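(* Let $N_0\ge 2$ be an integer and $1<s_0\le s_1$. Suppose $\phi$ is a sufficiently smooth function supported in $\mathcal{K}_{[s_0,s_1]}$, vanishing near $\partial\mathcal{K}$ and satisfying the Cauchy problem $$-\Box\phi=f,\qquad \phi|_{\mathcal{H}_{s_0}}=\phi_0,\qquad \partial_t\phi|_{\mathcal{H}_{s_0}}=\phi_1,$$ with $\phi_0,\phi_1$ being $C_c^\infty$ functions supported in $\mathcal{H}_{s_0}\cap\mathcal{K}$. Suppose that $f$ vanishes near $\partial\mathcal{K}$ and that, for some constants $A,B>0$ and all multi-indices $|I|\le N_0$, $$|Z^If(t,x)|\le A\,t^{-2}\quad\text{for }(t,x)\in\mathcal{K}_{[s_0,s_1]},\qquad \|Z^If\|_{L^2_f(\mathcal{H}_\tau)}\le B\,\tau^{-1}\quad\text{for }\tau\in[s_0,s_1].$$ Then there exists a constant $C>0$ (independent of $s_1$, $\phi$, $f$, $A$, $B$) such that, for all $|I|\le N_0-2$ and all $(t,x)\in\mathcal{K}_{[s_0,s_1]}$, writing $s=\sqrt{t^2-r^2}$, $$\sum_{\alpha}\big|s\,\partial_\alpha Z^I\phi\big|+\sum_\alpha\big|(t-r)(t/s)\,\partial_\alpha Z^I\phi\big|\le C\,D,$$ where $D$ is a constant depending only on $A$, $B$ and $\phi_0,\phi_1$.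
   Context: Coordinates on $\mathbb{R}^{1+2}$ are $(t,x)=(x^0,x^1,x^2)$, $r=|x|$, $\partial_\alpha=\partial_{x^\alpha}$ for $\alpha\in\{0,1,2\}$, $\partial_0=\partial_t$, and $-\Box=\partial_t^2-\partial_1^2-\partial_2^2$. Sets: $\mathcal{K}=\{(t,x): r<t-1\}$, $\partial\mathcal{K}=\{r=t-1\}$, $\mathcal{H}_s=\{(t,x): t>0,\ t^2-r^2=s^2\}$ for $s>1$, and $\mathcal{K}_{[s_0,s_1]}=\{(t,x)\in\mathcal{K}: s_0^2\le t^2-r^2\le s_1^2\}$. Lorentz boosts: $L_a=x_a\partial_t+t\partial_a$, $a=1,2$. For a multi-index $I=(\alpha_1,\dots,\alpha_5)$, $|I|=\alpha_1+\cdots+\alpha_5$ and $Z^I=\partial_0^{\alpha_1}\partial_1^{\alpha_2}\partial_2^{\alpha_3}L_1^{\alpha_4}L_2^{\alpha_5}$. Norms: $\|\phi\|_{L^p_f(\mathcal{H}_s)}^p=\int_{\mathbb{R}^2}|\phi(\sqrt{s^2+|x|^2},x)|^p\,dx$. *)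

(* Defs.v *)
(* MathComp-Analysis development, over an arbitrary [R : realType]. *)
From HB Require Import structures.
From mathcomp Require Import all_boot all_order all_algebra.
From mathcomp Require Import all_classical all_reals all_analysis.

Set Implicit Arguments.
Unset Strict Implicit.
Unset Printing Implicit Defensive.

Import Order.TTheory GRing.Theory Num.Theory.
Import numFieldNormedType.Exports.

Local Open Scope classical_set_scope.
Local Open Scope ring_scope.

Section Spacetime.
Context (R : realType).

(* A point (t, x) of R^{1+2} is the pair of t and x = (x^1, x^2). *)

(* The Euclidean length; the library norm on R * R is the sup norm. *)
Definition eucl_len (x : R * R) : R := Num.sqrt (x.1 ^+ 2 + x.2 ^+ 2).

Definition coord (a : 'I_3) (p : R * (R * R)) : R :=
  nth 0 [:: p.1; p.2.1; p.2.2] a.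

Definition basis_vec (a : 'I_3) : R * (R * R) :=
  ((val a == 0%N)%:R, ((val a == 1%N)%:R, (val a == 2%N)%:R)).

Definition pd (a : 'I_3) (g : R * (R * R) -> R) : R * (R * R) -> R :=
  fun p => 'D_(basis_vec a) g p.

Definition negbox (g : R * (R * R) -> R) : R * (R * R) -> R :=
  fun p => pd 0 (pd 0 g) p - pd 1 (pd 1 g) p - pd 2 (pd 2 g) p.

(* Used for the spatial indices a = 1, 2 only, where x_a = x^a. *)
Definition boost (a : 'I_3) (g : R * (R * R) -> R) : R * (R * R) -> R :=
  fun p => coord a p * pd 0 g p + p.1 * pd a g p.

Definition mlen (I : 'I_5 -> nat) : nat := (\sum_(j < 5) I j)%N.

Definition Z (I : 'I_5 -> nat) (g : R * (R * R) -> R) : R * (R * R) -> R :=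
  iter (I 0) (pd 0) (iter (I 1) (pd 1) (iter (I 2) (pd 2)
    (iter (I 3) (boost 1) (iter (I 4) (boost 2) g)))).

Definition cone : set (R * (R * R)) := [set p | eucl_len p.2 < p.1 - 1].

Definition bd_cone : set (R * (R * R)) := [set p | eucl_len p.2 = p.1 - 1].

Definition hyp_sq (p : R * (R * R)) : R := p.1 ^+ 2 - eucl_len p.2 ^+ 2.

(* The union of the full hyperboloids H_s, s0 <= s <= s1. *)
Definition slab (s0 s1 : R) : set (R * (R * R)) :=
  [set p | 0 < p.1 /\ s0 ^+ 2 <= hyp_sq p <= s1 ^+ 2].

Definition cone_slab (s0 s1 : R) : set (R * (R * R)) :=
  [set p | cone p /\ s0 ^+ 2 <= hyp_sq p <= s1 ^+ 2].

(* The global chart x |-> (sqrt (s^2 + |x|^2), x) of H_s; functions on H_s are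
   represented by functions of x. *)
Definition on_hyp (s : R) (x : R * R) : R * (R * R) :=
  (Num.sqrt (s ^+ 2 + eucl_len x ^+ 2), x).

Definition Lpf (p s : R) (g : R * (R * R) -> R) : \bar R :=
  Lnorm (@lebesgue_measure R \x @lebesgue_measure R)%E p%:E
    (fun x : R * R => (g (on_hyp s x))%:E).

(* g vanishes near the boundary of the cone, g being considered on U only *)
Definition vanishes_near_bd_cone (U : set (R * (R * R)))
    (g : R * (R * R) -> R) : Prop :=
  forall p, bd_cone p -> \forall q \near p, U q -> g q = 0.

End Spacetime.

(* g is of class C^k on the open set U, for V of finite dimension. *)
Fixpoint class_C (R : realType) (V : normedModType R) (k : nat) (U : set V)
    (g : V -> R) : Prop :=
  match k with
  | 0%N => forall p, U p -> {for p, continuous g}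
  | k'.+1 => (forall p, U p -> differentiable g p) /\
             (forall v : V, class_C k' U ('D_v g))
  end.

(* phi0, as a function of x in the chart on_hyp s0, is smooth with compact
   support contained in the intersection of H_{s0} with the cone *)
Definition cauchy_datum (R : realType) (s0 : R) (phi0 : R * R -> R) : Prop :=
  let supp := closure [set x | phi0 x != 0] in
  [/\ forall k, class_C k setT phi0,
      compact supp &
      supp `<=` [set x | cone (on_hyp s0 x)]].

(* A function on the closed region [slab s0 s1] is regular up to the boundary
   hyperboloids when it is regular on an open set U containing the region.
   The equation is imposed on U: when s0 < s1 this is no restriction, since only
   the values on the slab of f and of its derivatives matter, and when s0 = s1 it
   makes the derivatives of f transversal to H_{s0} those of - Box phi. *)
Definition cauchy_solution (R : realType) (k : nat) (s0 s1 : R)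
    (U : set (R * (R * R))) (f phi : R * (R * R) -> R)
    (phi0 phi1 : R * R -> R) : Prop :=
  [/\ open U /\ slab s0 s1 `<=` U,
      class_C k U phi,
      (forall p, U p -> ~ cone p -> phi p = 0) /\ vanishes_near_bd_cone U phi,
      forall p, U p -> negbox phi p = f p &
      forall x, phi (on_hyp s0 x) = phi0 x /\ pd 0 phi (on_hyp s0 x) = phi1 x].

(* Main.v *)
(** Each of the fields pd and boost commutes with -Box, so u = Z^J phi with
    |J| <= N0 solves -Box u = O(t^-2). A comparison principle for the wave
    equation between two hyperboloids holds: if -Box w >= 0, and w and its
    derivatives in future causal directions are nonnegative on H_{s0}, then
    w >= 0. It is proved by moving the vertex to (1, 0, 0) with a Lorentz map
    and differentiating in s a weighted integral of w over the part of H_s lying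
    in the backward light cone of the vertex, which tends to 2 pi w(1, 0, 0) as
    s -> 1. Compared with the supersolution
    4 s/t - 2 s0/t + r^2/(2 t^2) - 1/2, this gives |Z^J phi| = O(s/t).
    In particular L_a Z^I phi and L_a L_b Z^I phi are O(s/t) for |I| <= N0 - 2.
    With S = t pd_t + x . pd_x, the operator S^2 + S equals s^2 (-Box) up to such
    terms, so that s S(Z^I phi) has a derivative O(s/t) along the rays from the
    origin, on which s/t is constant. Hence S(Z^I phi) = O(s/t), and S, L_1, L_2
    together control s pd_a. On H_{s0} all derivatives of phi are computed from
    phi0, phi1 and derivatives of f of order at most N0, by solving the equation
    for pd_t^2 modulo the boosts, which are tangent to H_{s0}. All bounds are
    uniform over the solutions with the same A, phi0, phi1. *)

Require Import Defs.
From HB Require Import structures.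
From mathcomp Require Import all_boot all_order all_algebra.
From mathcomp Require Import all_classical all_reals all_analysis.
From mathcomp Require Import ring lra zify.

Set Implicit Arguments.
Unset Strict Implicit.
Unset Printing Implicit Defensive.

Import Order.TTheory GRing.Theory Num.Theory.
Import numFieldNormedType.Exports.

Local Open Scope classical_set_scope.
Local Open Scope ring_scope.

(** * Functions of class C^k *)

Section ClassC.
Context (R : realType) (V : normedModType R).
Implicit Types (U : set V) (g h : V -> R) (n : nat).

(** The weight behind the comparison principle is the fundamental solution
    [((1 - t)^2 - r^2)^(-1/2)] of the wave equation in two space dimensions. It is singular on the
    edge of the disc that the backward light cone cuts out of H_s, and its derivatives are not
    integrable there, which obstructs Green's formula. The angle [a] with
    [sqrt((1 - t)^2 - r^2) = (1 - s) cos a] on H_s removes the singularity: the integrand becomes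
    [mean_q], smooth up to the edge, and its derivative in [s] is the source density plus exact
    derivatives in [a] and [th]. An algebraic identity and the fundamental theorem of calculus in
    one variable thus take the place of the divergence theorem. Uniformity shapes everything after
    that, since the constants must be fixed before s1, phi and f. Estimates are stated for families
    over an index type [T], with the bound quantified before the index, and [T] finally becomes the
    type of all admissible solutions. *)

Lemma near_open_eq U g h p : open U -> U p -> (forall q, U q -> g q = h q) ->
  \forall q \near p, g q = h q.
Proof.
by move=> oU Up gh; apply: filterS (open_nbhs_nbhs (conj oU Up)) => q /gh.
Qed.

Lemma derive_open_eq U g h v : open U -> (forall q, U q -> g q = h q) ->
  forall p, U p -> 'D_v g p = 'D_v h p.
Proof. by move=> oU gh p Up; apply/near_eq_derive/(near_open_eq oU Up gh). Qed.

(** The differential of [g] gives a first-order expansion of [h] at [p], and uniqueness of the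
    differential turns it into differentiability of [h]. *)
Lemma differentiable_open_eq U g h p : open U -> U p ->
  (forall q, U q -> g q = h q) -> differentiable g p -> differentiable h p.
Proof.
move=> oU Up gh /diff_locallyP[cg eg].
have gh' := near_open_eq oU Up gh.
have E : h \o shift p = cst (h p) + 'd g p +o_ (0 : V) id.
  apply/eqaddoP => _/posnumP[e].
  move/eqaddoP: eg => /(_ e%:num (gt0 e)) eg.
  have gh0 : \forall y \near (0:V), g (y + p) = h (y + p).
    rewrite (near_shift p) /=; apply: filterS gh' => y /=.
    by rewrite sub0r addrNK.
  near=> y; rewrite -(gh p Up).
  have : g (y + p) = h (y + p) by near: y.
  move=> ghy.
  have : `|((g \o shift p) - (cst (g p) + 'd g p)) y| <= e%:num * `|y| by near: y.
  by rewrite !fctE /= ghy.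
by apply/diff_locallyP; rewrite (diff_unique cg E).
Unshelve. all: by end_near. Qed.

Lemma class_C_congr n U g h : open U -> (forall q, U q -> g q = h q) ->
  class_C n U g -> class_C n U h.
Proof.
elim: n g h => [|n IH] g h oU gh /=.
  move=> cg p Up.
  have gh' := near_open_eq oU Up gh.
  change (h q @[q --> p] --> h p); rewrite -(gh p Up).
  by apply: cvg_trans (cg p Up); apply: near_eq_cvg; apply: filterS gh'.
move=> [dg Dg]; split=> [p Up|v].
  exact: differentiable_open_eq oU Up gh (dg p Up).
exact: IH oU (derive_open_eq v oU gh) (Dg v).
Qed.

Lemma class_C_differentiable n U g p : class_C n.+1 U g -> U p ->
  differentiable g p.
Proof. by move=> [+ _]; exact. Qed.

Lemma class_C_derive n U g v : class_C n.+1 U g -> class_C n U ('D_v g).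
Proof. by move=> [_]; exact. Qed.

Lemma class_C_pred n U g : class_C n.+1 U g -> class_C n U g.
Proof.
elim: n g => [|n IH] g.
  by move=> [dg _] p Up; apply: differentiable_continuous; exact: dg.
by move=> [dg Dg]; split=> // v; apply: IH; exact: Dg.
Qed.

Lemma class_C_leq m n U g : (m <= n)%N -> class_C n U g -> class_C m U g.
Proof.
by move=> /subnKC <-; elim: (n - m)%N => [|d IH]; rewrite ?addn0// addnS => /class_C_pred.
Qed.

Lemma class_C_continuous n U g p : class_C n U g -> U p -> {for p, continuous g}.
Proof. by move=> /(class_C_leq (leq0n n)); exact. Qed.

Lemma class_C_derivable n U g p v : class_C n.+1 U g -> U p -> derivable g p v.
Proof. by move=> cg Up; apply/diff_derivable/(class_C_differentiable cg). Qed.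

Lemma class_C_sub n U U' g : U' `<=` U -> class_C n U g -> class_C n U' g.
Proof.
move=> sU; elim: n g => [|n IH] g /=; first by move=> cg p /sU /cg.
by move=> [dg Dg]; split=> [p /sU /dg//|v]; exact: IH.
Qed.

Lemma class_C_cst n U (c : R) : open U -> class_C n U (fun=> c).
Proof.
move=> oU; elim: n c => [|n IH] c /=; first by move=> p _; exact: cst_continuous.
split=> [p _|v]; first exact: differentiable_cst.
apply: (class_C_congr oU _ (IH 0)) => q _.
by rewrite derive_cst.
Qed.

Lemma class_C_add n U g h : open U -> class_C n U g -> class_C n U h ->
  class_C n U (fun p => g p + h p).
Proof.
move=> oU; elim: n g h => [|n IH] g h.
  by move=> cg ch p Up; apply: cvgD; [exact: cg|exact: ch].
move=> cg ch; split=> [p Up|v].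
  by apply: differentiableD; [exact: class_C_differentiable cg Up|
    exact: class_C_differentiable ch Up].
apply: (class_C_congr oU _ (IH _ _ (class_C_derive v cg) (class_C_derive v ch))).
move=> p Up; rewrite -deriveD//; [exact: class_C_derivable cg Up|].
exact: class_C_derivable ch Up.
Qed.

Lemma class_C_mul n U g h : open U -> class_C n U g -> class_C n U h ->
  class_C n U (fun p => g p * h p).
Proof.
move=> oU; elim: n g h => [|n IH] g h.
  by move=> cg ch p Up; apply: cvgM; [exact: cg|exact: ch].
move=> cg ch; split=> [p Up|v].
  by apply: differentiableM; [exact: class_C_differentiable cg Up|
    exact: class_C_differentiable ch Up].
have cg' := class_C_pred cg; have ch' := class_C_pred ch.
apply: (class_C_congr oU _ (class_C_add oU
  (IH _ _ cg' (class_C_derive v ch)) (IH _ _ ch' (class_C_derive v cg)))).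
move=> p Up /=; rewrite (@deriveM _ _ g h)//; [exact: class_C_derivable cg Up|].
exact: class_C_derivable ch Up.
Qed.

Lemma class_C_opp n U g : open U -> class_C n U g -> class_C n U (fun p => - g p).
Proof.
move=> oU cg; apply: (class_C_congr oU _ (class_C_mul oU (class_C_cst n (-1) oU) cg)).
by move=> p _; rewrite mulN1r.
Qed.

Lemma class_C_sub_fun n U g h : open U -> class_C n U g -> class_C n U h ->
  class_C n U (fun p => g p - h p).
Proof. by move=> oU cg ch; apply: class_C_add => //; exact: class_C_opp. Qed.

Lemma class_C_exp n U g m : open U -> class_C n U g ->
  class_C n U (fun p => g p ^+ m).
Proof.
move=> oU cg; elim: m => [|m IH].
  by apply: (class_C_congr oU _ (class_C_cst n 1 oU)) => p _; rewrite expr0.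
by apply: (class_C_congr oU _ (class_C_mul oU cg IH)) => p _; rewrite exprS.
Qed.

Lemma class_C_inv n U g : open U -> (forall p, U p -> g p != 0) ->
  class_C n U g -> class_C n U (fun p => (g p)^-1).
Proof.
move=> oU g0; elim: n g g0 => [|n IH] g g0.
  by move=> cg p Up; apply: cvgV; [exact: g0|exact: cg].
move=> cg; split=> [p Up|v].
  by apply: differentiableV; [exact: class_C_differentiable cg Up|exact: g0].
have cg' := IH _ g0 (class_C_pred cg).
apply: (class_C_congr oU _ (class_C_mul oU (class_C_opp oU
  (class_C_exp 2 oU cg')) (class_C_derive v cg))).
move=> p Up /=; rewrite (@deriveV _ _ g)//; [|exact: g0|exact: class_C_derivable cg Up].
by rewrite exprVn.
Qed.

Lemma differentiable_sqrt g p : 0 < g p -> differentiable g p ->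
  differentiable (fun q => Num.sqrt (g q)) p.
Proof.
move=> g0 dg; apply: (@differentiable_comp _ _ _ _ g Num.sqrt) => //.
by apply/derivable1_diffP; case: (is_derive1_sqrt g0).
Qed.

Lemma derive_sqrt_comp g p v : 0 < g p -> differentiable g p ->
  'D_v (fun q => Num.sqrt (g q)) p = (2 * Num.sqrt (g p))^-1 * 'D_v g p.
Proof.
move=> g0 dg; have sg := is_derive1_sqrt g0.
have ds : differentiable Num.sqrt (g p) by apply/derivable1_diffP; case: sg.
rewrite deriveE; last exact: differentiable_sqrt.
rewrite (@diff_comp _ _ _ _ g Num.sqrt)//= deriveE//.
by rewrite diff1E// derive1E; case: sg => _ ->; exact: mulrC.
Qed.

Lemma class_C_sqrt n U g : open U -> (forall p, U p -> 0 < g p) ->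
  class_C n U g -> class_C n U (fun p => Num.sqrt (g p)).
Proof.
move=> oU g0; elim: n => [|n IH].
  move=> cg p Up; apply: (@continuous_comp _ _ _ g Num.sqrt); first exact: cg.
  exact: sqrt_continuous.
move=> cg; split=> [p Up|v].
  by apply: differentiable_sqrt; [exact: g0|exact: class_C_differentiable cg Up].
have cs := IH (class_C_pred cg).
have s0 p : U p -> 2 * Num.sqrt (g p) != 0.
  by move=> Up; rewrite mulf_neq0// ?pnatr_eq0// gt_eqF// sqrtr_gt0 g0.
have ci := class_C_inv oU s0 (class_C_mul oU (class_C_cst n 2 oU) cs).
apply: (class_C_congr oU _ (class_C_mul oU ci (class_C_derive v cg))).
by move=> p Up /=; rewrite derive_sqrt_comp ?g0//; exact: class_C_differentiable cg Up.
Qed.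

Lemma class_C_linear n U (g : {linear V -> R}) : open U -> continuous g ->
  class_C n U g.
Proof.
move=> oU cg; case: n => [|n]; first by move=> p _; exact: cg.
have dg p : differentiable g p by exact: linear_differentiable.
split=> [p _//|v].
apply: (class_C_congr oU _ (class_C_cst n (g v) oU)) => p _.
by rewrite deriveE// diff_lin.
Qed.

End ClassC.

Lemma MVT_cc (R : realType) (f df : R -> R) (a b : R) : a < b ->
  (forall x, a <= x <= b -> is_derive x 1 f (df x)) ->
  exists2 c, a <= c <= b & f b - f a = df c * (b - a).
Proof.
move=> ab fd; have [||c cab E] := @MVT R f df a b ab.
- by move=> x; rewrite in_itv /= => /andP[/ltW ax /ltW xb]; apply: fd; rewrite ax.
- apply: derivable_within_continuous => x; rewrite in_itv /= => /fd[].
  by [].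
- exists c => //; move: cab.
  by rewrite in_itv /= => /andP[/ltW -> /ltW ->].
Qed.

(** * Symmetry of second derivatives *)

Section Schwarz.
Context (R : realType) (V : normedModType R).
Implicit Types (U : set V) (g : V -> R).

Lemma is_derive_comp_curve g (c : R -> V) (c' : V) (x : R) :
  differentiable g (c x) -> is_derive x 1 c c' ->
  is_derive x 1 (g \o c) ('D_c' g (c x)).
Proof.
move=> dg [dc <-].
have dc' : differentiable c x by apply/derivable1_diffP.
have dgc : differentiable (g \o c) x by apply: differentiable_comp.
apply: DeriveDef; first exact/derivable1_diffP.
by rewrite !deriveE// diff_comp.
Qed.

Lemma is_derive_line (q v : V) (x : R) :
  is_derive x 1 (fun a : R => q + a *: v) v.
Proof.
have dl : is_diff x (cst q + (fun a : R => a *: v)) (0 + (fun a : R => a *: v)).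
  exact: is_diffD.
have e1 : (fun a : R => q + a *: v) = cst q + (fun a : R => a *: v) by [].
rewrite e1; apply: DeriveDef; first exact/derivable1_diffP.
rewrite deriveE// diff_val.
by rewrite !fctE add0r scale1r.
Qed.

(** The second difference is the increment of [F], the difference of [g] along two parallel
    segments. The mean value theorem is used for [F] in the direction [v], then for ['D_v g] in the
    direction [w]. *)
Lemma mixed_difference_mean U g (p v w : V) (h : R) : 0 < h ->
  class_C 2 U g ->
  (forall a b : R, 0 <= a <= h -> 0 <= b <= h -> U (p + a *: v + b *: w)) ->
  exists a b : R, [/\ 0 <= a <= h, 0 <= b <= h &
    g (p + h *: v + h *: w) - g (p + h *: v) - g (p + h *: w) + g p =
    h ^+ 2 * 'D_w ('D_v g) (p + a *: v + b *: w)].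
Proof.
move=> h0 cg inU.
have h00 : 0 <= h <= h by rewrite lexx ltW.
have z0 : 0 <= (0 : R) <= h by rewrite lexx ltW.
have dg q : U q -> differentiable g q by exact: class_C_differentiable cg.
have dvg q : U q -> differentiable ('D_v g) q.
  exact: class_C_differentiable (class_C_derive v cg).
have inU1 (a : R) : 0 <= a <= h -> U (p + a *: v).
  by move=> ah; have := inU _ _ ah z0; rewrite scale0r addr0.
pose F a := g (p + h *: w + a *: v) - g (p + a *: v).
have dF (a : R) : 0 <= a <= h -> is_derive a 1 F
    ('D_v g (p + h *: w + a *: v) - 'D_v g (p + a *: v)).
  move=> ah; apply: is_deriveB; apply: (@is_derive_comp_curve g).
  - by rewrite -addrA [h *: w + _]addrC addrA; apply/dg/inU.
  - exact: is_derive_line.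
  - exact/dg/inU1.
  - exact: is_derive_line.
have [a ah Fa] := MVT_cc h0 dF.
pose G (b : R) : R := 'D_v g (p + a *: v + b *: w).
have dG (b : R) : 0 <= b <= h -> is_derive b 1 G ('D_w ('D_v g) (p + a *: v + b *: w)).
  move=> bh; apply: (@is_derive_comp_curve ('D_v g)); last exact: is_derive_line.
  exact/dvg/inU.
have [b bh Gb] := MVT_cc h0 dG.
exists a, b; split=> //.
move: Fa Gb; rewrite /F /G !subr0 !scale0r !addr0 !(addrAC p (h *: w)) => Fa Gb.
rewrite expr2 -mulrA [h * 'D_w _ _]mulrC -Gb mulrC -Fa.
by rewrite opprB addrA addrAC.
Qed.

Lemma near_norm_lt (p : V) (P : V -> Prop) : (\forall q \near p, P q) ->
  exists2 r : R, 0 < r & forall q, `|p - q| < r -> P q.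
Proof. by move=> /nbhs_normP[r r0 rP]; exists r => // q /rP. Qed.

Lemma continuous_eq_at (a b : V -> R) (p : V) :
  {for p, continuous a} -> {for p, continuous b} ->
  (forall r : R, 0 < r ->
    exists q q', [/\ `|p - q| < r, `|p - q'| < r & a q = b q']) ->
  a p = b p.
Proof.
move=> ca cb abr; suff ab (e : R) : 0 < e -> `|a p - b p| <= e.
  apply/eqP; rewrite -subr_eq0 -normr_eq0; apply/eqP/le_anti.
  by rewrite normr_ge0 andbT; apply/ler_addgt0Pl => e e0; rewrite addr0 ab.
move=> e0; have e20 : 0 < e / 2 by rewrite divr_gt0.
move/cvgrPdist_lt : ca => /(_ _ e20) /near_norm_lt[r1 r10 ra].
move/cvgrPdist_lt : cb => /(_ _ e20) /near_norm_lt[r2 r20 rb].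
have r0 : 0 < Num.min r1 r2 by rewrite lt_min r10.
have [q [q' [+ + aq]]] := abr _ r0; rewrite !lt_min => /andP[/ra qa _] /andP[_ /rb qb].
rewrite (_ : a p - b p = (a p - a q) - (b p - b q')); last by rewrite aq; ring.
apply/ltW/(le_lt_trans (ler_normB _ _)); rewrite [e]splitr; exact: ltrD.
Qed.

Lemma near_plane (p v w : V) (U : set V) : open U -> U p ->
  exists2 h : R, 0 < h &
    forall a b : R, 0 <= a <= h -> 0 <= b <= h -> U (p + a *: v + b *: w).
Proof.
move=> oU Up; have [r r0 rU] := near_norm_lt (open_nbhs_nbhs (conj oU Up)).
have m0 : 0 < `|v| + `|w| + 1 by rewrite ltr_wpDl// addr_ge0.
have h0 : 0 < r / (2 * (`|v| + `|w| + 1)) by rewrite divr_gt0// mulr_gt0.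
exists (r / (2 * (`|v| + `|w| + 1))) => // a b /andP[a0 ah] /andP[b0 bh].
apply: rU; rewrite -addrA opprD addrA subrr sub0r normrN.
apply: (le_lt_trans (ler_normD _ _)); rewrite !normrZ !ger0_norm//.
apply: (@le_lt_trans _ _ (r / (2 * (`|v| + `|w| + 1)) * (`|v| + `|w|))).
  by rewrite mulrDr lerD// ler_wpM2r.
apply: (@lt_trans _ _ (r / (2 * (`|v| + `|w| + 1)) * (`|v| + `|w| + 1))).
  by rewrite ltr_pM2l// ltrDl.
rewrite invfM mulrA -mulrA mulVf ?gt_eqF// mulr1.
by rewrite ltr_pdivrMr// mulr_natr mulr2n ltrDl.
Qed.

(** The second difference over a parallelogram is symmetric in [v] and [w], so by
    [mixed_difference_mean] the two mixed derivatives share a value arbitrarily close to [p], taken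
    at possibly different points. Their continuity concludes. *)
Lemma derive_commute U g (p v w : V) : open U -> class_C 2 U g -> U p ->
  'D_v ('D_w g) p = 'D_w ('D_v g) p.
Proof.
move=> oU cg Up.
apply: (@continuous_eq_at ('D_v ('D_w g)) ('D_w ('D_v g))).
- exact: (class_C_continuous (class_C_derive v (class_C_derive w cg)) Up).
- exact: (class_C_continuous (class_C_derive w (class_C_derive v cg)) Up).
move=> r r0; pose U' := U `&` [set q | `|p - q| < r].
have oU' : open U'.
  apply: openI => //; rewrite (_ : [set q | `|p - q| < r] = ball p r); first exact: ball_open.
  by rewrite -ball_normE.
have U'p : U' p by split; rewrite //= subrr normr0.
have cg' : class_C 2 U' g by apply: class_C_sub cg => q [].
have [h h0 inU] := near_plane v w oU' U'p.
have inU2 a b : 0 <= a <= h -> 0 <= b <= h -> U' (p + a *: w + b *: v).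
  by move=> ah bh; rewrite addrAC; exact: inU.
have [a [b [ah bh E1]]] := mixed_difference_mean h0 cg' inU.
have [a' [b' [ah' bh' E2]]] := mixed_difference_mean h0 cg' inU2.
exists (p + a' *: w + b' *: v), (p + a *: v + b *: w).
split; [by case: (inU2 _ _ ah' bh')|by case: (inU _ _ ah bh)|].
have h20 : h ^+ 2 != 0 by rewrite expf_neq0// gt_eqF.
apply: (mulfI h20); rewrite -E1 -E2 (addrAC p (h *: w)).
by congr (_ + _); exact: addrAC.
Qed.

End Schwarz.

(** * Integrals depending on a parameter *)

Section ParamIntegral.
Context (R : realType).
Notation mu := (@lebesgue_measure R).

Definition integ (a b : R) (f : R -> R) : R := \int[mu]_(y in `[a, b]) f y.

Definition slice (T : Type) (O : set (T * R)) (a b : R) : set T :=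
  [set x | forall y, a <= y <= b -> O (x, y)].

(** Tube lemma: by compactness of the segment, the neighbourhoods at the points [(x, y)] yield one
    neighbourhood of [x] valid for all [y]. *)
Lemma slice_near (T : topologicalType) (O : set (T * R)) (a b : R)
    (P : T -> R -> Prop) (x : T) :
  slice O a b x ->
  (forall p, O p -> \forall q \near p, P q.1 q.2) ->
  \forall x' \near x, forall y, a <= y <= b -> P x' y.
Proof.
move=> Ox OP.
have := @segment_compact R a b; rewrite compact_near_coveringP.
move=> /(_ T (nbhs x) (fun x' y => P x' y) _) cov.
have {}cov : \forall x' \near x, `[a, b]%classic `<=` P x'.
  apply: cov => y; rewrite /= in_itv /= => /Ox /OP [[A B] /= [nA nB] AB].
  by exists (B, A) => //= -[y' x'] [By Ax]; exact: (AB (x', y')).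
by apply: filterS cov => x' abP y aby; apply: abP; rewrite /= in_itv.
Qed.

Lemma slice_open (T : topologicalType) (O : set (T * R)) (a b : R) :
  open O -> open (slice O a b).
Proof.
rewrite openE => oO; rewrite openE => x Ox.
apply: (slice_near (O := O) (P := fun x y => O (x, y))) => // p /oO.
by apply: filterS => -[].
Qed.

Variables (a b : R).
Hypothesis ab : a < b.

Definition cont_on (f : R -> R) := forall y, a <= y <= b -> {for y, continuous f}.

Lemma cont_on_within f : cont_on f -> {within `[a, b], continuous f}.
Proof.
move=> cf; apply: continuous_in_subspaceT => y; rewrite inE /= in_itv /=.
exact: cf.
Qed.

Lemma cont_on_integrable f : cont_on f -> mu.-integrable `[a, b] (EFin \o f).
Proof.
move=> cf; apply: continuous_compact_integrable; first exact: segment_compact.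
exact: cont_on_within.
Qed.

Lemma integ_cst c : integ a b (fun=> c) = c * (b - a).
Proof.
rewrite /integ Rintegral_cst//; congr (_ * _).
rewrite -[X in fine X]/(@lebesgue_measure R `[a, b]) lebesgue_measure_itv.
by rewrite /= lte_fin ab -EFinB.
Qed.

Lemma integB f g : cont_on f -> cont_on g ->
  integ a b (fun y => f y - g y) = integ a b f - integ a b g.
Proof. by move=> cf cg; rewrite /integ RintegralB//; exact: cont_on_integrable. Qed.

Lemma integD f g : cont_on f -> cont_on g ->
  integ a b (fun y => f y + g y) = integ a b f + integ a b g.
Proof. by move=> cf cg; rewrite /integ RintegralD//; exact: cont_on_integrable. Qed.

Lemma eq_integ f g : (forall y, a <= y <= b -> f y = g y) ->
  integ a b f = integ a b g.
Proof.
by move=> fg; apply: eq_Rintegral => y; rewrite inE /= in_itv /=; exact: fg.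
Qed.

Lemma le_integ f g : cont_on f -> cont_on g ->
  (forall y, a <= y <= b -> f y <= g y) -> integ a b f <= integ a b g.
Proof.
move=> cf cg fg; have If := cont_on_integrable cf.
have Ig := cont_on_integrable cg; exact: (le_Rintegral _ If Ig).
Qed.

Lemma integ_ge0 f : (forall y, a <= y <= b -> 0 <= f y) -> 0 <= integ a b f.
Proof.
by move=> f0; apply: Rintegral_ge0 => y /=; rewrite in_itv /=; exact: f0.
Qed.

Lemma integ_dist f g e : cont_on f -> cont_on g ->
  (forall y, a <= y <= b -> `|f y - g y| <= e) ->
  `|integ a b f - integ a b g| <= e * (b - a).
Proof.
move=> cf cg fg; rewrite -integB// -integ_cst.
have cfg : cont_on (fun y => f y - g y).
  by move=> y aby; apply: cvgB; [exact: cf|exact: cg].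
have cc c : cont_on (fun=> c) by move=> y _; exact: cst_continuous.
rewrite ler_norml; apply/andP; split.
  rewrite integ_cst -mulNr -integ_cst; apply: le_integ => // y aby.
  by have := fg y aby; rewrite ler_norml => /andP[].
apply: le_integ => // y aby.
by have := fg y aby; rewrite ler_norml => /andP[].
Qed.

Lemma integ_derive f F : (forall y, a <= y <= b -> is_derive y 1 F (f y)) ->
  cont_on f -> integ a b f = F b - F a.
Proof.
move=> dF cf; rewrite /integ /Rintegral.
have cF : cont_on F.
  move=> y /dF[dFy _]; apply: differentiable_continuous.
  exact/derivable1_diffP.
have la : a <= a <= b by rewrite lexx ltW.
have lb : a <= b <= b by rewrite lexx ltW.
rewrite (continuous_FTC2 ab (cont_on_within cf) (F := F)) //=.
- split.
  + move=> y; rewrite ?inE ?in_itv /= => /andP[ay yb].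
    by have [] : is_derive y 1 F (f y) by apply: dF; rewrite !ltW.
  + exact: cvg_at_right_filter (cF a la).
  + exact: cvg_at_left_filter (cF b lb).
- move=> y; rewrite ?inE /= ?in_itv /= => /andP[ay yb].
  have [_ <-] : is_derive y 1 F (f y) by apply: dF; rewrite !ltW.
  by rewrite derive1E.
Qed.

Section continuity.
Context (T : topologicalType) (O : set (T * R)) (g : T -> R -> R).
Hypothesis cg : forall p, O p -> {for p, continuous (fun q => g q.1 q.2)}.

Lemma slice_cont_on x : slice O a b x -> cont_on (g x).
Proof.
move=> Ox y /Ox /cg c.
have cp : (fun y : R => (x, y)) @ y --> nbhs (x, y).
  by apply: (@cvg_pair _ _ _ (nbhs y) (nbhs x) (nbhs y)); [exact: cvg_cst|exact: cvg_id].
exact: (cvg_comp (fun y : R => (x, y)) (fun q : T * R => g q.1 q.2) cp c).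
Qed.

Lemma slice_dist_near e x : 0 < e -> slice O a b x ->
  \forall x' \near x, forall y, a <= y <= b -> `|g x' y - g x y| <= e.
Proof.
move=> e0 Ox.
(* The comparison with [g x] is available near points of the fibre over [x] only, so [slice_near] is
   applied to that fibre, which does not have to be open. *)
pose O' := O `&` [set p | p.1 = x].
have : slice O' a b x by move=> y aby; split => //; exact: Ox.
move=> /slice_near; apply=> -[x' y] [/= + ?]; subst x' => Oxy.
have /cvgrPdist_lt /(_ (e / 2)) : {for (x, y), continuous (fun q => g q.1 q.2)}.
  exact: cg.
rewrite divr_gt0// => /(_ isT) [[A B] /= [nA nB] AB].
exists (A, B) => //= -[x1 y1] /= [Ax1 By1].
have := AB (x1, y1) (conj Ax1 By1).
have := AB (x, y1) (conj (nbhs_singleton nA) By1) => /= h1 h2.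
have -> : g x1 y1 - g x y1 = (g x y - g x y1) - (g x y - g x1 y1).
  by rewrite opprB [RHS]addrC addrA subrK.
apply: (le_trans (ler_normB _ _)); apply/ltW; rewrite [e]splitr.
exact: ltrD.
Qed.

End continuity.

Lemma integ_continuous (T : topologicalType) (O : set (T * R))
    (g : T -> R -> R) (x : T) : open O ->
  (forall p, O p -> {for p, continuous (fun q => g q.1 q.2)}) ->
  slice O a b x -> {for x, continuous (fun x => integ a b (g x))}.
Proof.
move=> oO cg Ox; apply/cvgrPdist_le => e e0.
have ba : 0 < b - a by rewrite subr_gt0.
have eb : 0 < e / (b - a) by rewrite divr_gt0.
have nO : \forall x' \near x, slice O a b x'.
  by apply: open_nbhs_nbhs; split => //; exact: slice_open.
have := slice_dist_near cg eb Ox.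
apply: filterS2 nO => x' Ox' h.
rewrite distrC -[e](divfK (_ : b - a != 0)) ?gt_eqF//.
by apply: integ_dist => //; exact: (slice_cont_on cg).
Qed.

Lemma integ_is_derive (O : set (R * R)) (g g' : R -> R -> R) (x : R) : open O ->
  (forall p, O p -> is_derive p.1 1 (g ^~ p.2) (g' p.1 p.2)) ->
  (forall p, O p -> {for p, continuous (fun q => g q.1 q.2)}) ->
  (forall p, O p -> {for p, continuous (fun q => g' q.1 q.2)}) ->
  slice O a b x ->
  is_derive x 1 (fun x => integ a b (g x)) (integ a b (g' x)).
Proof.
move=> oO dg cg cg' Ox.
have nO : \forall x' \near x, slice O a b x'.
  by apply: open_nbhs_nbhs; split => //; exact: slice_open.
have nd := slice_dist_near cg' ltr01 Ox.
have [r r0 rO] : exists2 r : R, 0 < r & forall x', `|x - x'| < r ->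
    slice O a b x' /\ forall y, a <= y <= b -> `|g' x' y - g' x y| <= 1.
  by apply: near_norm_lt; near=> x'; split; near: x'; [exact: nO|exact: nd].
pose u := x - r; pose v := x + r.
have uvr z : z \in `]u, v[%R -> `|x - z| < r.
  by rewrite in_itv /= ltr_norml ltrBlDr ltrBrDl /u /v => /andP[? ?]; apply/andP; split; lra.
have Ix : `]u, v[%classic x.
  by rewrite /= in_itv /= /u /v; apply/andP; split; lra.
have intf z : `]u, v[%classic z -> mu.-integrable `[a, b] (EFin \o g z).
  by move=> /uvr /rO[Oz _]; apply/cont_on_integrable/(slice_cont_on cg).
have derf z y : `]u, v[%classic z -> `[a, b]%classic y -> derivable (g ^~ y) z 1.
  move=> /uvr /rO[Oz _]; rewrite /= in_itv /= => /Oz.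
  by move=> /dg[].
have d1E z y : `]u, v[%classic z -> `[a, b]%classic y ->
    partial1of2 g z y = g' z y.
  move=> /uvr /rO[Oz _]; rewrite /= in_itv /= => /Oz Ozy.
  by rewrite partial1of2E; have /= [] := dg _ Ozy.
(* An integrable majorant: [r] was chosen so that [g'] stays within 1 of its values over [x]. *)
pose G y := `|g' x y| + 1.
have G0 y : 0 <= G y by rewrite addr_ge0.
have intG : mu.-integrable `[a, b] (EFin \o G).
  apply: cont_on_integrable => y aby; apply: cvgD; last exact: cvg_cst.
  apply: cvg_norm; exact: (slice_cont_on cg').
have GP z y : `]u, v[%classic z -> `[a, b]%classic y -> `|partial1of2 g z y| <= G y.
  move=> uz aby; rewrite d1E//; have [_ h] := rO _ (uvr _ uz).
  move: aby; rewrite /= in_itv /= => /h {}h.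
  rewrite -[g' z y](subrK (g' x y)) addrC (le_trans (ler_normD _ _))//.
  by rewrite lerD2l.
apply: DeriveDef.
  exact: (derivable_under_integral _ Ix intf derf G0 intG GP).
rewrite -derive1E (differentiation_under_integral _ Ix intf derf G0 intG GP)//.
by apply: eq_Rintegral => y; rewrite inE => aby; exact: d1E.
Unshelve. all: by end_near. Qed.

End ParamIntegral.

(* With S = sin a, C = cos a, c = cos th, e = sin th, and H and its derivatives
   taken at the point [disc_pt s a th] below, this expresses d/ds of [mean_q] as
   s (1 - s) S (-Box H) plus the derivatives in a of [mean_Y] and in th of
   [mean_Z]. *)
Lemma mean_density_identity (F : numFieldType)
    (s S C c e k H Ht H1 H2 Htt Ht1 Ht2 H11 H12 H22 : F) : k != 0 ->
  k ^+ 2 = s + (1 - s) ^+ 2 * S ^+ 2 / 4 -> C ^+ 2 = 1 - S ^+ 2 ->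
  e ^+ 2 = 1 - c ^+ 2 ->
  let d := 1 - s in
  let t := s + d ^+ 2 * S ^+ 2 / 2 in
  let r := S * d * k in
  let ks := (1 - d * S ^+ 2 / 2) / (2 * k) in
  let ts := 1 - d * S ^+ 2 in
  let rs := S * (d * ks - k) in
  let ka := d ^+ 2 * S * C / (4 * k) in
  let ta := d ^+ 2 * S * C in
  let ra := d * (C * k + S * ka) in
  let W := s * (3 - s) + d ^+ 2 * S ^+ 2 in
  let W' := 3 - 2 * s - 2 * d * S ^+ 2 in
  let A := d * (s + d * S ^+ 2) in
  let A' := d * (1 - S ^+ 2) - (s + d * S ^+ 2) in
  let B := d * S * W / (2 * k) in
  let B' := S * ((d * W' - W) / (2 * k) - d * W * ks / (2 * k ^+ 2)) in
  let Hc := c * H1 + e * H2 in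
  let Htc := c * Ht1 + e * Ht2 in
  let Hcc := c ^+ 2 * H11 + 2 * c * e * H12 + e ^+ 2 * H22 in
  S * (ts * Ht + rs * Hc + A' * Ht + A * (ts * Htt + rs * Htc) + B' * Hc
    + B * (ts * Htc + rs * Hcc)) =
  s * d * S * (Htt - H11 - H22)
  + (((C ^+ 2 - S ^+ 2) / k - S * C * ka / k ^+ 2) * (r * Ht + t * Hc)
     + S * C / k * (ra * Ht + r * (ta * Htt + ra * Htc) + ta * Hc
                    + t * (ta * Htc + ra * Hcc)))
  + s / k * (r * (e ^+ 2 * H11 - 2 * e * c * H12 + c ^+ 2 * H22) - Hc).
Proof.
move=> k0 kE CE eE; cbv zeta.
have two : (2 : F) != 0 by rewrite pnatr_eq0.
(* With [S = 2 z] the relation for [k] has no denominator and can serve [field] as a rewriting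
   equation. *)
pose z := S / 2; have SE : S = 2 * z by rewrite /z; field.
have {}kE : k ^+ 2 = s + (1 - s) ^+ 2 * z ^+ 2 by rewrite kE SE; field.
have {}CE : C ^+ 2 = 1 - 4 * z ^+ 2 by rewrite CE SE; ring.
rewrite {}SE; move: z => z in kE CE *.
by field: kE CE eE.
Qed.

(** * Partial derivatives *)

Section Coordinates.
Context (R : realType).
Notation pt := (R * (R * R))%type.
Implicit Types (U : set pt) (f g h : pt -> R) (p : pt).

Lemma dir_basis (a b c : R) :
  (a, (b, c)) = a *: basis_vec R 0 + (b *: basis_vec R 1 + c *: basis_vec R 2) :> pt.
Proof.
rewrite /basis_vec /= /GRing.scale /= /GRing.scale /=; congr (_, (_, _)) => /=;
  rewrite /GRing.scale /=; ring.
Qed.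

Lemma derive_dir g p (a b c : R) : differentiable g p ->
  'D_(a, (b, c)) g p = a * pd 0 g p + b * pd 1 g p + c * pd 2 g p.
Proof.
move=> dg; rewrite /pd !(deriveE _ dg) dir_basis.
by rewrite linearD linearZ linearD !linearZ addrA.
Qed.

Lemma is_derive_curve g (a b c : R -> R) (a' b' c' x : R) :
  differentiable g (a x, (b x, c x)) ->
  is_derive x 1 a a' -> is_derive x 1 b b' -> is_derive x 1 c c' ->
  is_derive x 1 (fun x => g (a x, (b x, c x)))
    (a' * pd 0 g (a x, (b x, c x)) + b' * pd 1 g (a x, (b x, c x))
     + c' * pd 2 g (a x, (b x, c x))).
Proof.
move=> dg [da Ea] [db Eb] [dc Ec]; rewrite -(derive_dir _ _ _ dg).
apply: (@is_derive_comp_curve _ _ g (fun x => (a x, (b x, c x)))) => //.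
move/derivable1_diffP in da; move/derivable1_diffP in db.
move/derivable1_diffP in dc.
have dbc : differentiable (fun x => (b x, c x)) x by exact: differentiable_pair.
have dabc : differentiable (fun x => (a x, (b x, c x))) x.
  exact: differentiable_pair.
apply: DeriveDef; first exact/derivable1_diffP.
by rewrite -Ea -Eb -Ec !deriveE// !diff_pair.
Qed.

Lemma class_C_fst n U : open U -> class_C n U (fun p => p.1).
Proof. by move=> oU; apply: (class_C_linear n (g := fst) oU) => p; exact: cvg_fst. Qed.

Lemma class_C_x1 n U : open U -> class_C n U (fun p => p.2.1).
Proof.
move=> oU; apply: (class_C_linear n (g := fst \o snd) oU) => p.
by apply: cvg_comp; [exact: cvg_snd|exact: cvg_fst].
Qed.

Lemma class_C_x2 n U : open U -> class_C n U (fun p => p.2.2).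
Proof.
move=> oU; apply: (class_C_linear n (g := snd \o snd) oU) => p.
by apply: cvg_comp; exact: cvg_snd.
Qed.

Lemma class_C_pd n U g a : class_C n.+1 U g -> class_C n U (pd a g).
Proof. exact: class_C_derive. Qed.

Lemma pd_commute U g p a b : open U -> class_C 2 U g -> U p ->
  pd a (pd b g) p = pd b (pd a g) p.
Proof. exact: derive_commute. Qed.

Lemma pd_open_eq U g h a p : open U -> (forall q, U q -> g q = h q) -> U p ->
  pd a g p = pd a h p.
Proof. by move=> oU gh; exact: derive_open_eq. Qed.

Lemma pd_cst (c : R) a p : pd a (fun=> c) p = 0.
Proof. exact: derive_cst. Qed.

Lemma pdD g h a p : differentiable g p -> differentiable h p ->
  pd a (fun q => g q + h q) p = pd a g p + pd a h p.
Proof. by move=> dg dh; apply: deriveD; exact: diff_derivable. Qed.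

Lemma pdB g h a p : differentiable g p -> differentiable h p ->
  pd a (fun q => g q - h q) p = pd a g p - pd a h p.
Proof. by move=> dg dh; apply: deriveB; exact: diff_derivable. Qed.

Lemma pdM g h a p : differentiable g p -> differentiable h p ->
  pd a (fun q => g q * h q) p = g p * pd a h p + h p * pd a g p.
Proof.
by move=> dg dh; rewrite /pd (@deriveM _ _ g h)//; exact: diff_derivable.
Qed.

Lemma pd_scale (c : R) g a p : differentiable g p ->
  pd a (fun q => c * g q) p = c * pd a g p.
Proof.
move=> dg; have dc : differentiable (fun=> c : R) p by exact: differentiable_cst.
by rewrite (pdM a dc dg) pd_cst mulr0 addr0.
Qed.

Lemma pd_lin3 (x y z : R) f g h a p :
  differentiable f p -> differentiable g p -> differentiable h p ->
  pd a (fun q => x * f q + y * g q + z * h q) p =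
  x * pd a f p + y * pd a g p + z * pd a h p.
Proof.
move=> df dg dh.
have dZ c (k : pt -> R) : differentiable k p -> differentiable (fun q => c * k q) p.
  move=> dk; have dc : differentiable (fun=> c : R) p by exact: differentiable_cst.
  exact: (differentiableM dc dk).
have dfg := differentiableD (dZ x f df) (dZ y g dg).
by rewrite (pdD a dfg (dZ z h dh)) (pdD a (dZ x f df) (dZ y g dg)) !pd_scale.
Qed.

Lemma pdV g a p : differentiable g p -> g p != 0 ->
  pd a (fun q => (g q)^-1) p = - (g p) ^- 2 * pd a g p.
Proof. by move=> dg g0; rewrite /pd (@deriveV _ _ g)//; exact: diff_derivable. Qed.

Lemma pd_fst a p : pd a (fun q => q.1) p = (val a == 0%N)%:R.
Proof.
rewrite /pd deriveE; last by exact: (class_C_differentiable (class_C_fst 1 openT)).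
by rewrite (@diff_lin _ _ _ fst)//= => q; exact: cvg_fst.
Qed.

Lemma pd_x1 a p : pd a (fun q => q.2.1) p = (val a == 1%N)%:R.
Proof.
rewrite /pd deriveE; last by exact: (class_C_differentiable (class_C_x1 1 openT)).
rewrite (@diff_lin _ _ _ (fst \o snd))//= => q.
by apply: cvg_comp; [exact: cvg_snd|exact: cvg_fst].
Qed.

Lemma pd_x2 a p : pd a (fun q => q.2.2) p = (val a == 2%N)%:R.
Proof.
rewrite /pd deriveE; last by exact: (class_C_differentiable (class_C_x2 1 openT)).
rewrite (@diff_lin _ _ _ (snd \o snd))//= => q.
by apply: cvg_comp; exact: cvg_snd.
Qed.

End Coordinates.

(** * Rules for derivatives in one variable and for continuity *)

Section FunctionRules.
Context (R : realType).

Lemma is_derive_add (f g : R -> R) (x f' g' : R) : is_derive x 1 f f' ->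
  is_derive x 1 g g' -> is_derive x 1 (fun x => f x + g x) (f' + g').
Proof. exact: is_deriveD. Qed.

Lemma is_derive_opp (f : R -> R) (x f' : R) : is_derive x 1 f f' ->
  is_derive x 1 (fun x => - f x) (- f').
Proof. exact: is_deriveN. Qed.

Lemma is_derive_mul (f g : R -> R) (x f' g' : R) : is_derive x 1 f f' ->
  is_derive x 1 g g' -> is_derive x 1 (fun x => f x * g x) (f x * g' + g x * f').
Proof. exact: is_deriveM. Qed.

Lemma is_derive_const (c x : R) : is_derive x 1 (fun=> c) 0.
Proof. exact: is_derive_cst. Qed.

Lemma is_derive_var (x : R) : is_derive x 1 (fun x => x) 1.
Proof. exact: is_derive_id. Qed.

Lemma is_derive_inv (f : R -> R) (x f' : R) : f x != 0 -> is_derive x 1 f f' ->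
  is_derive x 1 (fun x => (f x)^-1) (- (f x) ^- 2 * f').
Proof.
move=> fx0 [df <-]; apply: DeriveDef; first exact: derivableV.
by rewrite (@deriveV _ _ f).
Qed.

Lemma is_derive_sqr (f : R -> R) (x f' : R) : is_derive x 1 f f' ->
  is_derive x 1 (fun x => f x ^+ 2) (2 * f x * f').
Proof.
move=> df; have := is_derive_mul df df => d2; apply: is_derive_eq.
by ring.
Qed.

Lemma is_derive_comp (g f : R -> R) (x f' g' : R) : is_derive (f x) 1 g g' ->
  is_derive x 1 f f' -> is_derive x 1 (fun x => g (f x)) (g' * f').
Proof. by move=> dg df; exact: is_derive1_comp. Qed.

Lemma is_derive_sqrt (f : R -> R) (x f' : R) : 0 < f x -> is_derive x 1 f f' ->
  is_derive x 1 (fun x => Num.sqrt (f x)) ((2 * Num.sqrt (f x))^-1 * f').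
Proof. by move=> f0; apply: is_derive_comp; exact: is_derive1_sqrt. Qed.

Context (T : topologicalType).
Implicit Types (f g : T -> R) (p : T).

Lemma continuous_add f g p : {for p, continuous f} -> {for p, continuous g} ->
  {for p, continuous (fun q => f q + g q)}.
Proof. exact: cvgD. Qed.

Lemma continuous_opp f p : {for p, continuous f} ->
  {for p, continuous (fun q => - f q)}.
Proof. exact: cvgN. Qed.

Lemma continuous_mul f g p : {for p, continuous f} -> {for p, continuous g} ->
  {for p, continuous (fun q => f q * g q)}.
Proof. exact: cvgM. Qed.

Lemma continuous_inv f p : f p != 0 -> {for p, continuous f} ->
  {for p, continuous (fun q => (f q)^-1)}.
Proof. by move=> f0 cf; exact: cvgV. Qed.

Lemma continuous_sqr f p : {for p, continuous f} ->
  {for p, continuous (fun q => f q ^+ 2)}.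
Proof. by move=> cf; exact: continuous_mul. Qed.

Lemma continuous_const (c : R) p : {for p, continuous (fun=> c)}.
Proof. exact: cvg_cst. Qed.

Lemma continuous_comp_fun (h : R -> R) f p : continuous h ->
  {for p, continuous f} -> {for p, continuous (fun q => h (f q))}.
Proof. by move=> ch cf; apply: (cvg_comp f h cf); exact: ch. Qed.

Lemma continuous_pt (a b c : T -> R) p :
  {for p, continuous a} -> {for p, continuous b} -> {for p, continuous c} ->
  {for p, continuous (fun q => (a q, (b q, c q)))}.
Proof.
move=> ca cb cc.
have cbc : (b q, c q) @[q --> p] --> nbhs (b p, c p).
  exact: (@cvg_pair T R R (nbhs p) (nbhs (b p)) (nbhs (c p))).
exact: (@cvg_pair T R (R * R)%type (nbhs p) (nbhs (a p)) (nbhs (b p, c p))).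
Qed.

Lemma continuous_comp_pt (h : R * (R * R) -> R) (a b c : T -> R) p :
  {for p, continuous a} -> {for p, continuous b} -> {for p, continuous c} ->
  {for (a p, (b p, c p)), continuous h} ->
  {for p, continuous (fun q => h (a q, (b q, c q)))}.
Proof.
move=> ca cb cc ch; have cabc := continuous_pt ca cb cc.
exact: (cvg_comp (fun q => (a q, (b q, c q))) h cabc ch).
Qed.

End FunctionRules.

Ltac derive_step := lazymatch goal with
  | |- is_derive _ _ (fun _ => ?c) _ => apply is_derive_const
  | |- is_derive _ _ (fun y => y) _ => apply is_derive_var
  | |- is_derive _ _ (fun y => @?f y + @?g y) _ => notypeclasses refine (@is_derive_add _ f g _ _ _ _ _)
  | |- is_derive _ _ (fun y => @?f y * @?g y) _ => notypeclasses refine (@is_derive_mul _ f g _ _ _ _ _)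
  | |- is_derive _ _ (fun y => - @?f y) _ => notypeclasses refine (@is_derive_opp _ f _ _ _)
  | |- is_derive _ _ (fun y => (@?f y) ^+ 2) _ => notypeclasses refine (@is_derive_sqr _ f _ _ _)
  | |- is_derive _ _ (fun y => (@?f y)^-1) _ => notypeclasses refine (@is_derive_inv _ f _ _ _ _)
  | |- is_derive _ _ (fun y => Num.sqrt (@?f y)) _ => notypeclasses refine (@is_derive_sqrt _ f _ _ _ _)
  | D : is_derive _ _ ?f _ |- is_derive _ _ ?f _ => notypeclasses refine D
  | D : is_derive _ _ ?f _ |- is_derive _ _ (fun y => ?f y) _ =>
      notypeclasses refine D
  end.
Ltac derive_rules := repeat derive_step; try assumption.
(* [notypeclasses]: instances of [is_derive] would otherwise be used for the
   subgoals and produce derivatives of an unpredictable shape *)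
Tactic Notation "derive_as" := notypeclasses refine (is_derive_eq _ _);
  [derive_rules|cbv beta].

Ltac continuous_step := lazymatch goal with
  | |- {for _, continuous (fun _ => ?c)} => apply continuous_const
  | |- {for _, continuous (fun y => @?f y + @?g y)} => apply (@continuous_add _ _ f g)
  | |- {for _, continuous (fun y => @?f y * @?g y)} => apply (@continuous_mul _ _ f g)
  | |- {for _, continuous (fun y => - @?f y)} => apply (@continuous_opp _ _ f)
  | |- {for _, continuous (fun y => (@?f y) ^+ 2)} => apply (@continuous_sqr _ _ f)
  | |- {for _, continuous (fun y => (@?f y)^-1)} => apply (@continuous_inv _ _ f)
  | |- {for _, continuous (fun y => Num.sqrt (@?f y))} =>
      apply (continuous_comp_fun (f := f) (@sqrt_continuous _))
  | C : {for _, continuous ?f} |- {for _, continuous ?f} => exact C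
  | C : {for _, continuous ?f} |- {for _, continuous (fun y => ?f y)} => exact C
  end.
Ltac continuous_rules := repeat continuous_step; try assumption.

(** * The comparison principle *)

Section MeanDensity.
Context (R : realType).
Notation pt := (R * (R * R))%type.
Implicit Types s a th : R.

(* For 0 <= a <= pi/2 and 0 <= th <= 2 pi, [disc_pt s a th] parametrises the
   part of H_s in the backward light cone of (1, 0, 0); a = pi/2 is its edge. The
   suffixes s and a on disc_k, disc_t, disc_r denote partial derivatives. *)
Definition disc_k (s a : R) := Num.sqrt (s + (1 - s) ^+ 2 * sin a ^+ 2 / 4).
Definition disc_t (s a : R) := s + (1 - s) ^+ 2 * sin a ^+ 2 / 2.
Definition disc_r (s a : R) := sin a * (1 - s) * disc_k s a.
Definition disc_pt (s a th : R) : pt :=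
  (disc_t s a, (disc_r s a * cos th, disc_r s a * sin th)).

Definition disc_ks (s a : R) := (1 - (1 - s) * sin a ^+ 2 / 2) / (2 * disc_k s a).
Definition disc_ts (s a : R) := 1 - (1 - s) * sin a ^+ 2.
Definition disc_rs (s a : R) := sin a * ((1 - s) * disc_ks s a - disc_k s a).
Definition disc_ka (s a : R) := (1 - s) ^+ 2 * sin a * cos a / (4 * disc_k s a).
Definition disc_ta (s a : R) := (1 - s) ^+ 2 * sin a * cos a.
Definition disc_ra (s a : R) :=
  (1 - s) * (cos a * disc_k s a + sin a * disc_ka s a).

Lemma disc_k2_gt0 s a : 0 < s -> 0 < s + (1 - s) ^+ 2 * sin a ^+ 2 / 4.
Proof. by move=> s0; rewrite ltr_pwDl// divr_ge0// mulr_ge0// sqr_ge0. Qed.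

Lemma disc_k_gt0 s a : 0 < s -> 0 < disc_k s a.
Proof. by move=> s0; rewrite sqrtr_gt0 disc_k2_gt0. Qed.

Lemma disc_k_sqr s a : 0 < s ->
  disc_k s a ^+ 2 = s + (1 - s) ^+ 2 * sin a ^+ 2 / 4.
Proof. by move=> s0; rewrite sqr_sqrtr// ltW// disc_k2_gt0. Qed.

Lemma disc_t_gt0 s a : 0 < s -> 0 < disc_t s a.
Proof. by move=> s0; rewrite ltr_pwDl// divr_ge0// mulr_ge0// sqr_ge0. Qed.

Lemma sin_sqr (a : R) : sin a ^+ 2 = 1 - cos a ^+ 2.
Proof. by rewrite -(cos2Dsin2 a); ring. Qed.

Lemma cos_sqr (a : R) : cos a ^+ 2 = 1 - sin a ^+ 2.
Proof. by rewrite -(cos2Dsin2 a); ring. Qed.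

Lemma hyp_sqE (p : pt) : hyp_sq p = p.1 ^+ 2 - p.2.1 ^+ 2 - p.2.2 ^+ 2.
Proof.
by rewrite /hyp_sq /eucl_len sqr_sqrtr ?addr_ge0 ?sqr_ge0// opprD addrA.
Qed.

Lemma hyp_sq_disc s a th : 0 < s -> hyp_sq (disc_pt s a th) = s ^+ 2.
Proof.
move=> s0; rewrite hyp_sqE /=.
transitivity (disc_t s a ^+ 2 - disc_r s a ^+ 2 * (cos th ^+ 2 + sin th ^+ 2)).
  by ring.
have := disc_k_sqr a s0; rewrite cos2Dsin2 mulr1 /disc_r /disc_t => kE.
rewrite (_ : (_ * disc_k s a) ^+ 2 = (sin a * (1 - s)) ^+ 2 * disc_k s a ^+ 2); last by ring.
by rewrite kE; field.
Qed.

Lemma is_derive_disc_k s a : 0 < s ->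
  is_derive s 1 (disc_k ^~ a) (disc_ks s a).
Proof.
move=> s0; have k0 := disc_k2_gt0 a s0; have k1 := disc_k_gt0 a s0.
rewrite /disc_k; derive_as.
rewrite /disc_ks /disc_k; field.
by rewrite gt_eqF.
Qed.

Lemma is_derive_disc_t s a : is_derive s 1 (disc_t ^~ a) (disc_ts s a).
Proof.
rewrite /disc_t; derive_as.
by rewrite /disc_ts; field.
Qed.

Lemma is_derive_disc_r s a : 0 < s -> is_derive s 1 (disc_r ^~ a) (disc_rs s a).
Proof.
move=> s0; have dk := is_derive_disc_k a s0.
rewrite /disc_r; derive_as.
by rewrite /disc_rs; ring.
Qed.

Lemma is_derive_disc_ka s a : 0 < s -> is_derive a 1 (disc_k s) (disc_ka s a).
Proof.
move=> s0; have k0 := disc_k2_gt0 a s0; have k1 := disc_k_gt0 a s0.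
have ds := is_derive_sin a.
rewrite /disc_k; derive_as.
rewrite /disc_ka /disc_k; field.
by rewrite gt_eqF.
Qed.

Lemma is_derive_disc_ta s a : is_derive a 1 (disc_t s) (disc_ta s a).
Proof.
have ds := is_derive_sin a.
rewrite /disc_t; derive_as.
by rewrite /disc_ta; field.
Qed.

Lemma is_derive_disc_ra s a : 0 < s -> is_derive a 1 (disc_r s) (disc_ra s a).
Proof.
move=> s0; have dk := is_derive_disc_ka a s0; have ds := is_derive_sin a.
rewrite /disc_r; derive_as.
by rewrite /disc_ra; ring.
Qed.

Lemma is_derive_disc_s (g : pt -> R) s a th : 0 < s ->
  differentiable g (disc_pt s a th) ->
  is_derive s 1 (fun s => g (disc_pt s a th))
    (disc_ts s a * pd 0 g (disc_pt s a th) + disc_rs s a *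
      (cos th * pd 1 g (disc_pt s a th) + sin th * pd 2 g (disc_pt s a th))).
Proof.
move=> s0 dg; have dt := is_derive_disc_t s a; have dr := is_derive_disc_r a s0.
have d1 : is_derive s 1 (fun s => disc_r s a * cos th) (disc_rs s a * cos th).
  by derive_as; ring.
have d2 : is_derive s 1 (fun s => disc_r s a * sin th) (disc_rs s a * sin th).
  by derive_as; ring.
have d : is_derive s 1 (fun s => g (disc_pt s a th)) (disc_ts s a * pd 0 g (disc_pt s a th) +
    (disc_rs s a * cos th) * pd 1 g (disc_pt s a th) + (disc_rs s a * sin th) * pd 2 g (disc_pt s a th)).
  exact: (@is_derive_curve R g (disc_t ^~ a) _ _ _ _ _ s dg dt d1 d2).
notypeclasses refine (is_derive_eq d _); move: (pd 0 g _) (pd 1 g _) (pd 2 g _) => g0 g1 g2.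
by ring.
Qed.

Lemma is_derive_disc_a (g : pt -> R) s a th : 0 < s ->
  differentiable g (disc_pt s a th) ->
  is_derive a 1 (fun a => g (disc_pt s a th))
    (disc_ta s a * pd 0 g (disc_pt s a th) + disc_ra s a *
      (cos th * pd 1 g (disc_pt s a th) + sin th * pd 2 g (disc_pt s a th))).
Proof.
move=> s0 dg; have dt := is_derive_disc_ta s a; have dr := is_derive_disc_ra a s0.
have d1 : is_derive a 1 (fun a => disc_r s a * cos th) (disc_ra s a * cos th).
  by derive_as; ring.
have d2 : is_derive a 1 (fun a => disc_r s a * sin th) (disc_ra s a * sin th).
  by derive_as; ring.
have d : is_derive a 1 (fun a => g (disc_pt s a th)) (disc_ta s a * pd 0 g (disc_pt s a th) +
    (disc_ra s a * cos th) * pd 1 g (disc_pt s a th) + (disc_ra s a * sin th) * pd 2 g (disc_pt s a th)).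
  exact: (@is_derive_curve R g (disc_t s) _ _ _ _ _ a dg dt d1 d2).
notypeclasses refine (is_derive_eq d _); move: (pd 0 g _) (pd 1 g _) (pd 2 g _) => g0 g1 g2.
by ring.
Qed.

Lemma is_derive_disc_th (g : pt -> R) s a th :
  differentiable g (disc_pt s a th) ->
  is_derive th 1 (fun th => g (disc_pt s a th))
    (disc_r s a *
      (cos th * pd 2 g (disc_pt s a th) - sin th * pd 1 g (disc_pt s a th))).
Proof.
move=> dg; have ds := is_derive_sin th; have dc := is_derive_cos th.
have d0 : is_derive th 1 (fun=> disc_t s a) 0 by derive_rules.
have d1 : is_derive th 1 (fun th => disc_r s a * cos th) (- (disc_r s a * sin th)).
  by derive_as; ring.
have d2 : is_derive th 1 (fun th => disc_r s a * sin th) (disc_r s a * cos th).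
  by derive_as; ring.
have d : is_derive th 1 (fun th => g (disc_pt s a th)) (0 * pd 0 g (disc_pt s a th) +
    (- (disc_r s a * sin th)) * pd 1 g (disc_pt s a th) + (disc_r s a * cos th) * pd 2 g (disc_pt s a th)).
  exact: (@is_derive_curve R g (fun=> disc_t s a) _ _ _ _ _ th dg d0 d1 d2).
notypeclasses refine (is_derive_eq d _); move: (pd 0 g _) (pd 1 g _) (pd 2 g _) => g0 g1 g2.
by ring.
Qed.

End MeanDensity.

Section MeanDensityDerivative.
Context (R : realType).
Notation pt := (R * (R * R))%type.
Implicit Types (s a th : R) (g : pt -> R).

Notation X := disc_pt.

Definition ang g1 g2 s a th := cos th * g1 (X s a th) + sin th * g2 (X s a th).

(** When [g0], [g1], [g2] are the partial derivatives of [g], this is [sin a] times the sum of [g]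
    and its derivative in the direction of [disc_direction_causal]; positivity on the initial
    hyperboloid comes from this form. The derivatives are separate arguments, so that [field] sees
    plain variables. *)
Definition mean_q g g0 g1 g2 s a th :=
  sin a * (g (X s a th)
    + (1 - s) * (s + (1 - s) * sin a ^+ 2) * g0 (X s a th)
    + (1 - s) * sin a * (s * (3 - s) + (1 - s) ^+ 2 * sin a ^+ 2) *
      (2 * disc_k s a)^-1 * ang g1 g2 s a th).

(** The flux along [a]: a multiple of the radial boost r pd_t + t pd_r, whose factor [sin a * cos a]
    vanishes at the centre and on the edge of the disc. *)
Definition mean_Y g0 g1 g2 s a th := sin a * cos a * (disc_k s a)^-1 *
  (disc_r s a * g0 (X s a th) + disc_t s a * ang g1 g2 s a th).

Definition mean_Z g1 g2 s a th := s * (disc_k s a)^-1 *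
  (cos th * g2 (X s a th) - sin th * g1 (X s a th)).

(** The product of -Box with the kernel [((1 - t)^2 - r^2)^(-1/2)], as a density in s, a, th. The
    volume element is [s (1 - s)^2 sin a cos a ds da dth] and the kernel equals
    [1 / ((1 - s) cos a)], so the zero of the former on the edge cancels the pole of the latter. *)
Definition mean_N g00 g11 g22 s a th := s * (1 - s) * sin a *
  (g00 (X s a th) - g11 (X s a th) - g22 (X s a th)).

Definition ang_ang g11 g12 g22 s a th :=
  cos th * ang g11 g12 s a th + sin th * ang g12 g22 s a th.

Definition mean_Ya g0 g1 g2 g00 g01 g02 g11 g12 g22 s a th :=
  ((cos a ^+ 2 - sin a ^+ 2) * (disc_k s a)^-1
    - sin a * cos a * disc_ka s a * (disc_k s a ^+ 2)^-1) *
  (disc_r s a * g0 (X s a th) + disc_t s a * ang g1 g2 s a th)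
  + sin a * cos a * (disc_k s a)^-1 *
  (disc_ra s a * g0 (X s a th) + disc_r s a *
     (disc_ta s a * g00 (X s a th) + disc_ra s a * ang g01 g02 s a th)
   + disc_ta s a * ang g1 g2 s a th + disc_t s a *
     (disc_ta s a * ang g01 g02 s a th
      + disc_ra s a * ang_ang g11 g12 g22 s a th)).

Definition mean_Zt g1 g2 g11 g12 g22 s a th := s * (disc_k s a)^-1 *
  (disc_r s a * (cos th * (cos th * g22 (X s a th) - sin th * g12 (X s a th))
    - sin th * (cos th * g12 (X s a th) - sin th * g11 (X s a th)))
   - ang g1 g2 s a th).

Variables (g g0 g1 g2 g00 g01 g02 g11 g12 g22 : pt -> R) (s a th : R).
Hypotheses (dg : differentiable g (X s a th)).
Hypotheses (dg0 : differentiable g0 (X s a th)).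
Hypotheses (dg1 : differentiable g1 (X s a th)).
Hypotheses (dg2 : differentiable g2 (X s a th)).
Hypotheses (E0 : pd 0 g (X s a th) = g0 (X s a th)).
Hypotheses (E1 : pd 1 g (X s a th) = g1 (X s a th)).
Hypotheses (E2 : pd 2 g (X s a th) = g2 (X s a th)).
Hypotheses (E00 : pd 0 g0 (X s a th) = g00 (X s a th)).
Hypotheses (E01 : pd 0 g1 (X s a th) = g01 (X s a th)).
Hypotheses (E02 : pd 0 g2 (X s a th) = g02 (X s a th)).
Hypotheses (E10 : pd 1 g0 (X s a th) = g01 (X s a th)).
Hypotheses (E20 : pd 2 g0 (X s a th) = g02 (X s a th)).
Hypotheses (E11 : pd 1 g1 (X s a th) = g11 (X s a th)).
Hypotheses (E12 : pd 1 g2 (X s a th) = g12 (X s a th)).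
Hypotheses (E21 : pd 2 g1 (X s a th) = g12 (X s a th)).
Hypotheses (E22 : pd 2 g2 (X s a th) = g22 (X s a th)).

Lemma is_derive_mean_Z :
  is_derive th 1 (mean_Z g1 g2 s a) (mean_Zt g1 g2 g11 g12 g22 s a th).
Proof.
have d1 := is_derive_disc_th dg1; have d2 := is_derive_disc_th dg2.
rewrite E11 E21 in d1; rewrite E12 E22 in d2.
have ds := is_derive_sin th; have dc := is_derive_cos th.
rewrite /mean_Z; derive_as.
rewrite /mean_Zt /ang.
move: (g1 _) (g2 _) (g11 _) (g12 _) (g22 _) => *.
by ring.
Qed.

Lemma is_derive_mean_Y : 0 < s ->
  is_derive a 1 (fun a => mean_Y g0 g1 g2 s a th)
    (mean_Ya g0 g1 g2 g00 g01 g02 g11 g12 g22 s a th).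
Proof.
move=> s0; have d0 := is_derive_disc_a s0 dg0.
have d1 := is_derive_disc_a s0 dg1.
have d2 := is_derive_disc_a s0 dg2.
rewrite E00 E10 E20 in d0; rewrite E01 E11 E21 in d1; rewrite E02 E12 E22 in d2.
have ds := is_derive_sin a; have dc := is_derive_cos a.
have dk := is_derive_disc_ka a s0; have dr := is_derive_disc_ra a s0.
have dt := is_derive_disc_ta s a.
have k0 : disc_k s a != 0 by rewrite gt_eqF// disc_k_gt0.
rewrite /mean_Y /ang; derive_as.
rewrite /mean_Ya /ang_ang /ang.
move: (g0 _) (g1 _) (g2 _) (g00 _) (g01 _) (g02 _) (g11 _) (g12 _) (g22 _).
move: (disc_k s a) (disc_ka s a) (disc_ra s a) (disc_ta s a) (disc_r s a) (disc_t s a) k0.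
by move=> k ka ra ta r t k0 *; field.
Qed.

Lemma is_derive_mean_q : 0 < s ->
  is_derive s 1 (fun s => mean_q g g0 g1 g2 s a th)
    (mean_N g00 g11 g22 s a th
     + mean_Ya g0 g1 g2 g00 g01 g02 g11 g12 g22 s a th
     + mean_Zt g1 g2 g11 g12 g22 s a th).
Proof.
move=> s0; have d := is_derive_disc_s s0 dg; have d0 := is_derive_disc_s s0 dg0.
have d1 := is_derive_disc_s s0 dg1; have d2 := is_derive_disc_s s0 dg2.
rewrite E0 E1 E2 in d; rewrite E00 E10 E20 in d0.
rewrite E01 E11 E21 in d1; rewrite E02 E12 E22 in d2.
have dk := is_derive_disc_k a s0.
have k0 : disc_k s a != 0 by rewrite gt_eqF// disc_k_gt0.
have k20 : 2 * disc_k s a != 0 by rewrite mulf_neq0.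
rewrite /mean_q /ang; derive_as.
rewrite /mean_N /mean_Ya /mean_Zt /ang_ang /ang.
have := mean_density_identity (g (X s a th)) (g0 (X s a th))
  (g1 (X s a th)) (g2 (X s a th)) (g00 (X s a th))
  (g01 (X s a th)) (g02 (X s a th)) (g11 (X s a th)) (g12 (X s a th))
  (g22 (X s a th)) k0 (disc_k_sqr a s0) (cos_sqr a) (sin_sqr th).
cbv zeta; rewrite /disc_ts /disc_rs /disc_ra /disc_ta /disc_ka /disc_ks /disc_r /disc_t.
move: (g _) (g0 _) (g1 _) (g2 _) (g00 _) (g01 _) (g02 _) (g11 _) (g12 _) (g22 _).
move: (disc_k s a) (sin a) (cos a) (sin th) (cos th) k0 {k20 dk d d0 d1 d2}.
move=> k S C e c k0 h h0 h1 h2 h00 h01 h02 h11 h12 h22 id.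
etransitivity; last first; first (etransitivity; first exact: id).
  by field.
by field.
Qed.

End MeanDensityDerivative.

Section MeanContinuity.
Context (R : realType).
Notation pt := (R * (R * R))%type.

Definition disc_dom (V : set pt) : set (R * R * R) :=
  [set p | 0 < p.1.1 /\ V (disc_pt p.1.1 p.1.2 p.2)].

Section continuity.
Variable p : R * R * R.

Let c11 : {for p, continuous (fun p : R * R * R => p.1.1)}.
Proof. by apply: (cvg_comp fst fst); [exact: cvg_fst|exact: cvg_fst]. Qed.

Let c12 : {for p, continuous (fun p : R * R * R => p.1.2)}.
Proof. by apply: (cvg_comp fst snd); [exact: cvg_fst|exact: cvg_snd]. Qed.

Let c2 : {for p, continuous (fun p : R * R * R => p.2)}.
Proof. exact: cvg_snd. Qed.

Let cs : {for p, continuous (fun p : R * R * R => sin p.1.2)}.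
Proof. exact: (continuous_comp_fun (@continuous_sin R) c12). Qed.

Let cc : {for p, continuous (fun p : R * R * R => cos p.1.2)}.
Proof. exact: (continuous_comp_fun (@continuous_cos R) c12). Qed.

Let cs2 : {for p, continuous (fun p : R * R * R => sin p.2)}.
Proof. exact: (continuous_comp_fun (@continuous_sin R) c2). Qed.

Let cc2 : {for p, continuous (fun p : R * R * R => cos p.2)}.
Proof. exact: (continuous_comp_fun (@continuous_cos R) c2). Qed.

Let ck : {for p, continuous (fun p : R * R * R => disc_k p.1.1 p.1.2)}.
Proof. by rewrite /disc_k; continuous_rules. Qed.

Let ct : {for p, continuous (fun p : R * R * R => disc_t p.1.1 p.1.2)}.
Proof. by rewrite /disc_t; continuous_rules. Qed.

Let cr : {for p, continuous (fun p : R * R * R => disc_r p.1.1 p.1.2)}.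
Proof. by rewrite /disc_r; continuous_rules. Qed.

Lemma continuous_disc_fun (g : pt -> R) :
  {for disc_pt p.1.1 p.1.2 p.2, continuous g} ->
  {for p, continuous (fun p : R * R * R => g (disc_pt p.1.1 p.1.2 p.2))}.
Proof.
by move=> cg; rewrite /disc_pt; apply: continuous_comp_pt => //; continuous_rules.
Qed.

Lemma open_nbhs_disc_dom (V : set pt) : open V -> disc_dom V p ->
  nbhs p (disc_dom V).
Proof.
move=> oV [s0 Vp].
have cX : {for p, continuous (fun q : R * R * R => disc_pt q.1.1 q.1.2 q.2)}.
  apply: (@continuous_pt _ _ (fun q : R * R * R => disc_t q.1.1 q.1.2)
    (fun q => disc_r q.1.1 q.1.2 * cos q.2) (fun q => disc_r q.1.1 q.1.2 * sin q.2)).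
  - exact: ct.
  - by continuous_rules.
  - by continuous_rules.
have {}cX : disc_pt q.1.1 q.1.2 q.2 @[q --> p] --> disc_pt p.1.1 p.1.2 p.2 := cX.
have nV : nbhs p [set q | V (disc_pt q.1.1 q.1.2 q.2)].
  by apply: cX; exact: open_nbhs_nbhs.
have n0 : nbhs p [set q : R * R * R | 0 < q.1.1].
  have h : q.1.1 @[q --> p] --> nbhs p.1.1 by exact: c11.
  by apply: (h [set x : R | 0 < x]); apply: open_nbhs_nbhs; split => //; exact: open_gt.
exact: (filterI n0 nV).
Qed.

Variables (g g0 g1 g2 g00 g01 g02 g11 g12 g22 : pt -> R).
Notation X := (disc_pt p.1.1 p.1.2 p.2).
Hypotheses (cg : {for X, continuous g}) (cg0 : {for X, continuous g0})
  (cg1 : {for X, continuous g1}) (cg2 : {for X, continuous g2})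
  (cg00 : {for X, continuous g00}) (cg01 : {for X, continuous g01})
  (cg02 : {for X, continuous g02}) (cg11 : {for X, continuous g11})
  (cg12 : {for X, continuous g12}) (cg22 : {for X, continuous g22}).
Hypothesis s0 : 0 < p.1.1.

Let k0 : disc_k p.1.1 p.1.2 != 0. Proof. by rewrite gt_eqF// disc_k_gt0. Qed.

Let k20 : 2 * disc_k p.1.1 p.1.2 != 0. Proof. by rewrite mulf_neq0. Qed.

Let kk0 : disc_k p.1.1 p.1.2 ^+ 2 != 0. Proof. by rewrite expf_neq0. Qed.

Let k40 : 4 * disc_k p.1.1 p.1.2 != 0. Proof. by rewrite mulf_neq0. Qed.

Let cka : {for p, continuous (fun p : R * R * R => disc_ka p.1.1 p.1.2)}.
Proof. by rewrite /disc_ka; continuous_rules. Qed.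

Let cta : {for p, continuous (fun p : R * R * R => disc_ta p.1.1 p.1.2)}.
Proof. by rewrite /disc_ta; continuous_rules. Qed.

Let cra : {for p, continuous (fun p : R * R * R => disc_ra p.1.1 p.1.2)}.
Proof. by rewrite /disc_ra; continuous_rules. Qed.

Let C := continuous_disc_fun.

Lemma continuous_mean_q :
  {for p, continuous (fun p : R * R * R => mean_q g g0 g1 g2 p.1.1 p.1.2 p.2)}.
Proof.
have := C cg; have := C cg0; have := C cg1; have := C cg2 => *.
by rewrite /mean_q /ang; continuous_rules.
Qed.

Lemma continuous_mean_Y :
  {for p, continuous (fun p : R * R * R => mean_Y g0 g1 g2 p.1.1 p.1.2 p.2)}.
Proof.
have := C cg0; have := C cg1; have := C cg2 => *.
by rewrite /mean_Y /ang; continuous_rules.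
Qed.

Lemma continuous_mean_N :
  {for p, continuous (fun p : R * R * R => mean_N g00 g11 g22 p.1.1 p.1.2 p.2)}.
Proof.
have := C cg00; have := C cg11; have := C cg22 => *.
by rewrite /mean_N; continuous_rules.
Qed.

Lemma continuous_mean_Ya :
  {for p, continuous (fun p : R * R * R =>
    mean_Ya g0 g1 g2 g00 g01 g02 g11 g12 g22 p.1.1 p.1.2 p.2)}.
Proof.
have := C cg0; have := C cg1; have := C cg2; have := C cg00; have := C cg01.
have := C cg02; have := C cg11; have := C cg12; have := C cg22 => *.
by rewrite /mean_Ya /ang_ang /ang; continuous_rules.
Qed.

Lemma continuous_mean_Zt :
  {for p, continuous (fun p : R * R * R =>
    mean_Zt g1 g2 g11 g12 g22 p.1.1 p.1.2 p.2)}.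
Proof.
have := C cg1; have := C cg2; have := C cg11; have := C cg12; have := C cg22 => *.
by rewrite /mean_Zt /ang; continuous_rules.
Qed.

End continuity.

Definition causal (v : pt) : Prop := eucl_len v.2 <= v.1.

(** The square of the time component minus that of the spatial length is
    [(1 - s)^2 s^3 cos^2 a / k^2]. For s < 1 the direction is thus timelike inside the disc and null
    on its edge. *)
Lemma disc_direction_causal (s a th : R) : 0 < s <= 1 ->
  let B := (1 - s) * sin a * (s * (3 - s) + (1 - s) ^+ 2 * sin a ^+ 2) *
    (2 * disc_k s a)^-1 in
  causal ((1 - s) * (s + (1 - s) * sin a ^+ 2), (B * cos th, B * sin th)).
Proof.
move=> /andP[s0 s1] B; rewrite /causal /eucl_len /=.
have -> : (B * cos th) ^+ 2 + (B * sin th) ^+ 2 = B ^+ 2.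
  by rewrite -[RHS]mulr1 -(cos2Dsin2 th); ring.
have A0 : 0 <= (1 - s) * (s + (1 - s) * sin a ^+ 2).
  apply: mulr_ge0; first by rewrite subr_ge0.
  by apply: addr_ge0; [exact: ltW|apply: mulr_ge0; rewrite ?subr_ge0 ?sqr_ge0].
rewrite sqrtr_sqr -(ger0_norm A0) -ler_sqr ?nnegrE// !real_normK ?num_real//.
rewrite -subr_ge0; have k0 := disc_k_gt0 a s0.
suff -> : ((1 - s) * (s + (1 - s) * sin a ^+ 2)) ^+ 2 - B ^+ 2 =
    (1 - s) ^+ 2 * s ^+ 3 * (cos a ^+ 2) / disc_k s a ^+ 2.
  apply: divr_ge0; last exact: sqr_ge0.
  apply: mulr_ge0; last exact: sqr_ge0.
  by apply: mulr_ge0; [exact: sqr_ge0|rewrite exprn_ge0// ltW].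
have kE := disc_k_sqr a s0; have cE := cos_sqr a; rewrite /B.
move: (disc_k s a) (sin a) (cos a) k0 kE cE => k S c k0 kE cE.
have k1 : k != 0 by rewrite gt_eqF.
apply: (@mulfI _ (4 * k ^+ 2)); first by rewrite mulf_neq0// expf_neq0.
rewrite cE; transitivity ((1 - s) ^+ 2 * ((s + (1 - s) * S ^+ 2) ^+ 2 * (4 * k ^+ 2)
   - S ^+ 2 * (s * (3 - s) + (1 - s) ^+ 2 * S ^+ 2) ^+ 2)); first by field.
transitivity (4 * (1 - s) ^+ 2 * s ^+ 3 * (1 - S ^+ 2)); last by field.
by rewrite kE; field.
Qed.

End MeanContinuity.

Section CenterComparison.
Context (R : realType).
Notation pt := (R * (R * R))%type.
Variables (V : set pt) (H : pt -> R) (e : R).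
Hypotheses (oV : open V) (cH : class_C 2 V H) (e0 : 0 < e) (e1 : e < 1).
Hypothesis slabV : forall p, slab e 1 p -> V p.
Hypothesis box_ge0 : forall p, slab e 1 p -> 0 <= negbox H p.
Hypothesis data_ge0 : forall p, 0 < p.1 -> hyp_sq p = e ^+ 2 ->
  0 <= H p /\ forall v, causal v -> 0 <= 'D_v H p.

Notation dom := (disc_dom V).
Notation Q := (mean_q H (pd 0 H) (pd 1 H) (pd 2 H)).
Notation Y := (mean_Y (pd 0 H) (pd 1 H) (pd 2 H)).
Notation ZZ := (mean_Z (pd 1 H) (pd 2 H)).
Notation N := (mean_N (pd 0 (pd 0 H)) (pd 1 (pd 1 H)) (pd 2 (pd 2 H))).
Notation Ya := (mean_Ya (pd 0 H) (pd 1 H) (pd 2 H) (pd 0 (pd 0 H))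
  (pd 0 (pd 1 H)) (pd 0 (pd 2 H)) (pd 1 (pd 1 H)) (pd 1 (pd 2 H)) (pd 2 (pd 2 H))).
Notation Zt := (mean_Zt (pd 1 H) (pd 2 H) (pd 1 (pd 1 H)) (pd 1 (pd 2 H))
  (pd 2 (pd 2 H))).

Let diffH p : V p -> differentiable H p.
Proof. exact: class_C_differentiable cH. Qed.

Let diffpH i p : V p -> differentiable (pd i H) p.
Proof. exact: (class_C_differentiable (class_C_pd i cH)). Qed.

Let contH p : V p -> {for p, continuous H}.
Proof. exact: class_C_continuous cH. Qed.

Let contpH i p : V p -> {for p, continuous (pd i H)}.
Proof. exact: (class_C_continuous (class_C_pd i cH)). Qed.

Let contppH i j p : V p -> {for p, continuous (pd i (pd j H))}.
Proof. exact: (class_C_continuous (class_C_pd i (class_C_pd j cH))). Qed.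

Let comm i j p : V p -> pd i (pd j H) p = pd j (pd i H) p.
Proof. exact: pd_commute. Qed.

Let dQ (s a th : R) : dom ((s, a), th) ->
  is_derive s 1 (fun s => Q s a th) (N s a th + Ya s a th + Zt s a th).
Proof.
move=> [/= s0 VX].
exact: (is_derive_mean_q (diffH VX) (diffpH 0 VX) (diffpH 1 VX) (diffpH 2 VX)
  erefl erefl erefl erefl erefl erefl (comm 1 0 VX) (comm 2 0 VX)
  erefl erefl (comm 2 1 VX) erefl s0).
Qed.

Let dY (s a th : R) : dom ((s, a), th) ->
  is_derive a 1 (fun a => Y s a th) (Ya s a th).
Proof.
move=> [/= s0 VX].
exact: (is_derive_mean_Y (diffpH 0 VX) (diffpH 1 VX) (diffpH 2 VX)
  erefl erefl erefl (comm 1 0 VX) (comm 2 0 VX)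
  erefl erefl (comm 2 1 VX) erefl s0).
Qed.

Let dZ (s a th : R) : dom ((s, a), th) ->
  is_derive th 1 (ZZ s a) (Zt s a th).
Proof.
move=> [/= s0 VX].
exact: (is_derive_mean_Z (diffpH 1 VX) (diffpH 2 VX)
  erefl erefl (comm 2 1 VX) erefl).
Qed.

Let open_dom : open dom.
Proof. by rewrite openE => p; exact: open_nbhs_disc_dom. Qed.

Let cQ p : dom p -> {for p, continuous (fun p => Q p.1.1 p.1.2 p.2)}.
Proof. by move=> [s0 VX]; apply: continuous_mean_q; auto. Qed.

Let cY p : dom p -> {for p, continuous (fun p => Y p.1.1 p.1.2 p.2)}.
Proof. by move=> [s0 VX]; apply: continuous_mean_Y; auto. Qed.

Let cN p : dom p -> {for p, continuous (fun p => N p.1.1 p.1.2 p.2)}.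
Proof. by move=> [s0 VX]; apply: continuous_mean_N; auto. Qed.

Let cYa p : dom p -> {for p, continuous (fun p => Ya p.1.1 p.1.2 p.2)}.
Proof. by move=> [s0 VX]; apply: continuous_mean_Ya; auto. Qed.

Let cZt p : dom p -> {for p, continuous (fun p => Zt p.1.1 p.1.2 p.2)}.
Proof. by move=> [s0 VX]; apply: continuous_mean_Zt; auto. Qed.

Let DQ (x : R * R) (th : R) := N x.1 x.2 th + Ya x.1 x.2 th + Zt x.1 x.2 th.

Let cDQ p : dom p -> {for p, continuous (fun p => DQ p.1 p.2)}.
Proof.
move=> dp; have := cN dp; have := cYa dp; have := cZt dp => *.
by rewrite /DQ; continuous_rules.
Qed.

Notation P2 := (pi *+ 2).

Let P20 : 0 < P2 :> R. Proof. by rewrite pmulrn_lgt0// pi_gt0. Qed.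

Let dom2 : set (R * R) := slice dom 0 P2.

Let open_dom2 : open dom2. Proof. exact: slice_open. Qed.

Let comp_cont (m : R * R -> R * R * R) (G : R * R * R -> R) z :
  {for z, continuous m} -> {for m z, continuous G} ->
  {for z, continuous (fun z => G (m z))}.
Proof. by move=> cm cG; exact: (cvg_comp m G cm cG). Qed.

(** [ms] and [ma] freeze one of the first two variables, so that [integ_is_derive], which has one
    parameter and one integration variable, applies to the other. *)
Let ms (a : R) (z : R * R) : R * R * R := ((z.1, a), z.2).
Let ma (s : R) (z : R * R) : R * R * R := ((s, z.1), z.2).

Let cms a : continuous (ms a).
Proof.
move=> z; apply: (@cvg_pair _ _ _ (nbhs z) (nbhs (z.1, a)) (nbhs z.2)); last exact: cvg_snd.
apply: (@cvg_pair _ _ _ (nbhs z) (nbhs z.1) (nbhs a)); last exact: cvg_cst.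
exact: cvg_fst.
Qed.

Let cma s : continuous (ma s).
Proof.
move=> z; apply: (@cvg_pair _ _ _ (nbhs z) (nbhs (s, z.1)) (nbhs z.2)); last exact: cvg_snd.
apply: (@cvg_pair _ _ _ (nbhs z) (nbhs s) (nbhs z.1)); first exact: cvg_cst.
exact: cvg_fst.
Qed.

Let F (x : R * R) := integ 0 P2 (Q x.1 x.2).
Let DF (x : R * R) := integ 0 P2 (DQ x).

Let cF x : dom2 x -> {for x, continuous F}.
Proof. exact: (integ_continuous P20 open_dom (g := fun x => Q x.1 x.2)). Qed.

Let cDF x : dom2 x -> {for x, continuous DF}.
Proof. exact: (integ_continuous P20 open_dom (g := DQ)). Qed.

Let open_ms a : open (ms a @^-1` dom).
Proof. by apply: open_comp => // z _; exact: cms. Qed.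

Let open_ma s : open (ma s @^-1` dom).
Proof. by apply: open_comp => // z _; exact: cma. Qed.

Let dF (s a : R) : dom2 (s, a) -> is_derive s 1 (fun s => F (s, a)) (DF (s, a)).
Proof.
move=> dsa; pose O := ms a @^-1` dom.
have h1 z : O z -> is_derive z.1 1 (fun s => Q s a z.2) (DQ (z.1, a) z.2).
  exact: dQ.
have h2 z : O z -> {for z, continuous (fun z => Q z.1 a z.2)}.
  by move=> /cQ; exact: (@comp_cont (ms a) (fun p => Q p.1.1 p.1.2 p.2) z (@cms a z)).
have h3 z : O z -> {for z, continuous (fun z => DQ (z.1, a) z.2)}.
  by move=> /cDQ; exact: (@comp_cont (ms a) (fun p => DQ p.1 p.2) z (@cms a z)).
exact: (@integ_is_derive R 0 P2 O
  (fun s th => Q s a th) (fun s th => DQ (s, a) th) s (@open_ms a) h1 h2 h3 dsa).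
Qed.

Let G (s a : R) := integ 0 P2 (Y s a).

Let dG (s a : R) : dom2 (s, a) -> is_derive a 1 (G s) (integ 0 P2 (Ya s a)).
Proof.
move=> dsa; pose O := ma s @^-1` dom.
have h1 z : O z -> is_derive z.1 1 (fun a => Y s a z.2) (Ya s z.1 z.2).
  exact: dY.
have h2 z : O z -> {for z, continuous (fun z => Y s z.1 z.2)}.
  by move=> /cY; exact: (@comp_cont (ma s) (fun p => Y p.1.1 p.1.2 p.2) z (@cma s z)).
have h3 z : O z -> {for z, continuous (fun z => Ya s z.1 z.2)}.
  by move=> /cYa; exact: (@comp_cont (ma s) (fun p => Ya p.1.1 p.1.2 p.2) z (@cma s z)).
exact: (@integ_is_derive R 0 P2 O (Y s) (Ya s) a (@open_ma s) h1 h2 h3 dsa).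
Qed.

Let sinc (b : R) : cont_on 0 b (@sin R).
Proof. by move=> y _; exact: continuous_sin. Qed.

Let dom2_slab (s a : R) : e <= s <= 1 -> dom2 (s, a).
Proof.
move=> /andP[es s1] th _; have s0 : 0 < s := lt_le_trans e0 es.
split=> //=; apply: slabV; split; first exact: disc_t_gt0.
rewrite hyp_sq_disc// expr1n ler_sqr ?nnegrE ?(ltW e0) ?(ltW s0)// es /=.
by rewrite expr_le1// ltW.
Qed.

Notation P1 := (pi / 2).

Let P10 : 0 < P1 :> R. Proof. by rewrite divr_gt0// pi_gt0. Qed.

Let sin_P1_ge0 (a : R) : 0 <= a <= P1 -> 0 <= sin a.
Proof.
move=> /andP[a0 aP]; apply: sin_ge0_pi; rewrite a0 /=.
by apply: (le_trans aP); rewrite ler_pdivrMr// ler_peMr ?ler1n// pi_ge0.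
Qed.

Let slice_dom2 (s : R) : e <= s <= 1 -> slice dom2 0 P1 s.
Proof. by move=> es a _; exact: dom2_slab. Qed.

(** [Zt] contributes nothing to the integral, being the derivative in [th] of a function of period
    [2 pi]. *)
Let DF_split (s a : R) : e <= s <= 1 ->
  DF (s, a) = integ 0 P2 (N s a) + integ 0 P2 (Ya s a).
Proof.
move=> es; have ds := dom2_slab a es.
have kN : cont_on 0 P2 (N s a).
  exact: (slice_cont_on (g := fun x => N x.1 x.2) cN ds).
have kY : cont_on 0 P2 (Ya s a).
  exact: (slice_cont_on (g := fun x => Ya x.1 x.2) cYa ds).
have kZ : cont_on 0 P2 (Zt s a).
  exact: (slice_cont_on (g := fun x => Zt x.1 x.2) cZt ds).
have kNY : cont_on 0 P2 (fun th => N s a th + Ya s a th).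
  by move=> th thP; apply: continuous_add; [exact: kN|exact: kY].
rewrite /DF /DQ /= integD//= integD//.
rewrite [X in _ + X](_ : _ = 0) ?addr0//.
have dZ' th : 0 <= th <= P2 -> is_derive th 1 (ZZ s a) (Zt s a th).
  by move=> thP; exact/dZ/ds.
rewrite (integ_derive P20 dZ' kZ).
by rewrite /mean_Z /disc_pt cos2pi sin2pi cos0 sin0 subrr.
Qed.

Let IN_ge0 (s a : R) : e <= s <= 1 -> 0 <= a <= P1 -> 0 <= integ 0 P2 (N s a).
Proof.
move=> es aP; have ds := dom2_slab a es; have /andP[es' s1] := es.
have s0 : 0 < s := lt_le_trans e0 es'.
apply: integ_ge0 => th _; apply: mulr_ge0; last first.
  apply: (box_ge0 (p := disc_pt s a th)); split; first exact: disc_t_gt0.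
  rewrite hyp_sq_disc// expr1n ler_sqr ?nnegrE ?(ltW e0) ?(ltW s0)// es' /=.
  by rewrite expr_le1// ltW.
apply: mulr_ge0; last exact: sin_P1_ge0.
by apply: mulr_ge0; [exact: ltW|rewrite subr_ge0].
Qed.

Let total (s : R) := integ 0 P1 (fun a => F (s, a)).

Let d_total (s : R) : e <= s <= 1 ->
  is_derive s 1 total (integ 0 P1 (fun a => DF (s, a))).
Proof.
move=> es.
have h1 z : dom2 z -> is_derive z.1 1 (fun s => F (s, z.2)) (DF (z.1, z.2)).
  by case: z => s' a' /= dz; exact: dF.
exact: (@integ_is_derive R 0 P1 dom2 (fun s a => F (s, a))
  (fun s a => DF (s, a)) s open_dom2 h1 cF cDF (slice_dom2 es)).
Qed.

(** The integral of [Ya] over [a] vanishes because [mean_Y] is zero at a = 0 and at a = pi/2: no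
    flux crosses the centre or the edge. What remains is the integral of [N], which has the sign of
    -Box H. *)
Let d_total_ge0 (s : R) : e <= s <= 1 -> 0 <= integ 0 P1 (fun a => DF (s, a)).
Proof.
move=> es; have sl := slice_dom2 es.
pose IY (x : R * R) := integ 0 P2 (Ya x.1 x.2).
have cIY x : dom2 x -> {for x, continuous IY}.
  exact: (integ_continuous P20 open_dom (g := fun x => Ya x.1 x.2)).
have kIY : cont_on 0 P1 (fun a => IY (s, a)).
  exact: (slice_cont_on (g := fun s a => IY (s, a)) cIY sl).
have kDF : cont_on 0 P1 (fun a => DF (s, a)).
  exact: (slice_cont_on (g := fun s a => DF (s, a)) cDF sl).
have G0 a : sin a * cos a = 0 -> G s a = 0.
  move=> a0; rewrite /G (eq_integ (g := fun=> 0)) ?integ_cst ?mul0r//.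
  by move=> th _; rewrite /mean_Y a0 !mul0r.
have dG' a : 0 <= a <= P1 -> is_derive a 1 (G s) (IY (s, a)).
  by move=> aP; apply: dG; exact: sl.
have IY0 : integ 0 P1 (fun a => IY (s, a)) = 0.
  rewrite (integ_derive P10 dG' kIY).
  by rewrite !G0 ?subrr// ?sin0 ?mul0r// cos_pihalf mulr0.
have IYDF a : 0 <= a <= P1 -> IY (s, a) <= DF (s, a).
  by move=> aP; rewrite DF_split// lerDr; exact: IN_ge0.
by have := le_integ kIY kDF IYDF; rewrite IY0.
Qed.

(** Up to the factor [sin a], the integrand is the sum of [H] and of its derivative in a causal
    direction, both nonnegative on H_e by [data_ge0]. *)
Let total_e_ge0 : 0 <= total e.
Proof.
have ee : e <= e <= 1 by rewrite lexx ltW.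
apply: integ_ge0 => a aP; apply: integ_ge0 => th thP /=.
apply: mulr_ge0; first exact: sin_P1_ge0.
have [H0 dH] := data_ge0 (disc_t_gt0 a e0 : 0 < (disc_pt e a th).1)
  (hyp_sq_disc a th e0).
have eI : 0 < e <= 1 by rewrite e0 ltW.
have := dH _ (disc_direction_causal a th eI).
have [/= _ VX] := dom2_slab a ee thP.
rewrite (derive_dir _ _ _ (diffH VX)) => dv.
rewrite -addrA; apply: addr_ge0 => //; apply: le_trans dv _; rewrite /ang.
rewrite le_eqVlt; apply/orP; left; apply/eqP.
by move: (pd 0 H _) (pd 1 H _) (pd 2 H _) (disc_k e a) => *; ring.
Qed.

Lemma center_comparison : 0 <= H (1, (0, 0)).
Proof.
have [c cI E] := MVT_cc e1 d_total.
have : 0 <= total 1.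
  rewrite -(subrK (total e) (total 1)) E; apply: addr_ge0 => //.
  by apply: mulr_ge0; [exact: d_total_ge0|rewrite subr_ge0 ltW].
(* At s = 1 the disc has shrunk to the vertex, the factors 1 - s remove the derivatives from
   [mean_q], and [sin] has integral 1 over [0, pi/2]. *)
have -> : total 1 = H (1, (0, 0)) * P2.
  have kF a : F (1, a) = sin a * (H (1, (0, 0)) * P2).
    rewrite /F mulrA -[P2 in RHS]subr0 -integ_cst//; apply: eq_integ => th _.
    rewrite /mean_q /= !subrr !mul0r !addr0; congr (_ * H (_, (_, _))).
    + by rewrite /disc_t subrr expr0n /= !mul0r addr0.
    + by rewrite /disc_r subrr mulr0 !mul0r.
    + by rewrite /disc_r subrr mulr0 !mul0r.
  pose K := H (1, (0, 0)) * P2.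
  have dK (a : R) : 0 <= a <= P1 ->
      is_derive a 1 (fun a => - (cos a * K)) (sin a * K).
    by move=> _; have dc := is_derive_cos a; derive_as; ring.
  have kK : cont_on 0 P1 (fun a => sin a * K).
    by move=> a aP; have cs := sinc aP; continuous_rules.
  rewrite /total (eq_integ (g := fun a => sin a * K)); last by move=> a _; exact: kF.
  rewrite (integ_derive P10 dK kK) cos_pihalf cos0 /K; ring.
by rewrite pmulr_lge0.
Qed.

End CenterComparison.

(** * Linear changes of variables, Lorentz maps and comparison on a slab *)

Section LinearChange.
Context (R : realType) (V1 V2 : normedModType R) (L : {linear V1 -> V2}).
Hypothesis cL : continuous L.

Lemma differentiable_comp_linear (w : V2 -> R) (q : V1) :
  differentiable w (L q) -> differentiable (w \o L) q.
Proof.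
by move=> dw; apply: differentiable_comp => //; exact: linear_differentiable.
Qed.

Lemma derive_comp_linear (w : V2 -> R) (q v : V1) :
  differentiable w (L q) -> 'D_v (w \o L) q = 'D_(L v) w (L q).
Proof.
move=> dw; have dL : differentiable L q by exact: linear_differentiable.
rewrite deriveE; last exact: differentiable_comp_linear.
by rewrite diff_comp//= diff_lin// deriveE.
Qed.

Lemma class_C_comp_linear n (V : set V2) (w : V2 -> R) : open V ->
  class_C n V w -> class_C n (L @^-1` V) (w \o L).
Proof.
move=> oV; have oL : open (L @^-1` V) by apply: open_comp => // q _; exact: cL.
elim: n w => [|n IH] w.
  by move=> cw q Vq; apply: continuous_comp; [exact: cL|exact: cw].
move=> cw; split=> [q Vq|v].
  exact/differentiable_comp_linear/(class_C_differentiable cw).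
apply: (class_C_congr oL _ (IH _ (class_C_derive (L v) cw))) => q Vq /=.
by rewrite derive_comp_linear//; exact: (class_C_differentiable cw).
Qed.

End LinearChange.

Section Lorentz.
Context (R : realType).
Notation pt := (R * (R * R))%type.

(* The square root of the quadratic form of [P] times the boost sending the
   direction of the time axis to that of [P]. *)
Definition lorentz (P q : pt) : pt :=
  let s := Num.sqrt (hyp_sq P) in
  let: (a, (b, c)) := P in
  (a * q.1 + b * q.2.1 + c * q.2.2,
   (b * q.1 + (s + b ^+ 2 / (s + a)) * q.2.1 + b * c / (s + a) * q.2.2,
    c * q.1 + b * c / (s + a) * q.2.1 + (s + c ^+ 2 / (s + a)) * q.2.2)).

Fact lorentz_is_linear P : linear (lorentz P).
Proof.
case: P => a [b c] k [x [y z]] [x' [y' z']]; rewrite /lorentz /=.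
rewrite /GRing.scale /= /GRing.scale /=; congr (_, (_, _)); rewrite /= /GRing.scale /=; ring.
Qed.

HB.instance Definition _ P := GRing.isLinear.Build R pt pt *:%R (lorentz P)
  (lorentz_is_linear P).

Lemma lorentz_continuous P : continuous (lorentz P).
Proof.
case: P => a [b c] q; rewrite /lorentz.
have c1 : {for q, continuous (fun q : pt => q.1)} by exact: cvg_fst.
have c2 : {for q, continuous (fun q : pt => q.2.1)}.
  exact: (class_C_continuous (class_C_x1 0 openT)).
have c3 : {for q, continuous (fun q : pt => q.2.2)}.
  exact: (class_C_continuous (class_C_x2 0 openT)).
set s := Num.sqrt _.
apply: (@continuous_pt R pt (fun q => a * q.1 + b * q.2.1 + c * q.2.2)
  (fun q => b * q.1 + (s + b ^+ 2 / (s + a)) * q.2.1 + b * c / (s + a) * q.2.2)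
  (fun q => c * q.1 + b * c / (s + a) * q.2.1 + (s + c ^+ 2 / (s + a)) * q.2.2));
  by continuous_rules.
Qed.

Lemma hyp_sq_lorentz P q : 0 < P.1 -> 0 < hyp_sq P ->
  hyp_sq (lorentz P q) = hyp_sq P * hyp_sq q.
Proof.
case: P => a [b c] /= a0 m0; have sE := sqr_sqrtr (ltW m0).
have s0 : 0 < Num.sqrt (hyp_sq (a, (b, c))) by rewrite sqrtr_gt0.
rewrite !hyp_sqE /=; rewrite hyp_sqE /= in sE s0 *.
move: (Num.sqrt _) sE s0 => s sE s0; case: q => [x [y z]] /=.
have sa : s + a != 0 by rewrite gt_eqF// addr_gt0.
have {}sE : a ^+ 2 = s ^+ 2 + b ^+ 2 + c ^+ 2 by rewrite sE; ring.
by field: sE.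
Qed.

Lemma lorentz_axis P : lorentz P (1, (0, 0)) = P.
Proof. by case: P => a [b c]; rewrite /lorentz /=; congr (_, (_, _)); ring. Qed.

Lemma causalP (v : pt) : causal v <-> 0 <= v.1 /\ 0 <= hyp_sq v.
Proof.
have l0 : 0 <= eucl_len v.2 by exact: sqrtr_ge0.
rewrite /causal /hyp_sq subr_ge0; split=> [lv|[v0]].
  have v0 := le_trans l0 lv.
  by split=> //; rewrite ler_sqr ?nnegrE.
by rewrite ler_sqr ?nnegrE.
Qed.

Lemma eucl_dot (x y : R * R) :
  `|x.1 * y.1 + x.2 * y.2| <= eucl_len x * eucl_len y.
Proof.
rewrite -ler_sqr ?nnegrE ?mulr_ge0 ?sqrtr_ge0//.
rewrite exprMn !sqr_sqrtr ?addr_ge0 ?sqr_ge0// real_normK ?num_real//.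
rewrite -subr_ge0 (_ : _ - _ = (x.1 * y.2 - x.2 * y.1) ^+ 2) ?sqr_ge0//.
by ring.
Qed.

Lemma eucl_len_lt (p : pt) : 0 < p.1 -> 0 < hyp_sq p -> eucl_len p.2 < p.1.
Proof.
by move=> p0; rewrite /hyp_sq subr_gt0 ltr_sqr ?nnegrE ?sqrtr_ge0// ltW.
Qed.

(** The time component is the Euclidean product of [P] and [q] in R^3. By Cauchy-Schwarz on the
    spatial parts, it is positive when one vector is timelike, the other causal and both point to
    the future. *)
Lemma lorentz_time_gt0 P q : 0 < P.1 -> 0 < hyp_sq P -> 0 < q.1 ->
  0 <= hyp_sq q -> 0 < (lorentz P q).1.
Proof.
move=> P0 m0 q0 mq; have PP := eucl_len_lt P0 m0.
have qq : eucl_len q.2 <= q.1 by apply/causalP; split => //; exact: ltW.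
have := lerNnormlW (eucl_dot P.2 q.2); case: P P0 m0 PP => a [b c] /= P0 m0 PP D.
have : eucl_len (b, c) * eucl_len q.2 < a * q.1.
  apply: (@le_lt_trans _ _ (eucl_len (b, c) * q.1)).
    by rewrite ler_wpM2l// sqrtr_ge0.
  by rewrite ltr_pM2r.
by rewrite -addrA; lra.
Qed.

Lemma lorentz_causal P v : 0 < P.1 -> 0 < hyp_sq P -> causal v ->
  causal (lorentz P v).
Proof.
move=> P0 m0 /causalP[v0 hv]; apply/causalP; split; last first.
  by rewrite hyp_sq_lorentz// mulr_ge0// ltW.
move: v0; rewrite le_eqVlt => /predU1P[v0|v0]; last first.
  exact/ltW/lorentz_time_gt0.
case: v v0 hv => x [y z] /= <-; rewrite hyp_sqE /= expr0n sub0r -opprD oppr_ge0 => yz.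
have [y0 z0] : y = 0 /\ z = 0.
  have := sqr_ge0 y; have := sqr_ge0 z => z2 y2.
  by split; apply/eqP; rewrite -sqrf_eq0 eq_le; apply/andP; split=> //; lra.
by rewrite y0 z0; case: P {P0 m0} => a [b c] /=; rewrite !mulr0 !addr0.
Qed.

Lemma pd_lorentz P (w : pt -> R) (q : pt) i : differentiable w (lorentz P q) ->
  pd i (w \o lorentz P) q =
    (lorentz P (basis_vec R i)).1 * pd 0 w (lorentz P q)
    + (lorentz P (basis_vec R i)).2.1 * pd 1 w (lorentz P q)
    + (lorentz P (basis_vec R i)).2.2 * pd 2 w (lorentz P q).
Proof.
move=> dw; transitivity ('D_(lorentz P (basis_vec R i)) w (lorentz P q)).
  exact: (derive_comp_linear (@lorentz_continuous P)).
by case: (lorentz P (basis_vec R i)) => x [y z]; exact: derive_dir.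
Qed.

Lemma pd_lin3_lorentz P (f g h : pt -> R) (q : pt) i (x y z : R) :
  differentiable f (lorentz P q) -> differentiable g (lorentz P q) ->
  differentiable h (lorentz P q) ->
  let: (x', (y', z')) := lorentz P (basis_vec R i) in
  let D k u := pd k u (lorentz P q) in
  pd i (fun q => x * (f \o lorentz P) q + y * (g \o lorentz P) q
                 + z * (h \o lorentz P) q) q =
    x * (x' * D 0 f + y' * D 1 f + z' * D 2 f)
    + y * (x' * D 0 g + y' * D 1 g + z' * D 2 g)
    + z * (x' * D 0 h + y' * D 1 h + z' * D 2 h).
Proof.
move=> df dg dh; case E : (lorentz P (basis_vec R i)) => [x' [y' z']] /=.
have cL := @lorentz_continuous P.
rewrite (pd_lin3 x y z i (differentiable_comp_linear cL df)
  (differentiable_comp_linear cL dg) (differentiable_comp_linear cL dh)).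
by rewrite !pd_lorentz// E.
Qed.

Lemma pd2_lorentz P (V : set pt) (w : pt -> R) (q : pt) i :
  open V -> class_C 2 V w -> V (lorentz P q) ->
  let: (x, (y, z)) := lorentz P (basis_vec R i) in
  let D j k := pd j (pd k w) (lorentz P q) in
  pd i (pd i (w \o lorentz P)) q =
    x ^+ 2 * D 0 0 + y ^+ 2 * D 1 1 + z ^+ 2 * D 2 2
    + 2 * x * y * D 0 1 + 2 * x * z * D 0 2 + 2 * y * z * D 1 2.
Proof.
move=> oV cw Vq; case E : (lorentz P (basis_vec R i)) => [x [y z]] /=.
have cL := @lorentz_continuous P.
have oL : open (lorentz P @^-1` V) by apply: open_comp => // q' _; exact: cL.
have dpw k q' : V q' -> differentiable (pd k w) q'.
  exact: class_C_differentiable (class_C_pd k cw).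
rewrite (@pd_open_eq _ _ _ (fun q => x * (pd 0 w \o lorentz P) q
  + y * (pd 1 w \o lorentz P) q + z * (pd 2 w \o lorentz P) q) i q oL)//; last first.
  by move=> q' Vq' /=; rewrite pd_lorentz ?E//; exact: (class_C_differentiable cw).
have := pd_lin3_lorentz i x y z (dpw 0 _ Vq) (dpw 1 _ Vq) (dpw 2 _ Vq).
rewrite E => ->.
have := pd_commute 1 0 oV cw Vq; have := pd_commute 2 0 oV cw Vq.
have := pd_commute 2 1 oV cw Vq; set X := lorentz P q.
generalize (pd 0 (pd 0 w) X), (pd 0 (pd 1 w) X), (pd 0 (pd 2 w) X),
  (pd 1 (pd 0 w) X), (pd 1 (pd 1 w) X), (pd 1 (pd 2 w) X),
  (pd 2 (pd 0 w) X), (pd 2 (pd 1 w) X), (pd 2 (pd 2 w) X).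
by move=> d00 d01 d02 d10 d11 d12 d20 d21 d22 -> -> ->; ring.
Qed.

Lemma negbox_lorentz P (V : set pt) (w : pt -> R) (q : pt) :
  0 < P.1 -> 0 < hyp_sq P -> open V -> class_C 2 V w -> V (lorentz P q) ->
  negbox (w \o lorentz P) q = hyp_sq P * negbox w (lorentz P q).
Proof.
move=> P0 m0 oV cw Vq; rewrite /negbox.
have := pd2_lorentz 0 oV cw Vq; have := pd2_lorentz 1 oV cw Vq.
have := pd2_lorentz 2 oV cw Vq.
set X := lorentz P q; cbv beta zeta delta [negbox].
generalize (pd 0 (pd 0 w) X), (pd 0 (pd 1 w) X), (pd 0 (pd 2 w) X),
  (pd 1 (pd 1 w) X), (pd 1 (pd 2 w) X), (pd 2 (pd 2 w) X).
generalize (pd 0 (pd 0 (w \o lorentz P)) q), (pd 1 (pd 1 (w \o lorentz P)) q),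
  (pd 2 (pd 2 (w \o lorentz P)) q).
move=> w0 w1 w2 d00 d01 d02 d11 d12 d22 {X Vq}.
case: P P0 m0 => a [b c] /= a0 m0.
rewrite !(mulr0, mulr1, addr0, add0r) => -> -> ->.
have sE := sqr_sqrtr (ltW m0).
have s0 : 0 < Num.sqrt (hyp_sq (a, (b, c))) by rewrite sqrtr_gt0.
rewrite hyp_sqE /= in sE s0 *.
move: (Num.sqrt _) sE s0 => s sE s0.
have sa : s + a != 0 by rewrite gt_eqF// addr_gt0.
have {}sE : a ^+ 2 = s ^+ 2 + b ^+ 2 + c ^+ 2 by rewrite sE; ring.
by field: sE.
Qed.

Lemma class_C_lorentz n P (V : set pt) (w : pt -> R) : open V ->
  class_C n V w -> class_C n (lorentz P @^-1` V) (w \o lorentz P).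
Proof. by move=> oV; apply: class_C_comp_linear => //; exact: lorentz_continuous. Qed.

(** [center_comparison] is applied to the pull-back of [w] by [lorentz P], which sends (1, 0, 0) to
    [P]. The pull-back multiplies -Box by the positive number [hyp_sq P], and the map preserves
    causal vectors, so all sign conditions are inherited. *)
Lemma comparison (V : set pt) (w : pt -> R) (s0 s1 : R) : 0 < s0 ->
  open V -> class_C 2 V w -> slab s0 s1 `<=` V ->
  (forall p, slab s0 s1 p -> 0 <= negbox w p) ->
  (forall p, 0 < p.1 -> hyp_sq p = s0 ^+ 2 ->
    0 <= w p /\ forall v, causal v -> 0 <= 'D_v w p) ->
  forall P, slab s0 s1 P -> 0 <= w P.
Proof.
move=> s00 oV cw sV bw data P sP; have [P0 /andP[s0P Ps1]] := sP.
have s02 : 0 < s0 ^+ 2 by rewrite exprn_gt0.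
have m0 : 0 < hyp_sq P := lt_le_trans s02 s0P.
(* On the initial hyperboloid the data give the sign directly; elsewhere the slab below [P] is
   nondegenerate, which gives e < 1. *)
have [E|ne] := eqVneq (hyp_sq P) (s0 ^+ 2); first by have [] := data P P0 E.
have lt : s0 ^+ 2 < hyp_sq P by rewrite lt_neqAle eq_sym ne.
pose m := Num.sqrt (hyp_sq P); have mE : m ^+ 2 = hyp_sq P by exact/sqr_sqrtr/ltW.
have mgt0 : 0 < m by rewrite sqrtr_gt0.
(* [lorentz P] dilates by [m], so it maps H_e into H_{s0} and H_1 into the hyperboloid of [P]. *)
pose e := s0 / m; have e0 : 0 < e by rewrite divr_gt0.
have e1 : e < 1.
  by rewrite ltr_pdivrMr// mul1r -ltr_sqr ?nnegrE ?ltW// mE.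
have eE : hyp_sq P * e ^+ 2 = s0 ^+ 2.
  by rewrite -mE /e; field; rewrite gt_eqF.
have cL := @lorentz_continuous P.
have oL : open (lorentz P @^-1` V) by apply: open_comp => // q' _; exact: cL.
have slabL q : slab e 1 q -> slab s0 s1 (lorentz P q).
  move=> [q0 /andP[eq q1]]; have hq : 0 <= hyp_sq q by rewrite (le_trans _ eq)// sqr_ge0.
  split; first exact: lorentz_time_gt0.
  rewrite hyp_sq_lorentz// -eE ler_pM2l// eq /= (le_trans _ Ps1)//.
  by rewrite ger_pMr// (le_trans q1)// expr1n.
have := @center_comparison _ (lorentz P @^-1` V) (w \o lorentz P) e oL
  (@class_C_lorentz 2 P V w oV cw) e0 e1.
rewrite /= lorentz_axis; apply.
- by move=> q /slabL /sV.
- move=> q sq; rewrite (negbox_lorentz P0 m0 oV cw) ?mulr_ge0//; first exact: ltW.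
    exact/bw/slabL.
  exact/sV/slabL.
- move=> q q0 hq.
  have L0 : 0 < (lorentz P q).1 by apply: lorentz_time_gt0 => //; rewrite hq sqr_ge0.
  have hL : hyp_sq (lorentz P q) = s0 ^+ 2 by rewrite hyp_sq_lorentz// hq.
  have [wq Dw] := data _ L0 hL; split=> [|v cv]; first exact: wq.
  rewrite (derive_comp_linear cL); first exact/Dw/lorentz_causal.
  apply: (class_C_differentiable cw); apply: sV; split => //.
  by rewrite hL lexx /= (le_trans (ltW lt)).
Qed.

End Lorentz.

(** * A supersolution and the pointwise bound *)

Section Supersolution.
Context (R : realType).
Notation pt := (R * (R * R))%type.
Implicit Types (g : pt -> R) (p : pt).

(** Reduces a partial derivative to a derivative in one variable, which [derive_as] can compute;
    [pd1_line] and [pd2_line] do the same for the spatial variables. *)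
Lemma pd0_line g (t x y d : R) : differentiable g (t, (x, y)) ->
  is_derive t 1 (fun t => g (t, (x, y))) d -> pd 0 g (t, (x, y)) = d.
Proof.
move=> dg [_ <-].
have [_ ->] := @is_derive_curve R g (fun t => t) (fun=> x) (fun=> y) 1 0 0 t dg
  (is_derive_var t) (is_derive_const x t) (is_derive_const y t).
cbv beta; generalize (pd 0 g (t, (x, y))), (pd 1 g (t, (x, y))), (pd 2 g (t, (x, y))).
by move=> *; ring.
Qed.

Lemma pd1_line g (t x y d : R) : differentiable g (t, (x, y)) ->
  is_derive x 1 (fun x => g (t, (x, y))) d -> pd 1 g (t, (x, y)) = d.
Proof.
move=> dg [_ <-].
have [_ ->] := @is_derive_curve R g (fun=> t) (fun x => x) (fun=> y) 0 1 0 x dg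
  (is_derive_const t x) (is_derive_var x) (is_derive_const y x).
cbv beta; generalize (pd 0 g (t, (x, y))), (pd 1 g (t, (x, y))), (pd 2 g (t, (x, y))).
by move=> *; ring.
Qed.

Lemma pd2_line g (t x y d : R) : differentiable g (t, (x, y)) ->
  is_derive y 1 (fun y => g (t, (x, y))) d -> pd 2 g (t, (x, y)) = d.
Proof.
move=> dg [_ <-].
have [_ ->] := @is_derive_curve R g (fun=> t) (fun=> x) (fun y => y) 0 0 1 y dg
  (is_derive_const t y) (is_derive_const x y) (is_derive_var y).
cbv beta; generalize (pd 0 g (t, (x, y))), (pd 1 g (t, (x, y))), (pd 2 g (t, (x, y))).
by move=> *; ring.
Qed.

(** The quadratic form is written out because polynomials are smooth by the rules above, whereas
    [eucl_len] is not differentiable on the time axis. *)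
Definition fcone : set pt := [set p | 0 < p.1 /\ 0 < p.1 ^+ 2 - p.2.1 ^+ 2 - p.2.2 ^+ 2].

Lemma fconeP p : fcone p <-> 0 < p.1 /\ 0 < hyp_sq p.
Proof. by rewrite hyp_sqE. Qed.

Lemma class_C_form n (U : set pt) : open U ->
  class_C n U (fun p => p.1 ^+ 2 - p.2.1 ^+ 2 - p.2.2 ^+ 2).
Proof.
move=> oU; have c0 := class_C_exp 2 oU (class_C_fst n oU).
have c1 := class_C_exp 2 oU (class_C_x1 n oU).
have c2 := class_C_exp 2 oU (class_C_x2 n oU).
exact: (class_C_sub_fun oU (class_C_sub_fun oU c0 c1) c2).
Qed.

Lemma open_fcone : open fcone.
Proof.
apply: openI.
  apply: (open_comp (f := fst) (D := [set x : R | 0 < x])) => [p _|]; first exact: cvg_fst.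
  exact: open_gt.
apply: (open_comp (f := fun p : pt => p.1 ^+ 2 - p.2.1 ^+ 2 - p.2.2 ^+ 2)
  (D := [set x : R | 0 < x])) => [p _|]; last exact: open_gt.
exact: (class_C_continuous (class_C_form 0 openT)).
Qed.

(** The term r^2/(2 t^2) supplies 1/t^2 in -Box, with an error -3 s^2/t^4; subtracting 1/2 makes it
    nonpositive in the cone, whence the upper bound 4 s/t for the whole. The term 4 s/t contributes
    8 s/t^3 to -Box, which absorbs that error and the -4 s0/t^3 coming from -2 s0/t. The latter term
    is there because s/t decreases in outgoing null directions; its own values are negative, but
    with the coefficient 4 on s/t the sum is still at least s0/t on H_{s0}. *)
Definition barrier (s0 : R) (p : pt) : R :=
  4 * (Num.sqrt (p.1 ^+ 2 - p.2.1 ^+ 2 - p.2.2 ^+ 2) * p.1^-1) - 2 * s0 * p.1^-1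
  + (p.2.1 ^+ 2 + p.2.2 ^+ 2) * (2 * p.1 ^+ 2)^-1 - 2^-1.

Lemma class_C_barrier n s0 : class_C n fcone (barrier s0).
Proof.
have oC := open_fcone; have c0 := class_C_fst n oC; have c1 := class_C_x1 n oC.
have c2 := class_C_x2 n oC; have cc c := class_C_cst n c oC.
have ci : class_C n fcone (fun p => p.1^-1).
  by apply: class_C_inv => // p [p0 _]; rewrite gt_eqF.
have cs : class_C n fcone (fun p => Num.sqrt (p.1 ^+ 2 - p.2.1 ^+ 2 - p.2.2 ^+ 2)).
  by apply: class_C_sqrt => [//|p []//|]; exact: class_C_form.
have c4 := class_C_mul oC (cc 4) (class_C_mul oC cs ci).
have c3 := class_C_mul oC (cc (2 * s0)) ci.
have cr := class_C_add oC (class_C_exp 2 oC c1) (class_C_exp 2 oC c2).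
have c20 := class_C_mul oC (cc 2) (class_C_exp 2 oC c0).
have c5 : class_C n fcone (fun p => (2 * p.1 ^+ 2)^-1).
  by apply: class_C_inv => // p [p0 _]; rewrite mulf_neq0// expf_neq0// gt_eqF.
exact: (class_C_sub_fun oC (class_C_add oC (class_C_sub_fun oC c4 c3)
  (class_C_mul oC cr c5)) (cc _)).
Qed.

Definition barrier_t (s0 : R) (p : pt) : R :=
  let s := Num.sqrt (p.1 ^+ 2 - p.2.1 ^+ 2 - p.2.2 ^+ 2) in
  4 * (s^-1 - s * (p.1 ^+ 2)^-1) + 2 * s0 * (p.1 ^+ 2)^-1
  - (p.2.1 ^+ 2 + p.2.2 ^+ 2) * (p.1 * p.1 ^+ 2)^-1.

Definition barrier_x (x : R) (p : pt) : R :=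
  let s := Num.sqrt (p.1 ^+ 2 - p.2.1 ^+ 2 - p.2.2 ^+ 2) in
  x * ((p.1 ^+ 2)^-1 - 4 * (s * p.1)^-1).

Lemma barrier_pd s0 p : fcone p ->
  [/\ pd 0 (barrier s0) p = barrier_t s0 p,
      pd 1 (barrier s0) p = barrier_x p.2.1 p &
      pd 2 (barrier s0) p = barrier_x p.2.2 p].
Proof.
move=> Cp; have dB := class_C_differentiable (class_C_barrier 1 s0) Cp.
case: p Cp dB => t [x y] [/= t0 m0] dB.
have sE := sqr_sqrtr (ltW m0); have sgt0 : 0 < Num.sqrt (t ^+ 2 - x ^+ 2 - y ^+ 2).
  by rewrite sqrtr_gt0.
have tn : t != 0 by rewrite gt_eqF.
have t2n : 2 * t ^+ 2 != 0 by rewrite mulf_neq0// expf_neq0.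
split.
- apply: (pd0_line dB); rewrite /barrier; cbn [fst snd]; derive_as.
  rewrite /barrier_t /=; move: (Num.sqrt _) sgt0 sE => s sgt0 sE.
  by field; rewrite ?gt_eqF.
- apply: (pd1_line dB); rewrite /barrier; cbn [fst snd]; derive_as.
  rewrite /barrier_x /=; move: (Num.sqrt _) sgt0 sE => s sgt0 sE.
  by field; rewrite ?gt_eqF.
- apply: (pd2_line dB); rewrite /barrier; cbn [fst snd]; derive_as.
  rewrite /barrier_x /=; move: (Num.sqrt _) sgt0 sE => s sgt0 sE.
  by field; rewrite ?gt_eqF.
Qed.

Lemma negbox_barrier s0 p : fcone p ->
  let s := Num.sqrt (p.1 ^+ 2 - p.2.1 ^+ 2 - p.2.2 ^+ 2) in
  negbox (barrier s0) p =
    (8 * s - 4 * s0) / p.1 ^+ 3 + p.1 ^- 2 - 3 * s ^+ 2 / p.1 ^+ 4.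
Proof.
move=> Cp; have oC := open_fcone; rewrite /negbox.
have cB i : class_C 1 fcone (pd i (barrier s0)).
  exact: (class_C_pd i (class_C_barrier 2 s0)).
have e0 q : fcone q -> pd 0 (barrier s0) q = barrier_t s0 q.
  by case/(barrier_pd s0).
have e1 q : fcone q -> pd 1 (barrier s0) q = barrier_x q.2.1 q.
  by case/(barrier_pd s0).
have e2 q : fcone q -> pd 2 (barrier s0) q = barrier_x q.2.2 q.
  by case/(barrier_pd s0).
have d0 := class_C_differentiable (class_C_congr oC e0 (cB 0)) Cp.
have d1 := class_C_differentiable (class_C_congr oC e1 (cB 1)) Cp.
have d2 := class_C_differentiable (class_C_congr oC e2 (cB 2)) Cp.
have -> := pd_open_eq 0 oC e0 Cp.
have -> := pd_open_eq 1 oC e1 Cp.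
have -> := pd_open_eq 2 oC e2 Cp.
case: p Cp d0 d1 d2 => t [x y] [/= t0 m0] d0 d1 d2.
have sE := sqr_sqrtr (ltW m0); have sgt0 : 0 < Num.sqrt (t ^+ 2 - x ^+ 2 - y ^+ 2).
  by rewrite sqrtr_gt0.
have tn : t != 0 by rewrite gt_eqF.
have sn : Num.sqrt (t ^+ 2 - x ^+ 2 - y ^+ 2) != 0 by rewrite gt_eqF.
have stn : Num.sqrt (t ^+ 2 - x ^+ 2 - y ^+ 2) * t != 0 by rewrite mulf_neq0.
have t2n : t ^+ 2 != 0 by rewrite expf_neq0.
have t3n : t * t ^+ 2 != 0 by rewrite mulf_neq0.
erewrite (pd0_line d0); last by rewrite /barrier_t /=; derive_rules.
erewrite (pd1_line d1); last by rewrite /barrier_x /=; derive_rules.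
erewrite (pd2_line d2); last by rewrite /barrier_x /=; derive_rules.
cbv beta; move: (Num.sqrt _) sgt0 sE sn {stn} => s sgt0 sE sn.
have {}sE : y ^+ 2 = t ^+ 2 - x ^+ 2 - s ^+ 2 by rewrite sE; ring.
by field: sE; rewrite ?tn ?sn.
Qed.

End Supersolution.

Section WaveBound.
Context (R : realType).
Notation pt := (R * (R * R))%type.
Implicit Types (g : pt -> R) (p : pt).

Lemma slab_fcone (s0 s1 : R) p : 0 < s0 -> slab s0 s1 p -> fcone p.
Proof.
move=> s00 [p0 /andP[sp _]]; apply/fconeP; split => //.
by apply: lt_le_trans sp; rewrite exprn_gt0.
Qed.

Lemma eucl_len_ge0 (x : R * R) : 0 <= eucl_len x. Proof. exact: sqrtr_ge0. Qed.

Lemma hyp_sq_mul p : hyp_sq p = (p.1 - eucl_len p.2) * (p.1 + eucl_len p.2).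
Proof. by rewrite /hyp_sq; ring. Qed.

Lemma cone_time_lt p : cone p -> p.1 < hyp_sq p.
Proof.
rewrite /cone /= hyp_sq_mul => pc; have r0 := eucl_len_ge0 p.2.
have : 1 * (p.1 + eucl_len p.2) < (p.1 - eucl_len p.2) * (p.1 + eucl_len p.2).
  by rewrite ltr_pM2r; lra.
by apply: le_lt_trans; rewrite mul1r lerDl.
Qed.

Lemma derive_lin2 (c d : R) g h v p : differentiable g p -> differentiable h p ->
  'D_v (fun q => c * g q + d * h q) p = c * 'D_v g p + d * 'D_v h p.
Proof.
move=> dg dh.
have vg := @diff_derivable _ _ _ g p v dg; have vh := @diff_derivable _ _ _ h p v dh.
rewrite (@deriveD _ _ _ (fun q => c * g q) (fun q => d * h q)); last 2 first.
- exact: (@derivableZ _ _ _ g c p v vg).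
- exact: (@derivableZ _ _ _ h d p v vh).
by congr (_ + _); [exact: (deriveZ c vg)|exact: (deriveZ d vh)].
Qed.

Lemma pd_lin2 (c d : R) g h a p : differentiable g p -> differentiable h p ->
  pd a (fun q => c * g q + d * h q) p = c * pd a g p + d * pd a h p.
Proof. exact: derive_lin2. Qed.

Lemma negbox_lin2 (U : set pt) (c d : R) g h p : open U ->
  class_C 2 U g -> class_C 2 U h -> U p ->
  negbox (fun q => c * g q + d * h q) p = c * negbox g p + d * negbox h p.
Proof.
move=> oU cg ch Up; have key a :
    pd a (pd a (fun q => c * g q + d * h q)) p = c * pd a (pd a g) p + d * pd a (pd a h) p.
  rewrite (@pd_open_eq _ U _ (fun q => c * pd a g q + d * pd a h q) a p oU _ Up).
    exact: (pd_lin2 c d a (class_C_differentiable (class_C_pd a cg) Up)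
      (class_C_differentiable (class_C_pd a ch) Up)).
  move=> q Uq; exact: (pd_lin2 c d a (class_C_differentiable cg Uq)
    (class_C_differentiable ch Uq)).
have := key 0; have := key 1; have := key 2; rewrite {key} /negbox.
set k := (fun q => c * g q + d * h q).
generalize (pd 0 (pd 0 k) p), (pd 1 (pd 1 k) p), (pd 2 (pd 2 k) p).
generalize (pd 0 (pd 0 g) p), (pd 1 (pd 1 g) p), (pd 2 (pd 2 g) p).
generalize (pd 0 (pd 0 h) p), (pd 1 (pd 1 h) p), (pd 2 (pd 2 h) p).
by move=> h0 h1 h2 g0 g1 g2 k0 k1 k2 -> -> ->; ring.
Qed.

Lemma negbox_barrier_ge (s0 s1 : R) p : 0 < s0 -> slab s0 s1 p ->
  p.1 ^- 2 <= negbox (barrier s0) p.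
Proof.
move=> s00 sp; have Cp := slab_fcone s00 sp; have [t0 m0] := Cp.
rewrite (negbox_barrier s0 Cp); have sE := sqr_sqrtr (ltW m0).
have [_ /andP[hs _]] := sp; rewrite hyp_sqE -sE in hs.
have s'0 : 0 < Num.sqrt (p.1 ^+ 2 - p.2.1 ^+ 2 - p.2.2 ^+ 2) by rewrite sqrtr_gt0.
move: (Num.sqrt _) s'0 sE hs => s s'0 sE hs.
have {hs} s0s : s0 <= s by rewrite -ler_sqr ?nnegrE// ltW.
have st : s <= p.1.
  rewrite -ler_sqr ?nnegrE ?(ltW s'0) ?(ltW t0)// sE -addrA gerDl.
  by rewrite -opprD oppr_le0 addr_ge0 ?sqr_ge0.
rewrite -subr_ge0; move: (p.1) t0 st => t t0 st.
have tn : t != 0 by rewrite gt_eqF.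
rewrite (_ : _ - t ^- 2 = (4 * (s - s0) * t + s * t + 3 * s * (t - s)) / t ^+ 4); last by field.
have s'1 := ltW s'0; have t1 := ltW t0.
apply: divr_ge0; last exact: exprn_ge0.
by apply: addr_ge0; [apply: addr_ge0|]; rewrite !mulr_ge0 ?subr_ge0.
Qed.

Lemma barrier_le (s0 : R) p : 0 < s0 -> fcone p ->
  barrier s0 p <= 4 * (Num.sqrt (hyp_sq p) / p.1).
Proof.
move=> s00 [t0 m0]; rewrite /barrier hyp_sqE.
have : (p.2.1 ^+ 2 + p.2.2 ^+ 2) / (2 * p.1 ^+ 2) <= 2^-1.
  rewrite ler_pdivrMr ?mulr_gt0 ?exprn_gt0// mulKf ?pnatr_eq0//.
  by move: m0; rewrite -addrA -opprD subr_gt0 => /ltW.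
have : 0 <= 2 * s0 * p.1^-1 by rewrite !mulr_ge0 ?invr_ge0// ltW.
by lra.
Qed.

Lemma barrier_data (s0 : R) p : 0 < s0 -> 0 < p.1 -> hyp_sq p = s0 ^+ 2 ->
  s0 / p.1 <= barrier s0 p.
Proof.
move=> s00 t0 hp; have sE : Num.sqrt (p.1 ^+ 2 - p.2.1 ^+ 2 - p.2.2 ^+ 2) = s0.
  by rewrite -hyp_sqE hp sqrtr_sqr gtr0_norm.
have st : s0 <= p.1.
  rewrite -ler_sqr ?nnegrE ?(ltW s00) ?(ltW t0)// -hp hyp_sqE -addrA gerDl.
  by rewrite -opprD oppr_le0 addr_ge0 ?sqr_ge0.
rewrite /barrier sE.
have -> : p.2.1 ^+ 2 + p.2.2 ^+ 2 = p.1 ^+ 2 - s0 ^+ 2 by rewrite -hp hyp_sqE; ring.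
rewrite -subr_ge0; move: (p.1) t0 st => t t0 st.
have tn : t != 0 by rewrite gt_eqF.
rewrite (_ : _ - s0 / t = s0 * (2 * t - s0) / (2 * t ^+ 2)); last by field.
by rewrite divr_ge0 ?mulr_ge0 ?exprn_ge0 ?(ltW t0) ?(ltW s00)//; lra.
Qed.

(** In the worst direction, the outgoing one, 4 s/t and -2 s0/t together contribute exactly the
    lower bound on H_{s0}, and r^2/(2 t^2) contributes the nonnegative amount
    [v.1 * r (t - r) / t^3]. *)
Lemma barrier_direction (s0 : R) p (v : pt) : 0 < s0 -> 0 < p.1 ->
  hyp_sq p = s0 ^+ 2 -> causal v ->
  v.1 * (2 / s0 * (1 - eucl_len p.2 / p.1) ^+ 2) <= 'D_v (barrier s0) p.
Proof.
move=> s00 t0 hp cv; have Cp : fcone p by apply/fconeP; rewrite hp exprn_gt0.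
have sE : Num.sqrt (p.1 ^+ 2 - p.2.1 ^+ 2 - p.2.2 ^+ 2) = s0.
  by rewrite -hyp_sqE hp sqrtr_sqr gtr0_norm.
have st : s0 <= p.1.
  rewrite -ler_sqr ?nnegrE ?(ltW s00) ?(ltW t0)// -hp hyp_sqE -addrA gerDl.
  by rewrite -opprD oppr_le0 addr_ge0 ?sqr_ge0.
have [E0 E1 E2] := barrier_pd s0 Cp.
have dB := class_C_differentiable (class_C_barrier 1 s0) Cp.
have l0 := eucl_len_ge0 v.2; have r0 := eucl_len_ge0 p.2.
have dot := ler_normlW (eucl_dot v.2 p.2); have [v0 _] := (causalP v).1 cv.
have lr : eucl_len v.2 * eucl_len p.2 <= v.1 * eucl_len p.2 by rewrite ler_wpM2r.
have rE : p.2.1 ^+ 2 + p.2.2 ^+ 2 = eucl_len p.2 ^+ 2.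
  by rewrite /eucl_len sqr_sqrtr// addr_ge0 ?sqr_ge0.
have rt : eucl_len p.2 < p.1 by apply: eucl_len_lt => //; rewrite hp exprn_gt0.
have hr : s0 ^+ 2 = p.1 ^+ 2 - eucl_len p.2 ^+ 2 by rewrite -hp.
move: (eucl_len p.2) (eucl_len v.2) dot lr rE rt hr r0 l0 => r l dot lr rE rt hr r0 l0.
case: v v0 dot lr {cv} => a [b c] /= v0 dot lr.
rewrite derive_dir// E0 E1 E2 /barrier_t /barrier_x /= sE rE.
move: (p.1) (p.2.1) (p.2.2) t0 st rt hr dot {sE rE E0 E1 E2 Cp dB hp} => t x y t0 st rt hr dot.
have tn : t != 0 by rewrite gt_eqF. have sn : s0 != 0 by rewrite gt_eqF.
(* The spatial derivatives of the barrier on H_{s0} are [- K x] and [- K y]. Cauchy-Schwarz is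
   applied once, to this combined coefficient: bounding its two parts separately would lose the
   favourable sign of the second. *)
pose K := 4 * (s0 * t)^-1 - (t ^+ 2)^-1.
have K0 : 0 <= K.
  rewrite /K (_ : _ - _ = (4 * t - s0) / (s0 * t ^+ 2)); last by field; rewrite tn sn.
  by rewrite divr_ge0 ?mulr_ge0 ?exprn_ge0 ?(ltW t0) ?(ltW s00)//; lra.
have dK : K * (b * x + c * y) <= K * (a * r) by apply: ler_wpM2l => //; lra.
have {}hr : r ^+ 2 = t ^+ 2 - s0 ^+ 2 by rewrite hr; ring.
have main : a * (2 / s0 * (1 - r / t) ^+ 2) <= a * (4 * (s0^-1 - s0 / t ^+ 2)
    + 2 * s0 / t ^+ 2 - r ^+ 2 / (t * t ^+ 2)) - K * (a * r).
  rewrite -subr_ge0 (_ : _ - a * (2 / s0 * _) = a * (r * (t - r) / t ^+ 3)).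
    by rewrite mulr_ge0// divr_ge0 ?mulr_ge0 ?exprn_ge0 ?subr_ge0// ltW.
  by rewrite /K; field: hr; rewrite tn sn.
apply: (le_trans main); rewrite /K in dK *; lra.
Qed.

Lemma derive_causal_le (u : pt -> R) p (v : pt) (B : R) : differentiable u p ->
  (forall i, `|pd i u p| <= B) -> causal v -> `|'D_v u p| <= v.1 * (3 * B).
Proof.
move=> du uB cv; case: v cv => a [b c] cv; rewrite derive_dir//.
have := uB 0; have := uB 1; have := uB 2; cbn [fst].
generalize (pd 0 u p), (pd 1 u p), (pd 2 u p) => d0 d1 d2 B2 B1 B0.
have a0 : 0 <= a by have [] := (causalP (a, (b, c))).1 cv.
have la : Num.sqrt (b ^+ 2 + c ^+ 2) <= a := cv.
have bl : `|b| <= a.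
  by rewrite (le_trans _ la)// -sqrtr_sqr ler_wsqrtr// lerDl sqr_ge0.
have cl : `|c| <= a.
  by rewrite (le_trans _ la)// -sqrtr_sqr ler_wsqrtr// lerDr sqr_ge0.
have aa : `|a| <= a by rewrite ger0_norm.
have key (z d : R) : `|z| <= a -> `|d| <= B -> `|z * d| <= a * B.
  by move=> za dB; rewrite normrM; apply: ler_pM.
rewrite (_ : a * (3 * B) = a * B + a * B + a * B); last by ring.
apply: (le_trans (ler_normD _ _)); apply: lerD; last exact: key.
by apply: (le_trans (ler_normD _ _)); apply: lerD; exact: key.
Qed.

Lemma addr_ge0_norm (x y : R) : `|y| <= x -> 0 <= x + y.
Proof. by rewrite ler_norml => /andP[h _]; rewrite -(opprK x) addrC subr_ge0. Qed.

Lemma wave_pointwise_bound (s0 A B : R) : 1 < s0 -> 0 <= A -> 0 <= B ->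
  exists2 M : R, 0 <= M &
  forall (s1 : R) (U : set pt) (u : pt -> R),
    open U -> slab s0 s1 `<=` U -> class_C 2 U u ->
    (forall p, slab s0 s1 p -> `|negbox u p| <= A * p.1 ^- 2) ->
    (forall p, 0 < p.1 -> hyp_sq p = s0 ^+ 2 ->
      if `[< cone p >] then `|u p| <= B /\ (forall i, `|pd i u p| <= B)
      else u p = 0 /\ (forall i, pd i u p = 0)) ->
    s0 <= s1 ->
    forall p, slab s0 s1 p -> `|u p| <= M * (Num.sqrt (hyp_sq p) / p.1).
Proof.
move=> s01 A0 B0; have s00 : 0 < s0 by lra.
(* One summand for each condition of the comparison: source, values, causal derivatives. On H_{s0}
   inside the cone t < s0^2, so that B <= B s0 (s0/t). There also 1 - r/t >= 1/t, so the bound of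
   [barrier_direction] is at least [v.1 * 2 / s0^5], to be compared with [v.1 * (3 B)]. *)
pose M := A + B * s0 + 2 * B * s0 ^+ 5.
have M0 : 0 <= M by rewrite !addr_ge0 ?mulr_ge0 ?exprn_ge0// ltW.
have MA : A <= M by rewrite -subr_ge0 /M; have := mulr_ge0 B0 (ltW s00);
  have := mulr_ge0 B0 (exprn_ge0 5 (ltW s00)); lra.
have MB : B * s0 <= M by rewrite -subr_ge0 /M; 
  have := mulr_ge0 B0 (exprn_ge0 5 (ltW s00)); lra.
have M5 : 2 * B * s0 ^+ 5 <= M by rewrite -subr_ge0 /M; have := mulr_ge0 B0 (ltW s00); lra.
exists (M * 4); first by rewrite mulr_ge0.
move=> s1 U u oU sU cu bu du s0s1 p sp.
(* The comparison is made for c = 1 and c = -1, which gives the two sides of the absolute value; the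
   factor 4 in the final constant is that of [barrier_le]. *)
have half (c : R) : `|c| = 1 -> 0 <= M * barrier s0 p + c * u p.
  move=> c1; pose V := U `&` @fcone R.
  have oV : open V by apply: openI => //; exact: open_fcone.
  have sV : slab s0 s1 `<=` V by move=> q sq; split; [exact: sU|exact: slab_fcone sq].
  have cuV : class_C 2 V u by apply: class_C_sub cu => q [].
  have cbV : class_C 2 V (barrier s0).
    by apply: class_C_sub (class_C_barrier 2 s0) => q [].
  have cw := class_C_add oV (class_C_mul oV (class_C_cst 2 M oV) cbV)
    (class_C_mul oV (class_C_cst 2 c oV) cuV).
  apply: (comparison s00 oV cw sV _ _ sp) => q.
    move=> sq; rewrite (negbox_lin2 M c oV cbV cuV (sV _ sq)).
    have h1 := negbox_barrier_ge s00 sq; have h2 := bu _ sq.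
    apply/addr_ge0_norm/(le_trans _ (ler_wpM2l M0 h1)).
    rewrite normrM c1 mul1r; apply: (le_trans h2); rewrite ler_wpM2r//.
    by rewrite invr_ge0 sqr_ge0.
  move=> q0 hq.
  have s1p := ltW (lt_le_trans s00 s0s1).
  have sq : slab s0 s1 q by split; rewrite // hq lexx ler_sqr ?nnegrE// ltW.
  have Vq := sV _ sq; have bd := barrier_data s00 q0 hq.
  have dbq := class_C_differentiable cbV Vq; have duq := class_C_differentiable cuV Vq.
  have s0q : 0 < s0 / q.1 by rewrite divr_gt0.
  have dlin v : 'D_v (fun q => M * barrier s0 q + c * u q) q =
      M * 'D_v (barrier s0) q + c * 'D_v u q.
    exact: derive_lin2.
  have := du _ q0 hq; case: asboolP => [cq [uB duB]|ncq [u0 du0]]; last first.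
    split=> [|v cv].
      by rewrite u0 mulr0 addr0 mulr_ge0// (le_trans (ltW s0q)).
    rewrite dlin (_ : 'D_v u q = 0).
      rewrite mulr0 addr0 mulr_ge0// (le_trans _ (barrier_direction s00 q0 hq cv))//.
      have [v0 _] := (causalP v).1 cv.
      apply: mulr_ge0 => //; apply: mulr_ge0; last exact: sqr_ge0.
      by rewrite divr_ge0// ltW.
    by case: v {cv} => a [b e]; rewrite derive_dir// !du0 !mulr0 !addr0.
  have tq := cone_time_lt cq; rewrite hq in tq.
  split=> [|v cv].
    apply/addr_ge0_norm/(le_trans _ (ler_wpM2l M0 bd)).
    rewrite normrM c1 mul1r; apply: (le_trans uB).
    apply: (@le_trans _ _ (B * s0 * (s0 / q.1))); last by rewrite ler_wpM2r// ltW.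
    by rewrite -mulrA ler_peMr// mulrA -expr2 ler_pdivlMr// mul1r ltW.
  rewrite dlin; have hb := barrier_direction s00 q0 hq cv.
  have [v0 _] := (causalP v).1 cv.
  have h : `|c * 'D_v u q| <= v.1 * (3 * B).
    by rewrite normrM c1 mul1r; exact: derive_causal_le.
  have h1 : (q.1)^-1 <= 1 - eucl_len q.2 / q.1.
    rewrite -[1](@divff _ q.1) ?gt_eqF// -mulrBl ler_peMl ?invr_ge0 ?(ltW q0)//.
    by move: cq; rewrite /cone /=; lra.
  have h2 : v.1 * (3 * B) <= M * (v.1 * (2 / s0 * (1 - eucl_len q.2 / q.1) ^+ 2)).
    rewrite (mulrCA M) ler_wpM2l//.
    apply: (@le_trans _ _ (M * (2 / s0 * (q.1)^-1 ^+ 2))); last first.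
      rewrite ler_wpM2l// ler_wpM2l ?divr_ge0 ?(ltW s00)// ler_sqr ?nnegrE ?invr_ge0 ?(ltW q0)//.
      by rewrite (le_trans _ h1)// invr_ge0 ltW.
    have q4 : q.1 ^+ 2 <= s0 ^+ 4.
      have -> : s0 ^+ 4 = (s0 ^+ 2) ^+ 2 by ring.
      by rewrite ler_sqr ?nnegrE ?sqr_ge0 ?ltW.
    rewrite exprVn !mulrA ler_pdivlMr ?exprn_gt0// ler_pdivlMr//.
    apply: (@le_trans _ _ (3 * B * s0 ^+ 4 * s0)).
      by rewrite ler_wpM2r ?(ltW s00)// ler_wpM2l// mulr_ge0.
    rewrite -[_ * s0 ^+ 4 * s0]mulrA -exprSr.
    by have := mulr_ge0 B0 (exprn_ge0 5 (ltW s00)); lra.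
  exact/addr_ge0_norm/(le_trans h)/(le_trans h2)/(ler_wpM2l M0 hb).
have sC := slab_fcone s00 sp; have bl := ler_wpM2l M0 (barrier_le s00 sC).
rewrite ler_norml -mulrA; have := half 1 (normr1 _); have := half (-1) (normrN1 _).
rewrite mul1r mulN1r; move: bl; generalize (barrier s0 p), (u p) => b z bl h1 h2.
by apply/andP; split; lra.
Qed.

End WaveBound.

(** * Commutation of the vector fields *)

Section Commutation.
Context (R : realType).
Notation pt := (R * (R * R))%type.
(* [coord] alone is the coordinate function of the library of vector spaces. *)
Notation crd := (@Defs.coord R).
Variables (U : set pt) (oU : open U).
Implicit Types (f g h : pt -> R) (p : pt) (a b : 'I_3) (n m : nat).

Lemma class_C_coord n a : class_C n U (crd a).
Proof.
case: a => [[|[|[|//]]] i]; rewrite /Defs.coord /=.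
- exact: class_C_fst.
- exact: class_C_x1.
- exact: class_C_x2.
Qed.

Lemma pd_coord a b p : pd b (crd a) p = (val b == val a)%:R.
Proof.
case: a => [[|[|[|//]]] i]; rewrite /Defs.coord /=.
- exact: pd_fst.
- exact: pd_x1.
- exact: pd_x2.
Qed.

Lemma differentiable_coord3 a p : differentiable (crd a) p.
Proof.
case: a => [[|[|[|//]]] i]; rewrite /Defs.coord /=.
- exact: (class_C_differentiable (class_C_fst 1 openT)).
- exact: (class_C_differentiable (class_C_x1 1 openT)).
- exact: (class_C_differentiable (class_C_x2 1 openT)).
Qed.

Lemma class_C_boost n a g : class_C n.+1 U g -> class_C n U (boost a g).
Proof.
move=> cg; apply: class_C_add => //; apply: class_C_mul => //.
- exact: class_C_coord.
- exact: class_C_pd.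
- exact: class_C_fst.
- exact: class_C_pd.
Qed.

Lemma class_C_negbox n g : class_C n.+2 U g -> class_C n U (negbox g).
Proof.
move=> cg; have c a := class_C_pd a (class_C_pd a cg).
exact: (class_C_sub_fun oU (class_C_sub_fun oU (c 0) (c 1)) (c 2)).
Qed.

Lemma boostE a g p : boost a g p = crd a p * pd 0 g p + p.1 * pd a g p.
Proof. by []. Qed.

Lemma boost_open_eq a g h p : (forall q, U q -> g q = h q) -> U p ->
  boost a g p = boost a h p.
Proof.
by move=> gh Up; rewrite /boost (pd_open_eq 0 oU gh Up) (pd_open_eq a oU gh Up).
Qed.

Lemma negbox_open_eq g h p : (forall q, U q -> g q = h q) -> U p ->
  negbox g p = negbox h p.
Proof.
move=> gh Up; have e a : pd a (pd a g) p = pd a (pd a h) p.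
  by apply: (pd_open_eq a oU _ Up) => q Uq; exact: pd_open_eq oU gh Uq.
by rewrite /negbox; move: (e 0) (e 1) (e 2); generalize (pd 0 (pd 0 g) p),
  (pd 1 (pd 1 g) p), (pd 2 (pd 2 g) p) => ? ? ? -> -> ->.
Qed.

Lemma pd_boost_like f g a b p : differentiable f p -> differentiable g p ->
  pd b (fun q => crd a q * f q + q.1 * g q) p =
  (val b == val a)%:R * f p + crd a p * pd b f p
  + ((val b == 0%N)%:R * g p + p.1 * pd b g p).
Proof.
move=> df dg; have dc := differentiable_coord3 a p.
have d1 : differentiable (fun q : pt => q.1) p.
  exact: (class_C_differentiable (class_C_fst 1 openT)).
rewrite (pdD b (differentiableM dc df) (differentiableM d1 dg)).
rewrite (pdM b dc df) (pdM b d1 dg) pd_coord pd_fst.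
generalize (pd b f p), (pd b g p) => f' g'.
by ring.
Qed.

Lemma pd2_boost_like f g a b p : class_C 2 U f -> class_C 2 U g -> U p ->
  pd b (pd b (fun q => crd a q * f q + q.1 * g q)) p =
  2 * (val b == val a)%:R * pd b f p + crd a p * pd b (pd b f) p
  + (2 * (val b == 0%N)%:R * pd b g p + p.1 * pd b (pd b g) p).
Proof.
move=> cf cg Up; have df q := class_C_differentiable (p := q) cf.
have dg q := class_C_differentiable (p := q) cg.
have dpf := class_C_differentiable (class_C_pd b cf) Up.
have dpg := class_C_differentiable (class_C_pd b cg) Up.
set ca : R := (val b == val a)%:R; set c0 : R := (val b == 0%N)%:R.
have e q : U q -> pd b (fun q => crd a q * f q + q.1 * g q) q =
    (ca * f q + c0 * g q) + (crd a q * pd b f q + q.1 * pd b g q).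
  move=> Uq; rewrite (pd_boost_like a b (df q Uq) (dg q Uq)) -/ca -/c0.
  generalize (pd b f q), (pd b g q) => f' g'.
  by ring.
rewrite (pd_open_eq b oU e Up).
have dc (c : R) (k : pt -> R) : differentiable k p -> differentiable (fun q => c * k q) p.
  move=> dk; have dcc : differentiable (fun=> c : R) p by exact: differentiable_cst.
  exact: (differentiableM dcc dk).
have d1 : differentiable (fun q => ca * f q + c0 * g q) p.
  exact: (differentiableD (dc ca f (df p Up)) (dc c0 g (dg p Up))).
have d2 : differentiable (fun q => crd a q * pd b f q + q.1 * pd b g q) p.
  have dcoord := differentiable_coord3 a p.
  have dfst : differentiable (fun q : pt => q.1) p.
    exact: (class_C_differentiable (class_C_fst 1 openT)).
  exact: (differentiableD (differentiableM dcoord dpf) (differentiableM dfst dpg)).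
rewrite (pdD b d1 d2) (pd_lin2 ca c0 b (df p Up) (dg p Up)).
rewrite (pd_boost_like a b dpf dpg) -/ca -/c0.
generalize (pd b (pd b f) p), (pd b (pd b g) p), (pd b f p), (pd b g p).
by move=> *; ring.
Qed.

(** The coefficients are linear, so only the cross terms of the product rule survive. For f = pd_t u
    and g = pd_a u these are 2 (pd_t pd_a u - pd_a pd_t u) = 0, which is why boosts commute with
    -Box. *)
Lemma negbox_boost_like f g a p : class_C 2 U f -> class_C 2 U g -> U p ->
  val a != 0%N ->
  negbox (fun q => crd a q * f q + q.1 * g q) p =
  crd a p * negbox f p + p.1 * negbox g p + 2 * (pd 0 g p - pd a f p).
Proof.
move=> cf cg Up a0; rewrite /negbox.
have := pd2_boost_like a 0 cf cg Up; have := pd2_boost_like a 1 cf cg Up.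
have := pd2_boost_like a 2 cf cg Up.
set k := (fun q => _ + _).
generalize (pd 0 (pd 0 k) p), (pd 1 (pd 1 k) p), (pd 2 (pd 2 k) p).
generalize (pd 0 (pd 0 f) p), (pd 1 (pd 1 f) p), (pd 2 (pd 2 f) p).
generalize (pd 0 (pd 0 g) p), (pd 1 (pd 1 g) p), (pd 2 (pd 2 g) p).
move=> g0 g1 g2 f0 f1 f2 k0 k1 k2 -> -> ->.
have aE : a = 1 \/ a = 2.
  by case: a a0 {k} => [[|[|[|//]]] i] // _; [left|right]; exact: val_inj.
case: aE => -> /=.
  generalize (pd 0 f p), (pd 1 f p), (pd 2 f p), (pd 0 g p), (pd 1 g p), (pd 2 g p).
  by move=> *; rewrite !(mulr0, mul0r, add0r, mulr1); ring.
generalize (pd 0 f p), (pd 1 f p), (pd 2 f p), (pd 0 g p), (pd 1 g p), (pd 2 g p).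
by move=> *; rewrite !(mulr0, mul0r, add0r, mulr1); ring.
Qed.

Lemma pdB3 f g h b p : differentiable f p -> differentiable g p ->
  differentiable h p ->
  pd b (fun q => f q - g q - h q) p = pd b f p - pd b g p - pd b h p.
Proof.
move=> df dg dh; rewrite (pdB b (differentiableB df dg) dh).
by congr (_ - _); exact: pdB.
Qed.

Lemma negbox_pd b g p : class_C 3 U g -> U p -> negbox (pd b g) p = pd b (negbox g) p.
Proof.
move=> cg Up; have cpd a := class_C_pd a cg.
have e a : pd a (pd a (pd b g)) p = pd b (pd a (pd a g)) p.
  rewrite -(pd_commute a b oU (cpd a) Up); apply: (pd_open_eq a oU _ Up) => q Uq.
  exact: (pd_commute a b oU (class_C_pred cg) Uq).
have d a := class_C_differentiable (class_C_pd a (cpd a)) Up.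
have := pdB3 b (d 0) (d 1) (d 2); rewrite -/(negbox g) => ->.
move: (e 0) (e 1) (e 2); rewrite /negbox; generalize (pd 0 (pd 0 (pd b g)) p),
  (pd 1 (pd 1 (pd b g)) p), (pd 2 (pd 2 (pd b g)) p) => ? ? ? -> -> ->.
by [].
Qed.

Lemma negbox_boost a g p : class_C 3 U g -> U p -> val a != 0%N ->
  negbox (boost a g) p = boost a (negbox g) p.
Proof.
move=> cg Up a0.
apply: (etrans (negbox_boost_like (class_C_pd 0 cg) (class_C_pd a cg) Up a0)).
have := negbox_pd 0 cg Up; have := negbox_pd a cg Up.
have := pd_commute 0 a oU (class_C_pred cg) Up; rewrite /boost.
generalize (negbox (pd 0 g) p), (negbox (pd a g) p), (pd 0 (pd a g) p), (pd a (pd 0 g) p).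
generalize (pd 0 (negbox g) p), (pd a (negbox g) p) => n0 na x y z w -> -> ->.
by ring.
Qed.

Lemma pd_boost a b g p : class_C 2 U g -> U p ->
  pd b (boost a g) p = boost a (pd b g) p
    + (val b == val a)%:R * pd 0 g p + (val b == 0%N)%:R * pd a g p.
Proof.
move=> cg Up; have d c := class_C_differentiable (class_C_pd c cg) Up.
rewrite /boost (pd_boost_like a b (d 0) (d a)).
have := pd_commute b 0 oU cg Up; have := pd_commute b a oU cg Up.
generalize (pd b (pd 0 g) p), (pd b (pd a g) p), (pd 0 (pd b g) p), (pd a (pd b g) p).
generalize (pd 0 g p), (pd a g p) => g0 ga b0 ba k0 ka -> ->.
by ring.
Qed.

Lemma boost_boost g p : class_C 2 U g -> U p ->
  boost 2 (boost 1 g) p = boost 1 (boost 2 g) p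
    - (p.2.1 * pd 2 g p - p.2.2 * pd 1 g p).
Proof.
move=> cg Up; have d c := class_C_differentiable (class_C_pd c cg) Up.
rewrite (boostE 2 (boost 1 g) p) (boostE 1 (boost 2 g) p).
have := pd_boost 1 0 cg Up; have := pd_boost 1 2 cg Up.
have := pd_boost 2 0 cg Up; have := pd_boost 2 1 cg Up.
generalize (pd 0 (boost 1 g) p), (pd 2 (boost 1 g) p), (pd 0 (boost 2 g) p),
  (pd 1 (boost 2 g) p) => b01 b21 b02 b12 -> -> -> ->.
move: (boostE 1 (pd 0 g) p) (boostE 1 (pd 2 g) p) (boostE 2 (pd 0 g) p).
move: (boostE 2 (pd 1 g) p); generalize (boost 1 (pd 0 g) p),
  (boost 1 (pd 2 g) p), (boost 2 (pd 0 g) p), (boost 2 (pd 1 g) p).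
move=> c10 c12 c20 c21 -> -> -> ->.
have := pd_commute 1 0 oU cg Up; have := pd_commute 2 0 oU cg Up.
have := pd_commute 2 1 oU cg Up.
generalize (pd 0 (pd 0 g) p), (pd 1 (pd 0 g) p), (pd 2 (pd 0 g) p), (pd 0 (pd 1 g) p),
 (pd 0 (pd 2 g) p), (pd 1 (pd 2 g) p), (pd 2 (pd 1 g) p).
generalize (pd 0 g p), (pd 1 g p), (pd 2 g p).
move=> g0 g1 g2 g00 g10 g20 g01 g02 g12 g21 -> -> ->.
by rewrite /Defs.coord /= !(mul0r, mul1r, addr0); ring.
Qed.

End Commutation.

(** * Iterated fields and their spans *)

Section IteratedFields.
Context (R : realType).
Notation pt := (R * (R * R))%type.
Notation crd := (@Defs.coord R).
Implicit Types (U : set pt) (g : pt -> R) (p : pt).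

(** The operator [Z] with its five exponents as separate arguments, so that induction on each of
    them is possible. *)
Definition Zn a b c d e g : pt -> R :=
  iter a (pd 0) (iter b (pd 1) (iter c (pd 2)
    (iter d (boost 1) (iter e (boost 2) g)))).

Lemma mlenE (I : 'I_5 -> nat) : mlen I = (I 0%R + I 1%R + I 2%R + I 3%R + I 4%R)%N.
Proof.
rewrite /mlen !big_ord_recl big_ord0 addn0 !addnA.
by congr (_ + _ + _ + _ + _)%N; congr I; exact: val_inj.
Qed.

Lemma class_C_iter U (X : (pt -> R) -> pt -> R) m n g :
  (forall n g, class_C n.+1 U g -> class_C n U (X g)) ->
  class_C (m + n) U g -> class_C n U (iter m X g).
Proof.
move=> XU; elim: m n => [//|m IH] n cg.
by rewrite iterS; apply/XU/IH; rewrite addnS.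
Qed.

Lemma class_C_Zn U a b c d e n g : open U -> class_C (a + b + c + d + e + n) U g ->
  class_C n U (Zn a b c d e g).
Proof.
move=> oU cg; have pU i m h : class_C m.+1 U h -> class_C m U (pd i h).
  exact: class_C_pd.
have bU i m h : class_C m.+1 U h -> class_C m U (boost i h).
  exact: class_C_boost.
rewrite /Zn; apply: (class_C_iter (pU 0)); apply: (class_C_iter (pU 1)).
apply: (class_C_iter (pU 2)); apply: (class_C_iter (bU 1)); apply: (class_C_iter (bU 2)).
by apply: class_C_leq cg; lia.
Qed.

Lemma iter_open_eq U (X : (pt -> R) -> pt -> R) m g h :
  (forall g h, (forall q, U q -> g q = h q) -> forall p, U p -> X g p = X h p) ->
  (forall q, U q -> g q = h q) -> forall p, U p -> iter m X g p = iter m X h p.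
Proof. by move=> XU gh; elim: m => [//|m IH]; rewrite !iterS; exact: XU. Qed.

Lemma iter_commute U (X Y : (pt -> R) -> pt -> R) r m g :
  (forall n g, class_C n.+1 U g -> class_C n U (X g)) ->
  (forall g h, (forall q, U q -> g q = h q) -> forall p, U p -> X g p = X h p) ->
  (forall g, class_C r.+1 U g -> forall p, U p -> Y (X g) p = X (Y g) p) ->
  class_C (m + r) U g -> forall p, U p -> Y (iter m X g) p = iter m X (Y g) p.
Proof.
move=> cX eX XY; elim: m g => [//|m IH] g cg p Up; rewrite !iterS XY//.
  by apply: eX => // q Uq; apply: IH => //; exact: class_C_pred.
by apply: class_C_iter => //; rewrite addnS.
Qed.

Lemma pd_Zn U a b c d e g p : open U -> class_C (a + b + c + d + e + 1) U g -> U p ->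
  pd 1 (Zn a b c d e g) p = Zn a b.+1 c d e g p /\
  pd 2 (Zn a b c d e g) p = Zn a b c.+1 d e g p.
Proof.
move=> oU cg Up; pose B := iter d (boost 1) (iter e (boost 2) g).
have cB m : (m <= a + b + c + 1)%N -> class_C m U B.
  move=> le; apply: (@class_C_Zn U 0 0 0 d e m g oU).
  by apply: class_C_leq cg; lia.
have cpd u m h : class_C m.+1 U h -> class_C m U (pd u h) by exact: class_C_pd.
have epd u f h : (forall q, U q -> f q = h q) -> forall p, U p -> pd u f p = pd u h p.
  by move=> fh q Uq; exact: (pd_open_eq u oU fh Uq).
have comm u v m f : class_C m.+1 U f -> forall p, U p ->
    pd u (iter m (pd v) f) p = iter m (pd v) (pd u f) p.
  rewrite -addn1; apply: (@iter_commute _ (pd v) (pd u) 1); [exact: cpd|exact: epd|].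
  by move=> h ch q Uq; exact: (pd_commute u v oU ch Uq).
have cC m : (m <= a + b + 1)%N -> class_C m U (iter c (pd 2) B).
  by move=> le; apply: class_C_iter; [exact: cpd|apply: cB; lia].
have cD m : (m <= a + 1)%N -> class_C m U (iter b (pd 1) (iter c (pd 2) B)).
  by move=> le; apply: class_C_iter; [exact: cpd|apply: cC; lia].
rewrite /Zn -/B; split; rewrite comm//; first by apply: cD; rewrite addn1.
  apply: (iter_open_eq (U := U)) => // [|q Uq]; first exact: epd.
  by rewrite comm//; apply: cC; lia.
by apply: cD; rewrite addn1.
Qed.

Variables (T : Type) (U : T -> set pt) (g : T -> pt -> R) (k : nat).
Hypotheses (oU : forall i, open (U i)) (U0 : forall i p, U i p -> p.1 != 0).
Arguments oU : clear implicits.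
Hypothesis cg : forall i, class_C k (U i) (g i).

(** Index 0 encodes 1/t, and not the constant t/t; the spatial indices encode x_j/t. All three are
    bounded by 1 on the slab. *)
Definition ratio (j : 'I_3) p : R := (if val j == 0%N then 1 else crd j p) * p.1^-1.

(* Combinations of the Z^J g, |J| <= n, whose coefficients are products of 1/t
   and x_a/t. The family index T makes the combination the same for all
   solutions, so that the bounds below are uniform. *)
Inductive zspan : nat -> (T -> pt -> R) -> Prop :=
| zspan_Z n a b c d e : (a + b + c + d + e <= n)%N ->
    zspan n (fun i => Zn a b c d e (g i))
| zspan_add n h1 h2 : zspan n h1 -> zspan n h2 ->
    zspan n (fun i p => h1 i p + h2 i p)
| zspan_scale n (c : R) h : zspan n h -> zspan n (fun i p => c * h i p)
| zspan_ratio n j h : zspan n h -> zspan n (fun i p => ratio j p * h i p)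
| zspan_eq n h h' : (forall i p, U i p -> h i p = h' i p) ->
    zspan n h -> zspan n h'.

Lemma class_C_ratio n i j : class_C n (U i) (ratio j).
Proof.
apply: class_C_mul => //; last first.
  by apply: class_C_inv => //; [exact: U0|exact: class_C_fst].
by case: (val j == 0%N); [exact: class_C_cst|exact: class_C_coord].
Qed.

Lemma pd_ratio i j b p : U i p -> pd b (ratio j) p =
  ((val b == val j) && (val j != 0%N))%:R * ratio 0 p
  - (val b == 0%N)%:R * (ratio 0 p * ratio j p).
Proof.
move=> Up; have p0 := U0 Up.
have d1 : differentiable (fun q : pt => q.1) p.
  exact: (class_C_differentiable (class_C_fst 1 openT)).
have dV : differentiable (fun q : pt => q.1^-1) p by exact: differentiableV.
rewrite /ratio; case: (val j == 0%N).
  rewrite (pd_scale 1 b dV) (pdV b d1 p0) pd_fst /= andbF mul0r.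
  by move: (_ == _)%:R => c; field.
rewrite (pdM b (differentiable_coord3 j p) dV) (pdV b d1 p0) pd_fst pd_coord /= andbT.
by move: (_ == _)%:R (_ == 0%N)%:R => c c'; field.
Qed.

Lemma zspan_class n h : zspan n h ->
  forall m, (n + m <= k)%N -> forall i, class_C m (U i) (h i).
Proof.
elim=> {n h}.
- move=> n a b c d e sn m nm i; apply: class_C_Zn => //.
  by apply: class_C_leq (cg i); apply: leq_trans nm; rewrite leq_add2r.
- by move=> n h1 h2 _ c1 _ c2 m nm i; apply: class_C_add => //; [exact: c1|exact: c2].
- by move=> n c h _ ch m nm i; apply: class_C_mul => //; [exact: class_C_cst|exact: ch].
- by move=> n j h _ ch m nm i; apply: class_C_mul => //; [exact: class_C_ratio|exact: ch].
- by move=> n h h' hh _ ch m nm i; exact: (class_C_congr (oU i) (hh i) (ch m nm i)).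
Qed.

Let zspan_diff n h : zspan n h -> (n < k)%N -> forall i p, U i p -> differentiable (h i) p.
Proof.
move=> zh nk i p Up; have := zspan_class zh (m := 1); rewrite addn1 => /(_ nk i) c.
exact: class_C_differentiable c Up.
Qed.

Lemma zspan_leq m n h : (m <= n)%N -> zspan m h -> zspan n h.
Proof.
move=> mn zh; elim: zh n mn => {m h}.
- by move=> m a b c d e sm n mn; apply: zspan_Z; exact: leq_trans mn.
- by move=> m h1 h2 _ z1 _ z2 n mn; apply: zspan_add; [exact: z1|exact: z2].
- by move=> m c h _ zh n mn; apply: zspan_scale; exact: zh.
- by move=> m j h _ zh n mn; apply: zspan_ratio; exact: zh.
- by move=> m h h' hh _ zh n mn; apply: (zspan_eq hh); exact: zh.
Qed.

Lemma zspan_pd_Z n a b c d e j : (a + b + c + d + e <= n)%N -> (n < k)%N ->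
  zspan n.+1 (fun i => pd j (Zn a b c d e (g i))).
Proof.
move=> sn nk; have ck i : class_C (a + b + c + d + e + 1) (U i) (g i).
  by apply: class_C_leq (cg i); lia.
have jE : [\/ j = 0, j = 1 | j = 2].
  by case: j => [[|[|[|//]]] ij]; [constructor 1|constructor 2|constructor 3]; exact: val_inj.
case: jE => ->.
- apply: (@zspan_Z n.+1 a.+1 b c d e); lia.
- apply: (@zspan_eq _ (fun i => Zn a b.+1 c d e (g i))); last by apply: zspan_Z; lia.
  by move=> i p Up; have [-> _] := pd_Zn (oU i) (ck i) Up.
- apply: (@zspan_eq _ (fun i => Zn a b c.+1 d e (g i))); last by apply: zspan_Z; lia.
  by move=> i p Up; have [_ ->] := pd_Zn (oU i) (ck i) Up.
Qed.

Lemma zspan_pd n h j : zspan n h -> (n < k)%N -> zspan n.+1 (fun i => pd j (h i)).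
Proof.
elim=> {n h}.
- by move=> n a b c d e sn nk; exact: zspan_pd_Z.
- move=> n h1 h2 z1 c1 z2 c2 nk.
  apply: (@zspan_eq _ (fun i p => pd j (h1 i) p + pd j (h2 i) p)).
    by move=> i p Up; rewrite -(pdD j (zspan_diff z1 nk Up) (zspan_diff z2 nk Up)).
  by apply: zspan_add; [exact: c1|exact: c2].
- move=> n c h zh ch nk; apply: (@zspan_eq _ (fun i p => c * pd j (h i) p)).
    by move=> i p Up; rewrite -(pd_scale c j (zspan_diff zh nk Up)).
  by apply: zspan_scale; exact: ch.
- move=> n u h zh ch nk.
  apply: (@zspan_eq _ (fun i p => ratio u p * pd j (h i) p +
    (((val j == val u) && (val u != 0%N))%:R * (ratio 0 p * h i p)
    + (- (val j == 0%N)%:R) * (ratio 0 p * (ratio u p * h i p))))).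
    move=> i p Up; rewrite (pdM j (class_C_differentiable (@class_C_ratio 1 i u) Up)
      (zspan_diff zh nk Up)) (pd_ratio u j Up).
    by generalize (pd j (h i) p) => x; ring.
  apply: zspan_add; first by apply: zspan_ratio; exact: ch.
  have zh1 := zspan_leq (leqnSn n) zh.
  by apply: zspan_add; apply: zspan_scale; do ?apply: zspan_ratio.
- move=> n h h' hh zh ch nk; apply: (@zspan_eq _ (fun i => pd j (h i))); last exact: ch.
  by move=> i p Up; exact: (pd_open_eq j (oU i) (hh i) Up).
Qed.

Section boost.
Variable j : 'I_3.
Hypothesis j0 : val j != 0%N.
Hypothesis boost_Z : forall n a b c d e, (a + b + c + d + e <= n)%N -> (n < k)%N ->
  zspan n.+1 (fun i => boost j (Zn a b c d e (g i))).

(** The coefficients are stable under boosts, since L_j (1/t) = - (x_j/t) (1/t), and L_j (x_u/t) is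
    the Kronecker symbol of j and u minus (x_j/t) (x_u/t). *)
Lemma zspan_boost n h : zspan n h -> (n < k)%N -> zspan n.+1 (fun i => boost j (h i)).
Proof.
elim=> {n h}.
- by move=> n a b c d e sn nk; exact: boost_Z.
- move=> n h1 h2 z1 c1 z2 c2 nk.
  apply: (@zspan_eq _ (fun i p => boost j (h1 i) p + boost j (h2 i) p)).
    move=> i p Up; have dd1 := zspan_diff z1 nk Up; have dd2 := zspan_diff z2 nk Up.
    move: (pdD 0 dd1 dd2) (pdD j dd1 dd2); rewrite !boostE.
    generalize (pd 0 (fun q => h1 i q + h2 i q) p), (pd j (fun q => h1 i q + h2 i q) p).
    move=> ? ? -> ->.
    by generalize (pd 0 (h1 i) p), (pd 0 (h2 i) p), (pd j (h1 i) p), (pd j (h2 i) p) => *; ring.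
  by apply: zspan_add; [exact: c1|exact: c2].
- move=> n c h zh ch nk; apply: (@zspan_eq _ (fun i p => c * boost j (h i) p)).
    move=> i p Up; have dd := zspan_diff zh nk Up.
    move: (pd_scale c 0 dd) (pd_scale c j dd); rewrite !boostE.
    generalize (pd 0 (fun q => c * h i q) p), (pd j (fun q => c * h i q) p).
    move=> ? ? -> ->.
    by generalize (pd 0 (h i) p), (pd j (h i) p) => *; ring.
  by apply: zspan_scale; exact: ch.
- move=> n u h zh ch nk.
  apply: (@zspan_eq _ (fun i p => ratio u p * boost j (h i) p +
    (((val j == val u) && (val u != 0%N))%:R * h i p
    + (- 1) * (ratio j p * (ratio u p * h i p))))).
    move=> i p Up; have dr := class_C_differentiable (@class_C_ratio 1 i u) Up.
    have dd := zspan_diff zh nk Up; have p0 := U0 Up.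
    move: (pdM 0 dr dd) (pdM j dr dd) (pd_ratio u 0 Up) (pd_ratio u j Up); rewrite !boostE.
    generalize (pd 0 (fun q => ratio u q * h i q) p), (pd j (fun q => ratio u q * h i q) p).
    generalize (pd 0 (ratio u) p), (pd j (ratio u) p).
    move=> r0 rj q0 qj -> -> -> ->.
    generalize (pd 0 (h i) p), (pd j (h i) p) => x y.
    rewrite (negbTE j0) [ratio j p]/ratio (negbTE j0) [ratio 0 p]/ratio /=.
    have -> : (0%N == u :> nat) && (u != 0%N :> nat) = false by rewrite eq_sym andbN.
    rewrite mul0r; move: (_ && _)%:R => c.
    by field.
  apply: zspan_add; first by apply: zspan_ratio; exact: ch.
  have zh1 := zspan_leq (leqnSn n) zh.
  by apply: zspan_add; apply: zspan_scale => //; do 2 apply: zspan_ratio.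
- move=> n h h' hh zh ch nk; apply: (@zspan_eq _ (fun i => boost j (h i))); last exact: ch.
  by move=> i p Up; exact: (boost_open_eq (oU i) j (hh i) Up).
Qed.

End boost.

End IteratedFields.

Section SpanBoosts.
Context (R : realType).
Notation pt := (R * (R * R))%type.
Notation crd := (@Defs.coord R).
Variables (T : Type) (U : T -> set pt) (g : T -> pt -> R) (k : nat).
Hypotheses (oU : forall i, open (U i)) (U0 : forall i p, U i p -> p.1 != 0).
Arguments oU : clear implicits.
Hypothesis cg : forall i, class_C k (U i) (g i).
Implicit Types (h : T -> pt -> R) (p : pt) (j : 'I_3).
Local Notation zspan := (zspan U g).

Lemma zspan_boost_pd n h j b : val j != 0%N -> zspan n h ->
  zspan n.+1 (fun i => boost j (h i)) -> (n.+1 < k)%N ->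
  zspan n.+2 (fun i => boost j (pd b (h i))).
Proof.
move=> j0 zh zb nk.
apply: (@zspan_eq _ _ _ _ _ (fun i p => pd b (boost j (h i)) p
    + ((- (val b == val j)%:R) * pd 0 (h i) p + (- (val b == 0%N)%:R) * pd j (h i) p))).
  move=> i p Up; have := pd_boost (oU i) j b (zspan_class oU U0 cg zh (m := 2) _ i) Up.
  rewrite addn2 => /(_ nk).
  generalize (pd b (boost j (h i)) p), (boost j (pd b (h i)) p), (pd 0 (h i) p), (pd j (h i) p).
  by move=> ? ? ? ? ->; ring.
apply: zspan_add; first exact: (zspan_pd oU U0 cg).
apply: zspan_add; apply: zspan_scale; apply: (zspan_leq (leqnSn n.+1));
  exact: (zspan_pd oU U0 cg _ zh (ltnW nk)).
Qed.

(** The commutator of a boost with a partial derivative is zero or a partial derivative, so the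
    outer derivatives can be peeled off one at a time until only words in the boosts remain, which
    [base] handles. *)
Lemma zspan_boost_Zn j : val j != 0%N ->
  (forall d e, (d + e < k)%N -> zspan (d + e).+1 (fun i => boost j (Zn 0 0 0 d e (g i)))) ->
  forall n a b c d e, (a + b + c + d + e <= n)%N -> (n < k)%N ->
  zspan n.+1 (fun i => boost j (Zn a b c d e (g i))).
Proof.
move=> j0 base.
suff H a b c d e : (a + b + c + d + e < k)%N ->
    zspan (a + b + c + d + e).+1 (fun i => boost j (Zn a b c d e (g i))).
  move=> n a b c d e sn nk; apply: (@zspan_leq _ _ _ _ (a + b + c + d + e).+1) => //.
  by apply: H; exact: leq_ltn_trans nk.
elim: a => [|a IH] lk; last first.
  apply: (zspan_boost_pd (n := a + b + c + d + e) (h := fun i => Zn a b c d e (g i)) 0 j0 _ _ lk).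
    exact: zspan_Z.
  by apply: IH; exact: ltnW.
elim: b lk => [|b IH] lk; last first.
  apply: (zspan_boost_pd (n := 0 + b + c + d + e) (h := fun i => Zn 0 b c d e (g i)) 1 j0 _ _ lk).
    exact: zspan_Z.
  by apply: IH; exact: ltnW.
elim: c lk => [|c IH] lk; last first.
  apply: (zspan_boost_pd (n := 0 + 0 + c + d + e) (h := fun i => Zn 0 0 c d e (g i)) 2 j0 _ _ lk).
    exact: zspan_Z.
  by apply: IH; exact: ltnW.
exact: base.
Qed.

Lemma zspan_boost1 n h : zspan n h -> (n < k)%N -> zspan n.+1 (fun i => boost 1 (h i)).
Proof.
apply: (zspan_boost oU U0 cg) => //; apply: zspan_boost_Zn => // d e lk.
by apply: (@zspan_Z _ _ _ _ _ 0 0 0 d.+1 e).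
Qed.

(** In Z^I the field L_1 stands to the left of L_2, so L_2 has to be moved past L_1. The commutator
    is the rotation x_1 pd_2 - x_2 pd_1 = (x_1/t) L_2 - (x_2/t) L_1; this is where the coefficients
    x_a/t originate. *)
Lemma zspan_boost2 n h : zspan n h -> (n < k)%N -> zspan n.+1 (fun i => boost 2 (h i)).
Proof.
apply: (zspan_boost oU U0 cg) => //; apply: zspan_boost_Zn => //.
elim=> [|d IH] e lk; first by apply: (@zspan_Z _ _ _ _ _ 0 0 0 0 e.+1).
pose h' i := Zn 0 0 0 d e (g i).
have zh : zspan (d + e) h' by exact: zspan_Z.
apply: (@zspan_eq _ _ _ _ _ (fun i p => boost 1 (boost 2 (h' i)) p
  + ((- 1) * (ratio 1 p * boost 2 (h' i) p) + ratio 2 p * boost 1 (h' i) p))).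
  move=> i p Up; have p0 := U0 Up.
  have := boost_boost (oU i) (zspan_class oU U0 cg zh (m := 2) _ i) Up.
  rewrite addn2 => /(_ lk); move: (boostE 1 (h' i) p) (boostE 2 (h' i) p).
  rewrite -[Zn 0 0 0 d.+1 e (g i)]/(boost 1 (h' i)).
  generalize (boost 2 (boost 1 (h' i)) p), (boost 1 (boost 2 (h' i)) p).
  generalize (boost 1 (h' i) p), (boost 2 (h' i) p).
  generalize (pd 0 (h' i) p), (pd 1 (h' i) p), (pd 2 (h' i) p).
  move=> q0 q1 q2 b1 b2 b21 b12 -> -> ->.
  rewrite /ratio /Defs.coord /=.
  by field.
have lk' := ltnW lk.
have z1 : zspan (d + e).+1 (fun i => boost 1 (h' i)) by exact: zspan_boost1.
have z2 : zspan (d + e).+1 (fun i => boost 2 (h' i)) by exact: IH.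
apply: zspan_add; first exact: (zspan_boost1 z2).
apply: zspan_add.
  by apply: zspan_scale; apply: zspan_ratio; exact: (zspan_leq (leqnSn (d + e).+1) z2).
by apply: zspan_ratio; exact: (zspan_leq (leqnSn (d + e).+1) z1).
Qed.

(** The weight [w] will be 1 for derivatives of the source on the initial hyperboloid, and s/t for
    derivatives of the solution on the slab. *)
Lemma zspan_bound (S : T -> set pt) (w : pt -> R) N n h :
  (forall i, S i `<=` U i) -> (forall i p, S i p -> 0 <= w p) ->
  (forall j i p, S i p -> `|ratio j p| <= 1) ->
  (forall a b c d e, (a + b + c + d + e <= N)%N ->
    exists M, forall i p, S i p -> `|Zn a b c d e (g i) p| <= M * w p) ->
  zspan n h -> (n <= N)%N ->
  exists M, forall i p, S i p -> `|h i p| <= M * w p.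
Proof.
move=> SU w0 r1 bZ; elim=> {n h}.
- by move=> n a b c d e sn nN; apply: bZ; exact: leq_trans nN.
- move=> n h1 h2 _ b1 _ b2 nN; have [M1 {}b1] := b1 nN; have [M2 {}b2] := b2 nN.
  exists (M1 + M2) => i p Sp; rewrite mulrDl.
  by apply: (le_trans (ler_normD _ _)); apply: lerD; [exact: b1|exact: b2].
- move=> n c h _ bh nN; have [M {}bh] := bh nN.
  exists (`|c| * M) => i p Sp; rewrite normrM -mulrA.
  by apply: ler_wpM2l => //; exact: bh.
- move=> n j h _ bh nN; have [M {}bh] := bh nN.
  exists M => i p Sp; rewrite normrM; apply: le_trans (bh i p Sp).
  by apply: ler_piMl => //; exact: r1 Sp.
- move=> n h h' hh _ bh nN; have [M {}bh] := bh nN.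
  by exists M => i p Sp; rewrite -hh; [exact: bh|exact: SU].
Qed.

End SpanBoosts.

(** * Bounds on the initial hyperboloid *)

Section FamilyBounds.
Context (R : realType).
Notation pt := (R * (R * R))%type.
Notation crd := (@Defs.coord R).
Variables (T : Type) (U : T -> set pt) (S : set pt).
Hypotheses (oU : forall i, open (U i)) (SU : forall i, S `<=` U i).
Arguments oU : clear implicits.
Variables (P : pred 'I_3) (X : 'I_3 -> (pt -> R) -> pt -> R).
Hypothesis X_eq : forall a (V : set pt) (g h : pt -> R) (p : pt), open V -> (forall q, V q -> g q = h q) -> V p ->
  X a g p = X a h p.
Hypothesis XD : forall a (g h : pt -> R) (p : pt), differentiable g p -> differentiable h p ->
  X a (fun q => g q + h q) p = X a g p + X a h p.
Hypothesis XM : forall a (g h : pt -> R) (p : pt), differentiable g p -> differentiable h p ->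
  X a (fun q => g q * h q) p = g p * X a h p + h p * X a g p.
Hypothesis X_cst : forall a (c : R) p, X a (fun=> c) p = 0.
Implicit Types (g h : T -> pt -> R) (p : pt) (a b : 'I_3).

(** Words of length at most [m] in the fields [X a] are bounded on [S], by constants common to all
    indices [i]. It is used with the boosts, tangent to H_{s0}, and with all partial derivatives.
    Regularity is part of the definition so that the product rule for [X] is available at each
    stage. *)
Fixpoint bounded_upto (m : nat) h : Prop :=
  [/\ forall i, class_C m (U i) (h i),
      exists M, forall i p, S p -> `|h i p| <= M &
      if m is m'.+1 then forall a, P a -> bounded_upto m' (fun i => X a (h i)) else True].

Lemma bounded_upto_bound m h : bounded_upto m h ->
  exists M, forall i p, S p -> `|h i p| <= M.
Proof. by case: m => [|m] []. Qed.

Lemma bounded_upto_X m h a : P a -> bounded_upto m.+1 h ->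
  bounded_upto m (fun i => X a (h i)).
Proof. by move=> Pa [_ _]; exact. Qed.

Lemma bounded_upto_pred m h : bounded_upto m.+1 h -> bounded_upto m h.
Proof.
elim: m h => [|m IH] h [ch bh Xh].
  by split=> // i; exact: class_C_pred.
split=> // [i|a Pa]; first exact: class_C_pred.
by apply: IH; exact: Xh.
Qed.

Lemma bounded_upto_leq m n h : (m <= n)%N -> bounded_upto n h -> bounded_upto m h.
Proof.
by move=> /subnKC <-; elim: (n - m)%N => [|d IH]; rewrite ?addn0// addnS
  => /bounded_upto_pred.
Qed.

Lemma bounded_upto_eq m g h : (forall i p, U i p -> g i p = h i p) ->
  bounded_upto m g -> bounded_upto m h.
Proof.
elim: m g h => [|m IH] g h gh [cg [M bg] Xg]; split=> //.
- by move=> i; exact: (class_C_congr (oU i) (gh i) (cg i)).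
- by exists M => i p Sp; rewrite -gh; [exact: bg|exact: SU].
- by move=> i; exact: (class_C_congr (oU i) (gh i) (cg i)).
- by exists M => i p Sp; rewrite -gh; [exact: bg|exact: SU].
- move=> a Pa; apply: IH (Xg a Pa) => i p Up.
  exact: (X_eq a (oU i) (gh i) Up).
Qed.

Lemma bounded_upto_cst m (c : R) : bounded_upto m (fun _ _ => c).
Proof.
elim: m c => [|m IH] c; split=> //.
- by move=> i; exact: class_C_cst.
- by exists `|c|.
- by move=> i; exact: class_C_cst.
- by exists `|c|.
- by move=> a _; apply: bounded_upto_eq (IH 0) => i p _; rewrite X_cst.
Qed.

Lemma bounded_upto_add m g h : bounded_upto m g -> bounded_upto m h ->
  bounded_upto m (fun i p => g i p + h i p).
Proof.
have bD (g' h' : T -> pt -> R) : (exists M, forall i p, S p -> `|g' i p| <= M) ->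
    (exists M, forall i p, S p -> `|h' i p| <= M) ->
    exists M, forall i p, S p -> `|g' i p + h' i p| <= M.
  move=> [M gM] [M' hM]; exists (M + M') => i p Sp.
  by apply: (le_trans (ler_normD _ _)); apply: lerD; [exact: gM|exact: hM].
elim: m g h => [|m IH] g h [cg bg Xg] [ch bh Xh]; split=> //.
- by move=> i; apply: class_C_add.
- exact: bD.
- by move=> i; apply: class_C_add.
- exact: bD.
- move=> a Pa; apply: bounded_upto_eq (IH _ _ (Xg a Pa) (Xh a Pa)) => i p Up.
  have dg := class_C_differentiable (cg i) Up.
  by have := XD a dg (class_C_differentiable (ch i) Up) => /esym.
Qed.

Lemma bounded_upto_mul m g h : bounded_upto m g -> bounded_upto m h ->
  bounded_upto m (fun i p => g i p * h i p).
Proof.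
have bM (g' h' : T -> pt -> R) : (exists M, forall i p, S p -> `|g' i p| <= M) ->
    (exists M, forall i p, S p -> `|h' i p| <= M) ->
    exists M, forall i p, S p -> `|g' i p * h' i p| <= M.
  move=> [M gM] [M' hM]; exists (M * M') => i p Sp; rewrite normrM.
  by apply: ler_pM => //; [exact: gM|exact: hM].
elim: m g h => [|m IH] g h Bg Bh.
  move: Bg Bh => [cg bg _] [ch bh _]; split=> //; last exact: bM.
  by move=> i; apply: class_C_mul.
have pg := bounded_upto_pred Bg; have ph := bounded_upto_pred Bh.
move: Bg Bh => [cg bg Xg] [ch bh Xh]; split=> //.
- by move=> i; apply: class_C_mul.
- exact: bM.
- move=> a Pa; have := bounded_upto_add (IH _ _ pg (Xh a Pa)) (IH _ _ ph (Xg a Pa)).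
  apply: bounded_upto_eq => i p Up.
  have dg := class_C_differentiable (cg i) Up.
  by have := XM a dg (class_C_differentiable (ch i) Up) => /esym.
Qed.

End FamilyBounds.

Section BoostPd.
Context (R : realType).
Notation pt := (R * (R * R))%type.
Implicit Types (V : set pt) (g h : pt -> R) (p : pt) (a b : 'I_3).

Lemma boostD a g h p : differentiable g p -> differentiable h p ->
  boost a (fun q => g q + h q) p = boost a g p + boost a h p.
Proof.
move=> dg dh; move: (pdD 0 dg dh) (pdD a dg dh); rewrite /boost.
generalize (pd 0 (fun q => g q + h q) p), (pd a (fun q => g q + h q) p) => ? ? -> ->.
by generalize (pd 0 g p), (pd a g p), (pd 0 h p), (pd a h p) => *; ring.
Qed.

Lemma boostM a g h p : differentiable g p -> differentiable h p ->
  boost a (fun q => g q * h q) p = g p * boost a h p + h p * boost a g p.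
Proof.
move=> dg dh; move: (pdM 0 dg dh) (pdM a dg dh); rewrite /boost.
generalize (pd 0 (fun q => g q * h q) p), (pd a (fun q => g q * h q) p) => ? ? -> ->.
by generalize (pd 0 g p), (pd a g p), (pd 0 h p), (pd a h p) => *; ring.
Qed.

Lemma boost_cst a (c : R) p : boost a (fun=> c) p = 0.
Proof. by rewrite /boost !pd_cst !mulr0 addr0. Qed.

Lemma boost_eq a V g h p : open V -> (forall q, V q -> g q = h q) -> V p ->
  boost a g p = boost a h p.
Proof. by move=> oV; exact: boost_open_eq. Qed.

Lemma boostV a g p : differentiable g p -> g p != 0 ->
  boost a (fun q => (g q)^-1) p = - (g p) ^- 2 * boost a g p.
Proof.
move=> dg g0; rewrite /boost (pdV 0 dg g0) (pdV a dg g0).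
by generalize (pd 0 g p), (pd a g p) => *; ring.
Qed.

Lemma boost_coord a b p : boost a (@Defs.coord R b) p =
  (val b == 0%N)%:R * Defs.coord a p + (val b == val a)%:R * p.1.
Proof.
rewrite boostE !pd_coord (eq_sym (val b)) (eq_sym (val b)).
by rewrite mulrC [X in _ + X]mulrC.
Qed.

Lemma boost_hyp_sq a p : val a != 0%N ->
  boost a (fun p => p.1 ^+ 2 - p.2.1 ^+ 2 - p.2.2 ^+ 2) p = 0.
Proof.
move=> a0; have dq : differentiable (fun p : pt => p.1 ^+ 2 - p.2.1 ^+ 2 - p.2.2 ^+ 2) p.
  exact: (class_C_differentiable (class_C_form 1 openT)).
case: p dq => t [x y] dq.
have e0 : pd 0 (fun p : pt => p.1 ^+ 2 - p.2.1 ^+ 2 - p.2.2 ^+ 2) (t, (x, y)) = 2 * t.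
  by apply: (pd0_line dq); cbn [fst snd]; derive_as; ring.
have e1 : pd 1 (fun p : pt => p.1 ^+ 2 - p.2.1 ^+ 2 - p.2.2 ^+ 2) (t, (x, y)) = - 2 * x.
  by apply: (pd1_line dq); cbn [fst snd]; derive_as; ring.
have e2 : pd 2 (fun p : pt => p.1 ^+ 2 - p.2.1 ^+ 2 - p.2.2 ^+ 2) (t, (x, y)) = - 2 * y.
  by apply: (pd2_line dq); cbn [fst snd]; derive_as; ring.
have aE : a = 1 \/ a = 2.
  by case: a a0 => [[|[|[|//]]] i] // _; [left|right]; exact: val_inj.
by rewrite boostE e0; case: aE => ->; rewrite ?e1 ?e2 /Defs.coord /=; ring.
Qed.

End BoostPd.

Section CauchyData.
Context (R : realType).
Notation pt := (R * (R * R))%type.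
Notation crd := (@Defs.coord R).
Implicit Types (p : pt) (a b : 'I_3) (x v : R * R).

Lemma eucl_len_sq x : eucl_len x ^+ 2 = x.1 ^+ 2 + x.2 ^+ 2.
Proof. by rewrite sqr_sqrtr// addr_ge0// sqr_ge0. Qed.

Lemma on_hypE (s : R) x :
  on_hyp s x = (Num.sqrt (s ^+ 2 + (x.1 ^+ 2 + x.2 ^+ 2)), x).
Proof. by rewrite /on_hyp eucl_len_sq. Qed.

Lemma hyp_sq_on_hyp (s : R) x : hyp_sq (on_hyp s x) = s ^+ 2.
Proof.
rewrite hyp_sqE on_hypE /= sqr_sqrtr; first by ring.
by rewrite !addr_ge0// sqr_ge0.
Qed.

Lemma on_hyp_gt0 (s : R) x : 0 < s -> 0 < (on_hyp s x).1.
Proof.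
move=> s0; rewrite on_hypE /= sqrtr_gt0 ltr_pwDl ?exprn_gt0//.
by rewrite addr_ge0// sqr_ge0.
Qed.

Lemma on_hyp_snd (s : R) p : 0 < p.1 -> hyp_sq p = s ^+ 2 -> on_hyp s p.2 = p.
Proof.
move=> p0 ps; rewrite on_hypE -ps hyp_sqE; case: p p0 ps => t [x y] /= t0 _.
have -> : t ^+ 2 - x ^+ 2 - y ^+ 2 + (x ^+ 2 + y ^+ 2) = t ^+ 2 by ring.
by rewrite sqrtr_sqr gtr0_norm.
Qed.

Lemma derive_on_hyp (s : R) (h : pt -> R) (u : R * R -> R) x v : 0 < s ->
  (forall y, h (on_hyp s y) = u y) -> differentiable h (on_hyp s x) ->
  differentiable u x ->
  'D_v u x = (x.1 * v.1 + x.2 * v.2) / (on_hyp s x).1 * pd 0 h (on_hyp s x)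
    + v.1 * pd 1 h (on_hyp s x) + v.2 * pd 2 h (on_hyp s x).
Proof.
case: x v => [x1 x2] [v1 v2] s0 hu dh du.
pose c (z : R) : R * R := (x1, x2) + z *: (v1, v2).
have c0 : c 0 = (x1, x2) by rewrite /c scale0r addr0.
have du' : differentiable u (c 0) by rewrite c0.
have D1 := is_derive_comp_curve du' (@is_derive_line R _ (x1, x2) (v1, v2) 0).
move: D1 => [_]; rewrite -/c c0 => <-.
have m0 : 0 < s ^+ 2 + (x1 ^+ 2 + x2 ^+ 2).
  by rewrite ltr_pwDl ?exprn_gt0// addr_ge0// sqr_ge0.
pose al z : R := Num.sqrt (s ^+ 2 + ((x1 + z * v1) ^+ 2 + (x2 + z * v2) ^+ 2)).
have al0 : al 0 = Num.sqrt (s ^+ 2 + (x1 ^+ 2 + x2 ^+ 2)) by rewrite /al !mul0r !addr0.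
have e : u \o c = fun z => h (al z, (x1 + z * v1, x2 + z * v2)).
  have cE z : c z = (x1 + z * v1, x2 + z * v2) by [].
  by apply/funext => z; rewrite /= -hu cE on_hypE.
have pos : 0 < s ^+ 2 + ((x1 + 0 * v1) ^+ 2 + (x2 + 0 * v2) ^+ 2) by rewrite !mul0r !addr0.
have d1 : is_derive (0:R) 1 (fun z => x1 + z * v1) v1 by derive_as; ring.
have d2 : is_derive (0:R) 1 (fun z => x2 + z * v2) v2 by derive_as; ring.
have d0 : is_derive (0:R) 1 al ((x1 * v1 + x2 * v2) / Num.sqrt (s ^+ 2 + (x1 ^+ 2 + x2 ^+ 2))).
  rewrite /al; derive_as => //.
  rewrite !mul0r !addr0; have : Num.sqrt (s ^+ 2 + (x1 ^+ 2 + x2 ^+ 2)) != 0.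
    by rewrite gt_eqF// sqrtr_gt0.
  by move: (Num.sqrt _) => q q0; field.
move: dh; rewrite on_hypE e /= => dh.
have dh' : differentiable h (al 0, (x1 + 0 * v1, x2 + 0 * v2)) by rewrite al0 !mul0r !addr0.
have [_ ->] := is_derive_curve dh' d0 d1 d2.
by rewrite al0 !mul0r !addr0.
Qed.

Lemma class_C_on_hyp_time n (s : R) : 0 < s ->
  class_C n setT (fun x : R * R => Num.sqrt (s ^+ 2 + (x.1 ^+ 2 + x.2 ^+ 2))).
Proof.
move=> s0; apply: class_C_sqrt; first exact: openT.
  by move=> x _; rewrite ltr_pwDl ?exprn_gt0// addr_ge0// sqr_ge0.
have o := @openT (R * R)%type.
have c1 : class_C n setT (fun x : R * R => x.1).
  by apply: (class_C_linear n (g := fst)) => // p; exact: cvg_fst.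
have c2 : class_C n setT (fun x : R * R => x.2).
  by apply: (class_C_linear n (g := snd)) => // p; exact: cvg_snd.
exact: (class_C_add o (class_C_cst n (s ^+ 2) o)
  (class_C_add o (class_C_exp 2 o c1) (class_C_exp 2 o c2))).
Qed.

(** L_a is tangent to H_s, and in the chart [on_hyp s] it is t times the a-th coordinate
    derivative. *)
Lemma boost_on_hyp (s : R) (h : pt -> R) (u : R * R -> R) a x : 0 < s -> val a != 0%N ->
  (forall y, h (on_hyp s y) = u y) -> differentiable h (on_hyp s x) ->
  differentiable u x ->
  boost a h (on_hyp s x) = Num.sqrt (s ^+ 2 + (x.1 ^+ 2 + x.2 ^+ 2))
    * 'D_((val a == 1%N)%:R, (val a == 2%N)%:R) u x.
Proof.
move=> s0 a0 hu dh du; rewrite (derive_on_hyp _ s0 hu dh du).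
have := on_hyp_gt0 x s0; rewrite boostE on_hypE; case: x dh du => x1 x2 _ _.
cbn [fst snd].
move: (Num.sqrt _) => t t0; have tn : t != 0 by rewrite gt_eqF.
have aE : a = 1 \/ a = 2.
  by case: a a0 => [[|[|[|//]]] i] // _; [left|right]; exact: val_inj.
generalize (pd 0 h (t, (x1, x2))) => g0; case: aE => ->.
  generalize (pd 1 h (t, (x1, x2))), (pd 2 h (t, (x1, x2))) => g1 g2.
  rewrite /Defs.coord /= !(mulr0, mul0r, add0r, addr0, mulr1, mul1r).
  by field.
generalize (pd 1 h (t, (x1, x2))), (pd 2 h (t, (x1, x2))) => g1 g2.
rewrite /Defs.coord /= !(mulr0, mul0r, add0r, addr0, mulr1, mul1r).
by field.
Qed.

Variables (s0 : R) (s01 : 1 < s0).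
Let s00 : 0 < s0. Proof. exact: lt_trans ltr01 s01. Qed.

Definition cut : set pt := [set p | cone p /\ hyp_sq p = s0 ^+ 2].
Variables (T : Type) (U : T -> set pt).
Hypotheses (oU : forall i, open (U i)) (Ufcone : forall i, U i `<=` @fcone R).
Arguments oU : clear implicits.
Hypothesis HU : forall i p, 0 < p.1 -> hyp_sq p = s0 ^+ 2 -> U i p.
Implicit Types h : T -> pt -> R.

(** The cone cuts a bounded piece out of H_{s0}: from t - r > 1 and (t - r) (t + r) = s0^2 follows t
    + r < s0^2. *)
Lemma cut_time p : cut p -> 1 < p.1 < s0 ^+ 2.
Proof.
move=> [cp Hp]; rewrite -Hp cone_time_lt// andbT.
by have := eucl_len_ge0 p.2; move: cp; rewrite /cone /=; lra.
Qed.

Lemma cutU i : cut `<=` U i.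
Proof. by move=> p Cp; have := cut_time Cp; case: Cp => _ Hp t; apply: HU => //; lra. Qed.

Lemma cone_ratio j p : cone p -> `|ratio j p| <= 1.
Proof.
move=> cp; have l0 := eucl_len_ge0 p.2.
have t1 : 1 < p.1 by move: cp; rewrite /cone /=; lra.
have b (y : R) : y ^+ 2 <= eucl_len p.2 ^+ 2 -> `|y| <= p.1.
  move=> xl; rewrite -(ler_pXn2r (n := 2)) ?nnegrE//; last by lra.
  rewrite real_normK ?num_real//; apply: (le_trans xl).
  by rewrite ler_pXn2r ?nnegrE//; move: cp; rewrite /cone /=; lra.
rewrite /ratio normrM [`|_^-1|]gtr0_norm ?invr_gt0; last by lra.
rewrite ler_pdivrMr ?mul1r; last by lra.
case: j => [[|[|[|//]]] i]; rewrite /Defs.coord /= ?normr1; first by lra.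
  by apply: b; rewrite eucl_len_sq lerDl sqr_ge0.
by apply: b; rewrite eucl_len_sq lerDr sqr_ge0.
Qed.

Notation tangential := (bounded_upto U cut (fun a => val a != 0%N) (@boost R)).

Lemma tangential_eq m g h : (forall i p, U i p -> g i p = h i p) ->
  tangential m g -> tangential m h.
Proof. exact: (bounded_upto_eq oU cutU (@boost_eq R)). Qed.

Lemma tangential_add m g h : tangential m g -> tangential m h ->
  tangential m (fun i p => g i p + h i p).
Proof. exact: (bounded_upto_add oU cutU (@boost_eq R) (@boostD R)). Qed.

Lemma tangential_mul m g h : tangential m g -> tangential m h ->
  tangential m (fun i p => g i p * h i p).
Proof. exact: (bounded_upto_mul oU cutU (@boost_eq R) (@boostD R) (@boostM R)). Qed.

Lemma tangential_cst m (c : R) : tangential m (fun _ _ => c).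
Proof. exact: (bounded_upto_cst oU cutU _ (@boost_eq R) (@boost_cst R)). Qed.

Lemma tangential_boost m h a : val a != 0%N -> tangential m.+1 h ->
  tangential m (fun i => boost a (h i)).
Proof. exact: bounded_upto_X. Qed.

Lemma cut_coord b p : cut p -> `|crd b p| <= s0 ^+ 2.
Proof.
move=> Cp; have := cut_time Cp; have := cone_ratio b Cp.1.
rewrite /ratio normrM [`|_^-1|]normfV => r1 /andP[t1 t2].
have tE : `|p.1| = p.1 by rewrite gtr0_norm; lra.
move: r1; rewrite tE ler_pdivrMr ?mul1r; last by lra.
case: b => [[|[|[|//]]] i]; rewrite /Defs.coord /=; rewrite ?tE; lra.
Qed.

Lemma tangential_coord m b : tangential m (fun=> crd b).
Proof.
have bc : exists M, forall (i : T) p, cut p -> `|crd b p| <= M.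
  by exists (s0 ^+ 2) => i p; exact: cut_coord.
elim: m b bc => [|m IH] b bc; split=> //.
- by move=> i; exact: class_C_coord.
- by move=> i; exact: class_C_coord.
- move=> a a0.
  have B c : tangential m (fun=> crd c).
    by apply: IH; exists (s0 ^+ 2) => i p; exact: cut_coord.
  apply: tangential_eq (tangential_add
    (tangential_mul (tangential_cst m (val b == 0%N)%:R) (B a))
    (tangential_mul (tangential_cst m (val b == val a)%:R) (B 0))).
  by move=> i p _; rewrite boost_coord.
Qed.

Let time_neq0 i p : U i p -> p.1 != 0.
Proof. by move=> /Ufcone[t0 _]; rewrite gt_eqF. Qed.

Lemma tangential_invt m : tangential m (fun _ p => p.1^-1).
Proof.
have ci n i : class_C n (U i) (fun p => p.1^-1).
  by apply: class_C_inv (oU i) (@time_neq0 i) _; exact: class_C_fst.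
have bi : exists M, forall (i : T) p, cut p -> `|p.1^-1| <= M.
  exists 1 => i p /cut_time/andP[t1 _]; rewrite normfV invf_le1 gtr0_norm; lra.
elim: m => [|m IH]; split=> // a a0.
apply: tangential_eq (tangential_mul (tangential_cst m (-1))
  (tangential_mul (tangential_mul IH IH) (tangential_coord m a))).
move=> i p Up; have d1 : differentiable (fun q : pt => q.1) p.
  exact: (class_C_differentiable (class_C_fst 1 openT)).
have p0 := time_neq0 Up.
rewrite (boostV a d1 p0); have -> : boost a (fun q => q.1) p = crd a p.
  have := boost_coord a 0 p; rewrite /= mul1r => ->.
  by case: a a0 => [[|[|[|//]]] i'] //=; rewrite mul0r addr0.
by field.
Qed.

Lemma tangential_inv_hyp_sq m :
  tangential m (fun _ p => (p.1 ^+ 2 - p.2.1 ^+ 2 - p.2.2 ^+ 2)^-1).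
Proof.
have p0 i p : U i p -> p.1 ^+ 2 - p.2.1 ^+ 2 - p.2.2 ^+ 2 != 0.
  by move=> /Ufcone[_ f0]; rewrite gt_eqF.
have ci n i : class_C n (U i) (fun p => (p.1 ^+ 2 - p.2.1 ^+ 2 - p.2.2 ^+ 2)^-1).
  by apply: class_C_inv (oU i) (@p0 i) _; exact: class_C_form.
have bi : exists M, forall (i : T) p, cut p ->
    `|(p.1 ^+ 2 - p.2.1 ^+ 2 - p.2.2 ^+ 2)^-1| <= M.
  by exists (`|(s0 ^+ 2)^-1|) => i p [_ <-]; rewrite hyp_sqE.
case: m => [|m]; split=> // a a0.
apply: tangential_eq (tangential_cst m 0) => i p Up.
have dq : differentiable (fun p : pt => p.1 ^+ 2 - p.2.1 ^+ 2 - p.2.2 ^+ 2) p.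
  exact: (class_C_differentiable (class_C_form 1 openT)).
by rewrite (boostV a dq (p0 i p Up)) boost_hyp_sq// mulr0.
Qed.

(* pd_a = (1/t) L_a - (x_a/t) pd_t *)
Lemma tangential_pd m h a : tangential m.+1 h -> tangential m (fun i => pd 0 (h i)) ->
  tangential m (fun i => pd a (h i)).
Proof.
move=> th t0; have [a0|a0] := eqVneq (val a) 0%N.
  by have -> : a = 0 by exact: val_inj.
apply: tangential_eq (tangential_add
  (tangential_mul (tangential_invt m) (tangential_boost a0 th))
  (tangential_mul (tangential_cst m (-1)) (tangential_mul (tangential_invt m)
    (tangential_mul (tangential_coord m a) t0)))).
move=> i p /time_neq0 p0; rewrite boostE.
generalize (pd 0 (h i) p), (pd a (h i) p) => x y.
by field.
Qed.

(** By [boost_on_hyp], the boosts of [h] restricted to H_{s0} are expressed by the common datum [u]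
    alone, so their bounds are the same for all indices. *)
Lemma tangential_data m h (u : R * R -> R) : (forall i, class_C m (U i) (h i)) ->
  class_C m setT u -> (forall i x, h i (on_hyp s0 x) = u x) -> tangential m h.
Proof.
have bd h' (u' : R * R -> R) : class_C 0 setT u' ->
    (forall i x, h' i (on_hyp s0 x) = u' x) ->
    exists M, forall i p, cut p -> `|h' i p| <= M.
  move=> cu hu.
  (* By [cut_coord] this square contains the image of [cut s0] in the chart. *)
  pose K : set (R * R) := `[- s0 ^+ 2, s0 ^+ 2]%classic `*` `[- s0 ^+ 2, s0 ^+ 2]%classic.
  have cK : compact K by apply: compact_setX; exact: segment_compact.
  have [M [_ MK]] : bounded_set (u' @` K).
    apply: compact_bounded; apply: continuous_compact => //.
    by apply: continuous_subspaceT => x; exact: cu.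
  exists (M + 1) => i p Cp; have [cp Hp] := Cp; have /andP[t1 t2] := cut_time Cp.
  rewrite -(on_hyp_snd _ Hp); last by lra.
  rewrite hu; apply: (MK (M + 1)); first by lra.
  exists p.2 => //; split; rewrite /= in_itv /= -ler_norml.
    exact: (cut_coord 1 Cp).
  exact: (cut_coord 2 Cp).
elim: m h u => [|m IH] h u ch cu hu; split=> //.
- exact: bd cu hu.
- by apply: bd hu; exact: class_C_leq cu.
- move=> a a0; have o := @openT (R * R)%type.
  apply: (IH _ (fun x => Num.sqrt (s0 ^+ 2 + (x.1 ^+ 2 + x.2 ^+ 2))
    * 'D_((val a == 1%N)%:R, (val a == 2%N)%:R) u x)).
  + by move=> i; exact: class_C_boost.
  + apply: class_C_mul => //; first exact: class_C_on_hyp_time.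
    exact: class_C_derive cu.
  + move=> i x; apply: (boost_on_hyp s00 a0 (hu i)).
      apply: (class_C_differentiable (ch i)).
      by apply: HU; [exact: on_hyp_gt0|exact: hyp_sq_on_hyp].
    exact: (class_C_differentiable cu).
Qed.

End CauchyData.

Section InitialBounds.
Context (R : realType).
Notation pt := (R * (R * R))%type.
Notation crd := (@Defs.coord R).
Variables (s0 : R) (s01 : 1 < s0) (T : Type) (U : T -> set pt).
Hypotheses (oU : forall i, open (U i)) (Ufcone : forall i, U i `<=` @fcone R).
Arguments oU : clear implicits.
Hypothesis HU : forall i (p : pt), 0 < p.1 -> hyp_sq p = s0 ^+ 2 -> U i p.
Implicit Types (p : pt) (h : T -> pt -> R).
Local Notation cut := (cut s0).
Local Notation tangential := (bounded_upto U cut (fun a => val a != 0%N) (@boost R)).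
Local Notation full := (bounded_upto U cut xpredT (@pd R)).

Let cU i : cut `<=` U i. Proof. exact: (cutU HU). Qed.

Let time_neq0 i p : U i p -> p.1 != 0.
Proof. by move=> /Ufcone[t0 _]; rewrite gt_eqF. Qed.

Let pd_eq a (V : set pt) (g h : pt -> R) p : open V -> (forall q, V q -> g q = h q) ->
  V p -> pd a g p = pd a h p.
Proof. by move=> oV; exact: pd_open_eq. Qed.

Let full_eq m g h : (forall i p, U i p -> g i p = h i p) -> full m g -> full m h.
Proof. exact: (bounded_upto_eq oU cU pd_eq). Qed.

Let full_coord m b : full m (fun=> crd b).
Proof.
have bc : exists M, forall (i : T) p, cut p -> `|crd b p| <= M.
  by exists (s0 ^+ 2) => i p; exact: cut_coord.
case: m => [|m]; split=> //.
- by move=> i; exact: class_C_coord.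
- by move=> i; exact: class_C_coord.
- move=> a _; have := bounded_upto_cst oU cU xpredT pd_eq (fun a c => @pd_cst R c a) m (val a == val b)%:R.
  by apply: full_eq => i p _; rewrite pd_coord.
Qed.

Lemma full_boost m h a : full m.+1 h -> full m (fun i => boost a (h i)).
Proof.
move=> fh; have fpd b : full m (fun i => pd b (h i)) by exact: bounded_upto_X fh.
have fM := bounded_upto_mul oU cU pd_eq (fun a f1 f2 => @pdD R f1 f2 a) (fun a f1 f2 => @pdM R f1 f2 a).
apply: full_eq (bounded_upto_add oU cU pd_eq (fun a f1 f2 => @pdD R f1 f2 a)
  (fM _ _ _ _ (full_coord m a) (fpd 0)) (fM _ _ _ _ (full_coord m 0) (fpd a))).
by [].
Qed.

Lemma full_iter X m n h : (forall m h, full m.+1 h -> full m (fun i => X (h i))) ->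
  full (m + n) h -> full m (fun i => iter n X (h i)).
Proof.
move=> fX; elim: n m => [|n IH] m; first by rewrite addn0.
by move=> fh; apply: fX; apply: IH; rewrite addSnnS.
Qed.

Lemma full_Zn m a b c d e h : full (m + a + b + c + d + e) h ->
  full m (fun i => Zn a b c d e (h i)).
Proof.
have fpd j m' h' : full m'.+1 h' -> full m' (fun i => pd j (h' i)).
  exact: bounded_upto_X.
move=> fh; apply: (full_iter (fpd 0)); apply: (full_iter (fpd 1)).
apply: (full_iter (fpd 2)); apply: (full_iter (fun m' h' => @full_boost m' h' 1)).
by apply: (full_iter (fun m' h' => @full_boost m' h' 2)).
Qed.

Variables (N : nat) (f phi : T -> pt -> R) (u0 u1 : R * R -> R).
Hypothesis cphi : forall i, class_C N.+4 (U i) (phi i).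
Hypothesis phif : forall i p, U i p -> negbox (phi i) p = f i p.
Hypotheses (cu0 : forall n, class_C n setT u0) (cu1 : forall n, class_C n setT u1).
Hypothesis phi_data : forall i x, phi i (on_hyp s0 x) = u0 x.
Hypothesis dphi_data : forall i x, pd 0 (phi i) (on_hyp s0 x) = u1 x.
Hypothesis f_bound : forall a b c d e, (a + b + c + d + e <= N)%N ->
  exists M, forall i p, cut p -> `|Zn a b c d e (f i) p| <= M.

Let cf i : class_C N.+2 (U i) (f i).
Proof. exact: (class_C_congr (oU i) (@phif i) (class_C_negbox (oU i) (cphi i))). Qed.

(** A boost maps a combination of order [n] to one of order [n + 1], hence the budget [n + m <= N]
    of derivatives of the source. *)
Lemma tangential_zspan m n h : zspan U f n h -> (n + m <= N)%N -> tangential m h.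
Proof.
have bz n' h' : zspan U f n' h' -> (n' <= N)%N ->
    exists M, forall i p, cut p -> `|h' i p| <= M.
  move=> zh nN; have [||||M bM] := @zspan_bound R T U f (fun=> cut) (fun=> 1) N n' h' _ _ _ _ zh nN.
  - exact: cU.
  - by [].
  - by move=> j _ p [cp _]; exact: cone_ratio.
  - move=> a b c d e le; have [M fM] := f_bound le.
    by exists M => i p; rewrite mulr1; exact: fM.
  - by exists M => i p Cp; have := bM i p Cp; rewrite mulr1.
elim: m n h => [|m IH] n h zh nm; split=> //.
- by move=> i; apply: (zspan_class oU time_neq0 cf zh); lia.
- by apply: bz zh _; lia.
- by move=> i; apply: (zspan_class oU time_neq0 cf zh); lia.
- by apply: bz zh _; lia.
- move=> a a0; have aE : a = 1 \/ a = 2.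
    by case: a a0 => [[|[|[|//]]] i] // _; [left|right]; exact: val_inj.
  have nk : (n < N.+2)%N by lia.
  by case: aE => ->; apply: (IH n.+1); rewrite ?addSnnS//;
    [exact: (zspan_boost1 oU time_neq0 cf zh nk)
    |exact: (zspan_boost2 oU time_neq0 cf zh nk)].
Qed.

Lemma negbox_iter_pd0 i a p : (a <= N)%N -> U i p ->
  negbox (iter a (pd 0) (phi i)) p = iter a (pd 0) (f i) p.
Proof.
move=> aN Up; have cpd n g : class_C n.+1 (U i) g -> class_C n (U i) (pd 0 g).
  exact: class_C_pd.
have epd f1 f2 : (forall q, U i q -> f1 q = f2 q) ->
    forall p, U i p -> pd 0 f1 p = pd 0 f2 p.
  by move=> gh q Uq; exact: (pd_open_eq 0 (oU i) gh Uq).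
apply: etrans (iter_open_eq a epd (@phif i) Up).
apply: (@iter_commute R (U i) (pd 0) (@negbox R) 2 a (phi i) cpd epd) => //.
  by move=> g cg q Uq; exact: (negbox_pd (oU i) 0 cg Uq).
by apply: class_C_leq (cphi i); lia.
Qed.

(* The step uses (s/t)^2 pd_t^2 psi = -Box psi
   + sum_b ((1/t) L_b pd_b psi - (x_b/t^2) L_b pd_t psi). *)
Lemma tangential_iter_pd0 m a : (m + a <= N.+2)%N ->
  tangential m (fun i => iter a (pd 0) (phi i)).
Proof.
(* Two consecutive orders in pd_t are carried, since the equation gives order [a + 2] from orders
   [a] and [a + 1]; each further time derivative costs one boost. *)
suff [] : (forall m, (m + a <= N.+2)%N -> tangential m (fun i => iter a (pd 0) (phi i)))
  /\ (forall m, (m + a.+1 <= N.+2)%N -> tangential m (fun i => iter a.+1 (pd 0) (phi i))).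
  by move=> + _; exact.
have TM := tangential_mul oU HU; have TA := tangential_add oU HU.
have TX := tangential_coord oU HU; have TV := tangential_invt oU Ufcone HU.
have TH := tangential_inv_hyp_sq oU Ufcone HU; have TC := tangential_cst oU HU.
elim: a {m} => [|a [IH0 IH1]].
  split=> m ma.
    apply: (tangential_data s01 oU HU _ (cu0 m)) => //.
    by move=> i; apply: class_C_leq (cphi i); lia.
  apply: (tangential_data s01 oU HU _ (cu1 m)) => //.
  by move=> i; apply: class_C_pd; apply: class_C_leq (cphi i); lia.
split=> // m ma; pose psi i := iter a (pd 0) (phi i).
have t2 : tangential m.+2 psi by apply: IH0; lia.
have t1 : tangential m.+1 (fun i => pd 0 (psi i)) by apply: IH1; lia.
have tb b : tangential m.+1 (fun i => pd b (psi i)).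
  exact: (tangential_pd oU Ufcone HU b t2 t1).
have tF : tangential m (fun i => iter a (pd 0) (f i)).
  by apply: (@tangential_zspan m a); [apply: (zspan_Z U f (b:=0) (c:=0) (d:=0) (e:=0)); lia|lia].
have tterm b : val b != 0%N -> tangential m (fun i p => p.1^-1 * boost b (pd b (psi i)) p
    + (-1) * (crd b p * (p.1^-1 * (p.1^-1 * boost b (pd 0 (psi i)) p)))).
  move=> b0; apply: TA; first exact: (TM _ _ _ (TV m) (tangential_boost b0 (tb b))).
  exact: (TM _ _ _ (TC m (-1)) (TM _ _ _ (TX m b) (TM _ _ _ (TV m)
    (TM _ _ _ (TV m) (tangential_boost b0 t1))))).
have t12 := TA _ _ _ tF (TA _ _ _ (tterm 1 isT) (tterm 2 isT)).
apply: (tangential_eq oU HU _ (TM _ _ _ (TX m 0) (TM _ _ _ (TX m 0) (TM _ _ _ (TH m) t12)))).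
move=> i p Up; have [t0 q0] := Ufcone Up.
have aN : (a <= N)%N by lia.
have tn : p.1 != 0 by rewrite gt_eqF.
have qn : p.1 ^+ 2 - p.2.1 ^+ 2 - p.2.2 ^+ 2 != 0 by rewrite gt_eqF.
have cpsi : class_C 2 (U i) (psi i).
  apply: class_C_iter; first by move=> n g; exact: class_C_pd.
  by apply: class_C_leq (cphi i); lia.
have := negbox_iter_pd0 aN Up; rewrite -/(psi i) iterS iterS -/(psi i) /negbox => <-.
have := pd_commute 1 0 (oU i) cpsi Up; have := pd_commute 2 0 (oU i) cpsi Up.
have := boostE 1 (pd 1 (psi i)) p; have := boostE 2 (pd 2 (psi i)) p.
have := boostE 1 (pd 0 (psi i)) p; have := boostE 2 (pd 0 (psi i)) p.
generalize (boost 1 (pd 1 (psi i)) p), (boost 2 (pd 2 (psi i)) p),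
  (boost 1 (pd 0 (psi i)) p), (boost 2 (pd 0 (psi i)) p).
generalize (pd 0 (pd 0 (psi i)) p), (pd 1 (pd 1 (psi i)) p),
  (pd 2 (pd 2 (psi i)) p), (pd 0 (pd 1 (psi i)) p), (pd 0 (pd 2 (psi i)) p),
  (pd 1 (pd 0 (psi i)) p), (pd 2 (pd 0 (psi i)) p).
move=> w00 w11 w22 w01 w02 w10 w20 b11 b22 b10 b20 -> -> -> -> -> ->; rewrite /Defs.coord /=.
by field; apply/andP; split; [exact: tn|exact: qn].
Qed.

Lemma tangential_Zn_pd m a b c : (m + (a + b + c) <= N.+2)%N ->
  tangential m (fun i => Zn a b c 0 0 (phi i)).
Proof.
elim: c b a m => [|c IHc].
  elim=> [|b IHb] a m le; first by apply: tangential_iter_pd0; lia.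
  apply: (tangential_eq oU HU (g := fun i => pd 1 (Zn a b 0 0 0 (phi i)))).
    move=> i p Up; have ck : class_C (a + b + 0 + 0 + 0 + 1) (U i) (phi i).
      by apply: class_C_leq (cphi i); lia.
    by have [-> _] := pd_Zn (oU i) ck Up.
  apply: (tangential_pd oU Ufcone HU (h := fun i => Zn a b 0 0 0 (phi i)) 1).
    by apply: IHb; lia.
  by apply: (IHb a.+1 m); lia.
move=> b a m le.
apply: (tangential_eq oU HU (g := fun i => pd 2 (Zn a b c 0 0 (phi i)))).
  move=> i p Up; have ck : class_C (a + b + c + 0 + 0 + 1) (U i) (phi i).
    by apply: class_C_leq (cphi i); lia.
  by have [_ ->] := pd_Zn (oU i) ck Up.
apply: (tangential_pd oU Ufcone HU (h := fun i => Zn a b c 0 0 (phi i)) 2).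
  by apply: IHc; lia.
by apply: (IHc b a.+1 m); lia.
Qed.

(** A further partial derivative only raises one of the three exponents, so it is enough that each
    word in the partial derivatives of length at most N + 2 is bounded, which is [tangential_Zn_pd]
    without boosts. *)
Lemma full_Zn_pd m a b c : (m + (a + b + c) <= N.+2)%N ->
  full m (fun i => Zn a b c 0 0 (phi i)).
Proof.
elim: m a b c => [|m IH] a b c le.
  by have [? ? _] := tangential_Zn_pd le.
split.
- by move=> i; apply: class_C_Zn => //; apply: class_C_leq (cphi i); lia.
- by apply: bounded_upto_bound (tangential_Zn_pd (m := 0) _); lia.
- move=> j _; have ck i : class_C (a + b + c + 0 + 0 + 1) (U i) (phi i).
    by apply: class_C_leq (cphi i); lia.
  have jE : [\/ j = 0, j = 1 | j = 2].
    by case: j => [[|[|[|//]]] ij]; [constructor 1|constructor 2|constructor 3]; exact: val_inj.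
  case: jE => ->.
  + by apply: (IH a.+1); lia.
  + apply: (full_eq (g := fun i => Zn a b.+1 c 0 0 (phi i))); last by apply: IH; lia.
    by move=> i p Up; have [-> _] := pd_Zn (oU i) (ck i) Up.
  + apply: (full_eq (g := fun i => Zn a b c.+1 0 0 (phi i))); last by apply: IH; lia.
    by move=> i p Up; have [_ ->] := pd_Zn (oU i) (ck i) Up.
Qed.

Lemma initial_bounds a b c d e : (a + b + c + d + e <= N)%N ->
  exists2 M, 0 <= M & forall i p, cut p ->
    `|Zn a b c d e (phi i) p| <= M /\ forall j, `|pd j (Zn a b c d e (phi i)) p| <= M.
Proof.
move=> le; have F : full 1 (fun i => Zn a b c d e (phi i)).
  apply: full_Zn; apply: (bounded_upto_leq (n := N.+2)); first by lia.
  by apply: (@full_Zn_pd N.+2 0 0 0); lia.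
have [M0 b0] := bounded_upto_bound F.
have B j := bounded_upto_bound (bounded_upto_X (a := j) isT F).
have [[M1 b1] [M2 b2] [M3 b3]] := And3 (B 0) (B 1) (B 2).
have [n0 n1 n2 n3] := And4 (normr_ge0 M0) (normr_ge0 M1) (normr_ge0 M2) (normr_ge0 M3).
have [l0 l1 l2 l3] := And4 (ler_norm M0) (ler_norm M1) (ler_norm M2) (ler_norm M3).
exists (`|M0| + `|M1| + `|M2| + `|M3|); first by lra.
move=> i p Cp; split; first by have := b0 i p Cp; lra.
case=> [[|[|[|//]]] ij].
- by rewrite (_ : Ordinal ij = 0); [have := b1 i p Cp; lra|exact: val_inj].
- by rewrite (_ : Ordinal ij = 1); [have := b2 i p Cp; lra|exact: val_inj].
- by rewrite (_ : Ordinal ij = 2); [have := b3 i p Cp; lra|exact: val_inj].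
Qed.

End InitialBounds.

(** * Commutation of Z^I with -Box and vanishing outside the cone *)

Section PointwiseBounds.
Context (R : realType).
Notation pt := (R * (R * R))%type.
Implicit Types (p : pt) (V : set pt).

Lemma Zn_open_eq V a b c d e (g h : pt -> R) : open V ->
  (forall q, V q -> g q = h q) ->
  forall p, V p -> Zn a b c d e g p = Zn a b c d e h p.
Proof.
move=> oV gh; have epd j (f1 f2 : pt -> R) : (forall q, V q -> f1 q = f2 q) ->
    forall p, V p -> pd j f1 p = pd j f2 p.
  by move=> ff q Vq; exact: (pd_open_eq j oV ff Vq).
have ebo j (f1 f2 : pt -> R) : (forall q, V q -> f1 q = f2 q) ->
    forall p, V p -> boost j f1 p = boost j f2 p.
  by move=> ff q Vq; exact: (boost_open_eq oV j ff Vq).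
apply: (iter_open_eq a (epd 0)); apply: (iter_open_eq b (epd 1)).
apply: (iter_open_eq c (epd 2)); apply: (iter_open_eq d (ebo 1)).
exact: (iter_open_eq e (ebo 2)).
Qed.

Lemma Zn_zero a b c d e : Zn a b c d e (fun=> 0 : R) = (fun=> 0 : R) :> (pt -> R).
Proof.
have it m (X : (pt -> R) -> pt -> R) : X (fun=> 0) = (fun=> 0) ->
    iter m X (fun=> 0) = (fun=> 0).
  by move=> X0; elim: m => [//|m IH]; rewrite iterS IH.
have p0 j : pd j (fun=> 0 : R) = (fun=> 0 : R) :> (pt -> R).
  by apply/funext => p; exact: pd_cst.
have b0 j : boost j (fun=> 0 : R) = (fun=> 0 : R) :> (pt -> R).
  by apply/funext => p; exact: boost_cst.
by rewrite /Zn (it e) ?(it d) ?(it c) ?(it b) ?(it a).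
Qed.

Lemma negbox_iter V X m (g h : pt -> R) : open V ->
  (forall n g, class_C n.+1 V g -> class_C n V (X g)) ->
  (forall f1 f2, (forall q, V q -> f1 q = f2 q) -> forall p, V p -> X f1 p = X f2 p) ->
  (forall g, class_C 3 V g -> forall p, V p -> negbox (X g) p = X (negbox g) p) ->
  class_C (m + 2) V g -> (forall q, V q -> negbox g q = h q) ->
  forall q, V q -> negbox (iter m X g) q = iter m X h q.
Proof.
move=> oV cX eX XB cg gh q Vq; apply: etrans (iter_open_eq m eX gh Vq).
exact: (@iter_commute R V X (@negbox R) 2 m g cX eX XB cg q Vq).
Qed.

Lemma negbox_Zn V a b c d e (g h : pt -> R) : open V ->
  class_C (a + b + c + d + e + 2) V g -> (forall q, V q -> negbox g q = h q) ->
  forall q, V q -> negbox (Zn a b c d e g) q = Zn a b c d e h q.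
Proof.
move=> oV cg gh; have cpd j n (f1 : pt -> R) : class_C n.+1 V f1 -> class_C n V (pd j f1).
  exact: class_C_pd.
have epd j (f1 f2 : pt -> R) : (forall q, V q -> f1 q = f2 q) ->
    forall p, V p -> pd j f1 p = pd j f2 p.
  by move=> ff q Vq; exact: (pd_open_eq j oV ff Vq).
have npd j (f1 : pt -> R) : class_C 3 V f1 ->
    forall p, V p -> negbox (pd j f1) p = pd j (negbox f1) p.
  by move=> cf q Vq; exact: (negbox_pd oV j cf Vq).
have cbo j n (f1 : pt -> R) : class_C n.+1 V f1 -> class_C n V (boost j f1).
  exact: class_C_boost.
have ebo j (f1 f2 : pt -> R) : (forall q, V q -> f1 q = f2 q) ->
    forall p, V p -> boost j f1 p = boost j f2 p.
  by move=> ff q Vq; exact: (boost_open_eq oV j ff Vq).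
have nbo (j : 'I_3) (f1 : pt -> R) : val j != 0%N -> class_C 3 V f1 ->
    forall p, V p -> negbox (boost j f1) p = boost j (negbox f1) p.
  by move=> j0 cf q Vq; exact: (negbox_boost oV cf Vq j0).
apply: (negbox_iter oV (cpd 0) (epd 0) (npd 0)).
  by apply: (@class_C_Zn R V 0 b c d e (a + 2) g oV); apply: class_C_leq cg; lia.
apply: (negbox_iter oV (cpd 1) (epd 1) (npd 1)).
  by apply: (@class_C_Zn R V 0 0 c d e (b + 2) g oV); apply: class_C_leq cg; lia.
apply: (negbox_iter oV (cpd 2) (epd 2) (npd 2)).
  by apply: (@class_C_Zn R V 0 0 0 d e (c + 2) g oV); apply: class_C_leq cg; lia.
apply: (negbox_iter oV (cbo 1) (ebo 1) (fun f1 => nbo 1 f1 isT)).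
  by apply: (@class_C_Zn R V 0 0 0 0 e (d + 2) g oV); apply: class_C_leq cg; lia.
apply: (negbox_iter oV (cbo 2) (ebo 2) (fun f1 => nbo 2 f1 isT)) => //.
by apply: class_C_leq cg; lia.
Qed.

(** Off the closed cone all nearby points are outside it too, and on its boundary
    [vanishes_near_bd_cone] applies. A full neighbourhood is produced because the derivatives of [g]
    must vanish at [p] as well. *)
Lemma vanishing_nbhs V (g : pt -> R) p : open V -> (forall p, V p -> ~ cone p -> g p = 0) ->
  vanishes_near_bd_cone V g -> V p -> ~ cone p ->
  exists W, [/\ open W, W p, W `<=` V & forall q, W q -> g q = 0].
Proof.
move=> oV g0 gbd Vp np.
suff n0 : \forall q \near p, V q -> g q = 0.
  have nV : \forall q \near p, V q by apply: open_nbhs_nbhs.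
  exists (interior [set q | V q /\ g q = 0]); split.
  - exact: open_interior.
  - by near=> q; split; [near: q|apply: (near n0 q) => //; near: q].
  - by move=> q /interior_subset[].
  - by move=> q /interior_subset[].
have [lt|gt|eq] := ltgtP (p.1 - 1) (eucl_len p.2).
- pose k (q : pt) := eucl_len q.2 - (q.1 - 1).
  have kp : 0 < k p by rewrite subr_gt0.
  have ck : {for p, continuous k}.
    have c0 := class_C_continuous (class_C_fst 0 (@openT pt)) (I : setT p).
    have c1 := class_C_continuous (class_C_x1 0 (@openT pt)) (I : setT p).
    have c2 := class_C_continuous (class_C_x2 0 (@openT pt)) (I : setT p).
    by rewrite /k /eucl_len; continuous_rules.
  have nk : nbhs (k p) [set x | 0 < x].
    by apply: open_nbhs_nbhs; split; [exact: open_gt|exact: kp].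
  have : \forall q \near p, 0 < k q by exact: (ck _ nk).
  apply: filterS => q kq Vq; apply: g0 => //.
  by move: kq; rewrite /k /cone /=; lra.
- by case: np.
- exact: gbd.
Unshelve. all: by end_near.
Qed.

End PointwiseBounds.

(** * Bounds on the slab *)

Section SolutionBounds.
Context (R : realType).
Notation pt := (R * (R * R))%type.
Variables (s0 : R) (s01 : 1 < s0) (T : Type) (s1 : T -> R) (U : T -> set pt).
Hypotheses (oU : forall i, open (U i)) (Ufcone : forall i, U i `<=` @fcone R).
Arguments oU : clear implicits.
Hypotheses (s1_ge : forall i, s0 <= s1 i) (slabU : forall i, slab s0 (s1 i) `<=` U i).
Implicit Types (p : pt).

Let s00 : 0 < s0. Proof. exact: lt_trans ltr01 s01. Qed.

Lemma cut_slab i p : 0 < p.1 -> hyp_sq p = s0 ^+ 2 -> slab s0 (s1 i) p.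
Proof.
move=> p0 Hp; split=> //; rewrite Hp lexx /=.
have s10 := le_trans (ltW s00) (s1_ge i).
by rewrite ler_pXn2r ?nnegrE// ltW.
Qed.

Let HU i p : 0 < p.1 -> hyp_sq p = s0 ^+ 2 -> U i p.
Proof. by move=> p0 Hp; exact: (slabU (cut_slab i p0 Hp)). Qed.

Variables (N : nat) (A : R) (A0 : 0 <= A) (f phi : T -> pt -> R) (u0 u1 : R * R -> R).
Hypothesis cphi : forall i, class_C N.+4 (U i) (phi i).
Hypothesis phif : forall i p, U i p -> negbox (phi i) p = f i p.
Hypotheses (cu0 : forall n, class_C n setT u0) (cu1 : forall n, class_C n setT u1).
Hypothesis phi_data : forall i x, phi i (on_hyp s0 x) = u0 x.
Hypothesis dphi_data : forall i x, pd 0 (phi i) (on_hyp s0 x) = u1 x.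
Hypothesis phi_cone : forall i p, U i p -> ~ cone p -> phi i p = 0.
Hypothesis phi_bd : forall i, vanishes_near_bd_cone (U i) (phi i).
Hypothesis f_bound : forall i a b c d e, (a + b + c + d + e <= N)%N ->
  forall p, cone_slab s0 (s1 i) p -> `|Zn a b c d e (f i) p| <= A * p.1 ^- 2.

Lemma Zn_vanish i a b c d e p : U i p -> ~ cone p ->
  Zn a b c d e (phi i) p = 0 /\ (forall j, pd j (Zn a b c d e (phi i)) p = 0) /\
  negbox (Zn a b c d e (phi i)) p = 0.
Proof.
move=> Up np; have [W [oW Wp _ W0]] := vanishing_nbhs (oU i) (@phi_cone i) (@phi_bd i) Up np.
have ZW q : W q -> Zn a b c d e (phi i) q = 0.
  by move=> Wq; rewrite (Zn_open_eq a b c d e oW W0 Wq) Zn_zero.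
split; first exact: ZW.
have z0 j q : pd j (fun=> 0 : R) q = 0 by exact: pd_cst.
split; first by move=> j; rewrite (pd_open_eq j oW ZW Wp) pd_cst.
rewrite (negbox_open_eq oW ZW Wp) /negbox.
have z00 j : pd j (pd j (fun=> 0 : R)) p = 0.
  by rewrite (pd_open_eq j (@openT pt) (fun q _ => z0 j q) I) z0.
by rewrite !z00 !subr0.
Qed.

(** The bound on the source holds inside the cone only, while the comparison takes place on full
    hyperboloids; outside, the solution vanishes near the point. *)
Lemma negbox_Zn_bound i a b c d e p : (a + b + c + d + e <= N)%N ->
  slab s0 (s1 i) p -> `|negbox (Zn a b c d e (phi i)) p| <= A * p.1 ^- 2.
Proof.
move=> le Sp; have Up := slabU Sp.
have [cp|np] := pselect (cone p); last first.
  have [_ [_ ->]] := Zn_vanish a b c d e Up np.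
  by rewrite normr0 mulr_ge0// invr_ge0 sqr_ge0.
have ck : class_C (a + b + c + d + e + 2) (U i) (phi i).
  by apply: class_C_leq (cphi i); lia.
rewrite (negbox_Zn (oU i) ck (@phif i) Up); apply: f_bound => //.
by split=> //; case: Sp.
Qed.

Lemma cut_Zn_bound a b c d e : (a + b + c + d + e <= N)%N ->
  exists2 M, 0 <= M & forall i p, cut s0 p ->
    `|Zn a b c d e (phi i) p| <= M /\ forall j, `|pd j (Zn a b c d e (phi i)) p| <= M.
Proof.
apply: (initial_bounds s01 oU Ufcone HU cphi phif cu0 cu1 phi_data dphi_data).
move=> a' b' c' d' e' le; exists A => i p Cp.
have /andP[t1 _] := cut_time Cp.
have Cs : cone_slab s0 (s1 i) p.
  by case: Cp => cp Hp; split=> //; have [//|_ ->] := @cut_slab i p _ Hp; lra.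
apply: (le_trans (f_bound le Cs)); apply: ler_piMr => //.
by rewrite invf_le1 ?exprn_gt0 ?exprn_ege1//; lra.
Qed.

Lemma Zn_bound a b c d e : (a + b + c + d + e <= N)%N ->
  exists M, forall i p, slab s0 (s1 i) p ->
    `|Zn a b c d e (phi i) p| <= M * (Num.sqrt (hyp_sq p) / p.1).
Proof.
move=> le; have [B B0 bB] := cut_Zn_bound le.
have [M _ bM] := wave_pointwise_bound s01 A0 B0.
exists M => i; apply: (bM _ (U i)) => //.
- by apply: class_C_Zn => //; apply: class_C_leq (cphi i); lia.
- by move=> p; exact: negbox_Zn_bound.
- move=> p p0 Hp; case: asboolP => [cp|np]; first exact: bB.
  by have [-> [? _]] := Zn_vanish a b c d e (HU i p0 Hp) np.
Qed.

Lemma slab_time_ge1 (s : R) p : slab s0 s p -> 1 <= p.1.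
Proof.
move=> [p0 /andP[Hp _]]; rewrite -(ler_pXn2r (n := 2)) ?nnegrE// ?(ltW p0)//.
apply: le_trans (le_trans Hp _); first by rewrite expr1n exprn_ege1// ltW.
by rewrite /hyp_sq lerBlDr lerDl sqr_ge0.
Qed.

Lemma slab_ratio (s : R) j p : slab s0 s p -> `|ratio j p| <= 1.
Proof.
move=> Sp; have t1 := slab_time_ge1 Sp; have [p0 Hp] := slab_fcone s00 Sp.
rewrite /ratio normrM [`|_^-1|]gtr0_norm ?invr_gt0//.
rewrite ler_pdivrMr ?mul1r//.
have b (y : R) : y ^+ 2 <= p.1 ^+ 2 -> `|y| <= p.1.
  by move=> yl; rewrite -(ler_pXn2r (n := 2)) ?nnegrE// ?real_normK ?num_real// ltW.
have [q1 q2] := (sqr_ge0 p.2.1, sqr_ge0 p.2.2).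
case: j => [[|[|[|//]]] i]; rewrite /Defs.coord /= ?normr1.
- by [].
- by apply: b; lra.
- by apply: b; lra.
Qed.

Lemma zspan_slab_bound n h : zspan U phi n h -> (n <= N)%N ->
  exists M, forall i p, slab s0 (s1 i) p ->
    `|h i p| <= M * (Num.sqrt (hyp_sq p) / p.1).
Proof.
apply: zspan_bound => //.
- by move=> i p [p0 _]; rewrite divr_ge0 ?sqrtr_ge0// ltW.
- by move=> j i p; exact: slab_ratio.
- by move=> a b c d e; exact: Zn_bound.
Qed.

End SolutionBounds.

(** * Integration along rays *)

Section Rays.
Context (R : realType).
Notation pt := (R * (R * R))%type.
Variables (U : set pt) (oU : open U).
Implicit Types (p : pt) (g : pt -> R).

Definition scaling g p : R := p.1 * pd 0 g p + p.2.1 * pd 1 g p + p.2.2 * pd 2 g p.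

Lemma class_C_scaling n g : class_C n.+1 U g -> class_C n U (scaling g).
Proof.
move=> cg; have c j := class_C_pd j cg.
exact: (class_C_add oU (class_C_add oU (class_C_mul oU (class_C_fst n oU) (c 0))
  (class_C_mul oU (class_C_x1 n oU) (c 1))) (class_C_mul oU (class_C_x2 n oU) (c 2))).
Qed.

Lemma pd_scaling_like (f0 f1 f2 : pt -> R) b p : differentiable f0 p ->
  differentiable f1 p -> differentiable f2 p ->
  pd b (fun p => p.1 * f0 p + p.2.1 * f1 p + p.2.2 * f2 p) p =
  (val b == 0%N)%:R * f0 p + (val b == 1%N)%:R * f1 p + (val b == 2%N)%:R * f2 p
  + (p.1 * pd b f0 p + p.2.1 * pd b f1 p + p.2.2 * pd b f2 p).
Proof.
move=> d0 d1 d2.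
have x0 := class_C_differentiable (class_C_fst 1 (@openT pt)) (I : setT p).
have x1 := class_C_differentiable (class_C_x1 1 (@openT pt)) (I : setT p).
have x2 := class_C_differentiable (class_C_x2 1 (@openT pt)) (I : setT p).
rewrite (pdD b (differentiableD (differentiableM x0 d0) (differentiableM x1 d1))
  (differentiableM x2 d2)).
rewrite (pdD b (differentiableM x0 d0) (differentiableM x1 d1)).
rewrite (pdM b x0 d0) (pdM b x1 d1) (pdM b x2 d2) pd_fst pd_x1 pd_x2.
generalize (pd b f0 p), (pd b f1 p), (pd b f2 p) => *.
by ring.
Qed.

(* S^2 + S is s^2 times the radial part of -Box in hyperbolic coordinates. *)
Lemma scaling_scaling g p : class_C 2 U g -> U p -> p.1 != 0 ->
  scaling (scaling g) p + scaling g p = hyp_sq p * negbox g p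
  + (boost 1 (boost 1 g) p + boost 2 (boost 2 g) p
     - (ratio 1 p * ratio 1 p * boost 2 (boost 2 g) p
        - ratio 1 p * ratio 2 p * (boost 1 (boost 2 g) p + boost 2 (boost 1 g) p)
        + ratio 2 p * ratio 2 p * boost 1 (boost 1 g) p)
     + ratio 1 p * boost 1 g p + ratio 2 p * boost 2 g p).
Proof.
move=> cg Up tn; have d j := class_C_differentiable (class_C_pd j cg) Up.
have S b : pd b (scaling g) p = (val b == 0%N)%:R * pd 0 g p + (val b == 1%N)%:R * pd 1 g p
    + (val b == 2%N)%:R * pd 2 g p
    + (p.1 * pd b (pd 0 g) p + p.2.1 * pd b (pd 1 g) p + p.2.2 * pd b (pd 2 g) p).
  exact: (pd_scaling_like b (d 0) (d 1) (d 2)).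
have B a b : pd b (boost a g) p = (val b == val a)%:R * pd 0 g p
    + Defs.coord a p * pd b (pd 0 g) p
    + ((val b == 0%N)%:R * pd a g p + p.1 * pd b (pd a g) p).
  exact: (pd_boost_like a b (d 0) (d a)).
have SE : scaling (scaling g) p = p.1 * pd 0 (scaling g) p + p.2.1 * pd 1 (scaling g) p
    + p.2.2 * pd 2 (scaling g) p by exact: erefl.
have e10 := pd_commute 1 0 oU cg Up; have e20 := pd_commute 2 0 oU cg Up.
have e21 := pd_commute 2 1 oU cg Up.
have := boostE 1 (boost 1 g) p; have := boostE 2 (boost 2 g) p.
have := boostE 1 (boost 2 g) p; have := boostE 2 (boost 1 g) p.
move: (B 1 0) (B 1 1) (B 1 2) (B 2 0) (B 2 1) (B 2 2).
move: SE (S 0) (S 1) (S 2); generalize (scaling (scaling g) p) => SS.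
generalize (pd 0 (scaling g) p), (pd 1 (scaling g) p), (pd 2 (scaling g) p) => S0 S1 S2.
generalize (boost 1 (boost 1 g) p), (boost 2 (boost 2 g) p),
 (boost 1 (boost 2 g) p), (boost 2 (boost 1 g) p) => b11 b22 b12 b21.
generalize (pd 0 (boost 1 g) p), (pd 1 (boost 1 g) p), (pd 2 (boost 1 g) p),
 (pd 0 (boost 2 g) p), (pd 1 (boost 2 g) p), (pd 2 (boost 2 g) p) => p01 p11 p21 p02 p12 p22.
move: (boostE 1 g p) (boostE 2 g p).
generalize (boost 1 g p), (boost 2 g p) => b1 b2.
rewrite /scaling /negbox; move: e10 e20 e21.
generalize (pd 0 (pd 0 g) p), (pd 1 (pd 1 g) p), (pd 2 (pd 2 g) p),
  (pd 0 (pd 1 g) p), (pd 0 (pd 2 g) p), (pd 1 (pd 2 g) p),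
  (pd 1 (pd 0 g) p), (pd 2 (pd 0 g) p), (pd 2 (pd 1 g) p).
move=> w00 w11 w22 w01 w02 w12 w10 w20 w21 -> -> ->.
generalize (pd 0 g p), (pd 1 g p), (pd 2 g p) => w0 w1 w2.
move=> -> -> -> -> -> -> -> -> -> -> -> -> -> -> -> ->.
rewrite hyp_sqE /ratio /Defs.coord /=.
rewrite !(mul0r, mul1r, add0r, addr0).
case: p tn {Up d S B} => t [x y] /= tn.
by field.
Qed.

End Rays.

Section RayEstimate.
Context (R : realType).
Notation pt := (R * (R * R))%type.
Variables (U : set pt) (oU : open U).
Implicit Types (p : pt) (g : pt -> R).

Lemma is_derive_ray g t x y (z : R) : class_C 2 U g -> U (z * t, (z * x, z * y)) ->
  is_derive z 1 (fun z => z * scaling g (z * t, (z * x, z * y)))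
    (scaling (scaling g) (z * t, (z * x, z * y)) + scaling g (z * t, (z * x, z * y))).
Proof.
move=> cg Uz; have dS := class_C_differentiable (class_C_scaling oU cg) Uz.
have dl c : is_derive z 1 (fun z : R => z * c) c by derive_as; ring.
have dF : is_derive z 1 (fun z : R => scaling g (z * t, (z * x, z * y)))
    (t * pd 0 (scaling g) (z * t, (z * x, z * y))
    + x * pd 1 (scaling g) (z * t, (z * x, z * y))
    + y * pd 2 (scaling g) (z * t, (z * x, z * y))).
  exact: (@is_derive_curve R (scaling g) (fun z => z * t) (fun z => z * x)
  (fun z => z * y) t x y z dS (dl t) (dl x) (dl y)).
have SE : scaling (scaling g) (z * t, (z * x, z * y)) =
    (z * t) * pd 0 (scaling g) (z * t, (z * x, z * y))
    + (z * x) * pd 1 (scaling g) (z * t, (z * x, z * y))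
    + (z * y) * pd 2 (scaling g) (z * t, (z * x, z * y)) by exact: erefl.
derive_as; move: SE; generalize (scaling (scaling g) (z * t, (z * x, z * y))).
generalize (pd 0 (scaling g) (z * t, (z * x, z * y))),
  (pd 1 (scaling g) (z * t, (z * x, z * y))), (pd 2 (scaling g) (z * t, (z * x, z * y))).
generalize (scaling g (z * t, (z * x, z * y))) => c0 c1 c2 c3 c4 ->.
by ring.
Qed.

Lemma norm_le3 (a b c A B C : R) : `|a| <= A -> `|b| <= B -> `|c| <= C ->
  `|a + b + c| <= A + B + C.
Proof.
move=> aA bB cC; apply: (le_trans (ler_normD _ _)); apply: lerD => //.
by apply: (le_trans (ler_normD _ _)); apply: lerD.
Qed.

Lemma norm_ratio_mul (r a A : R) : `|r| <= 1 -> `|a| <= A -> `|r * a| <= A.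
Proof. by move=> r1 aA; rewrite normrM; apply: le_trans aA; apply: ler_piMl. Qed.

(** The error terms of [scaling_scaling] are eight products of size [Y], after expanding the sum
    [c12 + c21]. *)
Lemma radial_bound (n c11 c22 c12 c21 c1 c2 r1 r2 X Y : R) :
  `|n| <= X -> `|r1| <= 1 -> `|r2| <= 1 ->
  `|c11| <= Y -> `|c22| <= Y -> `|c12| <= Y -> `|c21| <= Y -> `|c1| <= Y -> `|c2| <= Y ->
  `|n + (c11 + c22 - (r1 * r1 * c22 - r1 * r2 * (c12 + c21) + r2 * r2 * c11)
     + r1 * c1 + r2 * c2)| <= X + 8 * Y.
Proof.
move=> nX r1K r2K c11K c22K c12K c21K c1K c2K.
have rr (q1 q2 c : R) : `|q1| <= 1 -> `|q2| <= 1 -> `|c| <= Y -> `|q1 * q2 * c| <= Y.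
  by move=> h1 h2 h3; rewrite -mulrA; do 2 apply: norm_ratio_mul => //.
have := rr _ _ _ r1K r1K c22K; have := rr _ _ _ r1K r2K c12K.
have := rr _ _ _ r1K r2K c21K; have := rr _ _ _ r2K r2K c11K.
have := norm_ratio_mul r1K c1K; have := norm_ratio_mul r2K c2K.
rewrite mulrDr; move: c11K c22K nX {rr c12K c21K c1K c2K r1K r2K}.
move: (r1 * c1) (r2 * c2) (r1 * r1 * c22) (r1 * r2 * c12) (r1 * r2 * c21) (r2 * r2 * c11).
move=> e1 e2 e3 e4 e5 e6 {c1 c2 c12 c21 r1 r2}.
have nD (a b A B : R) : `|a| <= A -> `|b| <= B -> `|a + b| <= A + B.
  by move=> aA bB; apply: le_trans (ler_normD _ _) _; exact: lerD.
have nB (a b A B : R) : `|a| <= A -> `|b| <= B -> `|a - b| <= A + B.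
  by move=> aA bB; apply: le_trans (ler_normB _ _) _; exact: lerD.
move=> h1 h2 h3 k2 k1 k6 k5 k4 k3.
have := nD _ _ _ _ h3 (nD _ _ _ _ (nD _ _ _ _ (nB _ _ _ _ (nD _ _ _ _ h1 h2)
  (nD _ _ _ _ (nB _ _ _ _ k3 (nD _ _ _ _ k4 k5)) k6)) k1) k2).
by move/le_trans; apply; rewrite le_eqVlt; apply/orP; left; apply/eqP; ring.
Qed.

(** Of the 11 K, eight come from [radial_bound], two from solving for pd_t in terms of S, L_1, L_2,
    and one from solving L_a for pd_a. *)
Lemma ray_estimate (s0 s1 A B K : R) g : 1 < s0 -> 0 <= A -> 0 <= B -> 0 <= K ->
  slab s0 s1 `<=` U -> class_C 2 U g ->
  (forall p, slab s0 s1 p -> `|negbox g p| <= A * p.1 ^- 2) ->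
  (forall p, 0 < p.1 -> hyp_sq p = s0 ^+ 2 -> `|scaling g p| <= B / p.1) ->
  (forall p a, slab s0 s1 p -> val a != 0%N ->
    `|boost a g p| <= K * (Num.sqrt (hyp_sq p) / p.1)) ->
  (forall p a b, slab s0 s1 p -> val a != 0%N -> val b != 0%N ->
    `|boost a (boost b g) p| <= K * (Num.sqrt (hyp_sq p) / p.1)) ->
  forall p j, slab s0 s1 p -> `|Num.sqrt (hyp_sq p) * pd j g p| <= A + B + 11 * K.
Proof.
move=> s01 A0 B0 K0 SU cg nb ini b1 b2 p j Sp.
have s00 : 0 < s0 by lra.
have [p0 /andP[Hp1 Hp2]] := Sp.
set s := Num.sqrt (hyp_sq p).
have ss : s ^+ 2 = hyp_sq p by rewrite sqr_sqrtr// (le_trans _ Hp1)// sqr_ge0.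
have s_ge : s0 <= s.
  by rewrite -(ler_pXn2r (n := 2)) ?nnegrE ?sqrtr_ge0 ?ss// ltW.
have sgt0 : 0 < s by lra.
have sn : s != 0 by rewrite gt_eqF.
have tn : p.1 != 0 by rewrite gt_eqF.
have w1 : s / p.1 <= 1.
  rewrite ler_pdivrMr// mul1r -(ler_pXn2r (n := 2)) ?nnegrE ?(ltW sgt0) ?(ltW p0)//.
  by rewrite ss /hyp_sq lerBlDr lerDl sqr_ge0.
have w0 : 0 <= s / p.1 by rewrite divr_ge0// ltW.
(* the ray through p; s/t = 1/t' is constant along it *)
pose t := p.1 / s; pose x := p.2.1 / s; pose y := p.2.2 / s.
pose ga (z : R) : pt := (z * t, (z * x, z * y)).
have gas : ga s = p.
  by rewrite /ga /t /x /y ![s * (_ / s)]mulrC !divfK//; case: p {Sp p0 Hp1 Hp2 s ss s_ge sgt0 sn tn w1 w0 t x y ga} => ? [].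
have tgt0 : 0 < t by rewrite divr_gt0.
have hypga z : hyp_sq (ga z) = z ^+ 2.
  rewrite hyp_sqE /ga /t /x /y /=.
  have := ss; rewrite hyp_sqE => e.
  have -> : (z * (p.1 / s)) ^+ 2 - (z * (p.2.1 / s)) ^+ 2 - (z * (p.2.2 / s)) ^+ 2 =
    z ^+ 2 * (p.1 ^+ 2 - p.2.1 ^+ 2 - p.2.2 ^+ 2) / s ^+ 2 by field.
  by rewrite -e mulfK// expf_neq0.
have Sga z : s0 <= z <= s -> slab s0 s1 (ga z).
  move=> /andP[z1 z2]; split; first by rewrite /= mulr_gt0//; lra.
  rewrite hypga; apply/andP; split; first by rewrite ler_pXn2r ?nnegrE//; lra.
  by apply: le_trans Hp2; rewrite -ss ler_pXn2r ?nnegrE//; lra.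
have wga z : s0 <= z <= s -> Num.sqrt (hyp_sq (ga z)) / (ga z).1 = t^-1.
  move=> /andP[z1 z2]; rewrite hypga sqrtr_sqr gtr0_norm; last by lra.
  have zn : z != 0 by rewrite gt_eqF//; lra.
  have tn' : t != 0 by rewrite gt_eqF.
  by rewrite /=; field; rewrite zn tn'.
have t1 : t^-1 <= 1 by rewrite /t invf_div.
have ti0 : 0 <= t^-1 by rewrite invr_ge0 ltW.
have dG z : s0 <= z <= s ->
    is_derive z 1 (fun z => z * scaling g (ga z)) (scaling (scaling g) (ga z) + scaling g (ga z)).
  by move=> zs; apply: is_derive_ray => //; exact: SU (Sga z zs).
(* On the ray the time is [z * t] and the hyperbolic radius is [z], so the source contributes at
   most z^2 A / (z t)^2 = A / t^2, which is at most A / t because t >= 1 here. *)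
have bG z : s0 <= z <= s ->
    `|scaling (scaling g) (ga z) + scaling g (ga z)| <= (A + 8 * K) * t^-1.
  move=> zs; have Sz := Sga z zs; have [z0 Hz] := slab_fcone s00 Sz.
  rewrite (scaling_scaling oU cg (SU _ Sz) _); last by rewrite gt_eqF.
  have n1 : `|hyp_sq (ga z) * negbox g (ga z)| <= A * t^-1.
    rewrite normrM hypga [`|_ ^+ 2|]ger0_norm ?sqr_ge0//.
    apply: le_trans (ler_wpM2l (sqr_ge0 _) (nb _ Sz)) _ => /=.
    have zn : z != 0 by rewrite gt_eqF//; case/andP: zs; lra.
    have tn' : t != 0 by rewrite gt_eqF.
    have -> : z ^+ 2 * (A * (z * t) ^- 2) = A * (t^-1 * t^-1) by field; rewrite zn tn'.
    by apply: ler_wpM2l => //; apply: ler_piMl.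
  have bb a b : val a != 0%N -> val b != 0%N -> `|boost a (boost b g) (ga z)| <= K * t^-1.
    by move=> a0 b0; rewrite -(wga z zs); exact: b2.
  have b a : val a != 0%N -> `|boost a g (ga z)| <= K * t^-1.
    by move=> a0; rewrite -(wga z zs); exact: b1.
  have r a := slab_ratio s01 a Sz.
  have [b11 b12 b21 b22] := And4 (bb 1 1 isT isT) (bb 1 2 isT isT) (bb 2 1 isT isT) (bb 2 2 isT isT).
  rewrite [(A + _) * _]mulrDl -[8 * K * _]mulrA.
  exact: (radial_bound n1 (r 1) (r 2) b11 b22 b12 b21 (b 1 isT) (b 2 isT)).
have tiE : t^-1 = s / p.1 by rewrite /t invf_div.
(* Integration from s0 to s gives a bound linear in s for s S g, hence a bound for S g itself. The
   initial value is at most B / t, which is absorbed since s > 1. *)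
have sS : `|scaling g p| <= (A + B + 8 * K) * (s / p.1).
  rewrite -tiE -(ler_pM2l sgt0) -[s in s * `|_|]gtr0_norm// -normrM.
  have i0 : `|s0 * scaling g (ga s0)| <= B * t^-1.
    rewrite normrM gtr0_norm//.
    have g0 : 0 < (ga s0).1 by rewrite /= mulr_gt0.
    apply: le_trans (ler_wpM2l (ltW s00) (ini _ g0 (hypga s0))) _ => /=.
    have s0n : s0 != 0 by rewrite gt_eqF.
    have tn' : t != 0 by rewrite gt_eqF.
    by rewrite le_eqVlt; apply/orP; left; apply/eqP; field; rewrite s0n tn'.
  have BT0 : 0 <= B * t^-1 by exact: mulr_ge0.
  have AK0 : 0 <= (A + 8 * K) * t^-1 by rewrite mulr_ge0// addr_ge0// mulr_ge0.
  have BTs : B * t^-1 <= s * (B * t^-1) by rewrite ler_peMl//; lra.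
  have splitE : s * ((A + B + 8 * K) * t^-1) = s * (B * t^-1) + s * ((A + 8 * K) * t^-1).
    by ring.
  (* The mean value theorem requires a nondegenerate interval; on the initial hyperboloid itself the
     initial bound is enough. *)
  have [e|ne] := eqVneq s0 s.
    have -> : s * scaling g p = s0 * scaling g (ga s0) by rewrite e gas.
    apply: le_trans i0 _; rewrite splitE.
    have : 0 <= s * ((A + 8 * K) * t^-1) by rewrite mulr_ge0// ltW.
    by lra.
  have lt : s0 < s by rewrite lt_neqAle ne.
  have [c cs E] := MVT_cc lt dG.
  move: E; rewrite gas => E.
  have : `|s * scaling g p - s0 * scaling g (ga s0)| <= (A + 8 * K) * t^-1 * s.
    rewrite E normrM [`|s - s0|]gtr0_norm ?subr_gt0//.
    apply: ler_pM; [exact: normr_ge0|by rewrite subr_ge0 ltW|exact: bG|].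
    by rewrite lerBlDr lerDl ltW.
  move: i0; rewrite splitE [s * ((A + 8 * K) * _)]mulrC.
  move: (s * scaling g p) (s0 * scaling g (ga s0)) => X4 X5 h5 h45.
  rewrite -[X4](subrK X5) addrC; apply: (le_trans (ler_normD _ _)); apply: lerD => //.
  exact: le_trans BTs.
have r a := slab_ratio s01 a Sp.
have l1 := b1 p 1 Sp isT; have l2 := b1 p 2 Sp isT.
have w0' : s / p.1 != 0 by rewrite mulf_neq0// invr_eq0.
have d0 : `|s * pd 0 g p| <= A + B + 10 * K.
  (* The identity S - (x_1/t) L_1 - (x_2/t) L_2 = (s^2/t) pd_t. *)
  have -> : s * pd 0 g p = (s / p.1)^-1 *
      (scaling g p + (- (ratio 1 p * boost 1 g p)) + (- (ratio 2 p * boost 2 g p))).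
    rewrite /scaling /boost /ratio /Defs.coord /=.
    generalize (pd 0 g p), (pd 1 g p), (pd 2 g p) => g0 g1 g2.
    have -> : p.1 * g0 + p.2.1 * g1 + p.2.2 * g2
        + - (p.2.1 / p.1 * (p.2.1 * g0 + p.1 * g1))
        + - (p.2.2 / p.1 * (p.2.2 * g0 + p.1 * g2)) = s ^+ 2 / p.1 * g0.
      by rewrite ss hyp_sqE; field.
    by field; rewrite tn sn.
  have wgt0 : 0 < s / p.1 by rewrite lt_neqAle eq_sym w0'.
  rewrite normrM gtr0_norm ?invr_gt0// ler_pdivrMl//.
  have -> : s / p.1 * (A + B + 10 * K) = (A + B + 8 * K) * (s / p.1)
    + K * (s / p.1) + K * (s / p.1) by ring.
  have := norm_ratio_mul (r 1) l1; have := norm_ratio_mul (r 2) l2.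
  move: sS; generalize (scaling g p), (ratio 1 p * boost 1 g p), (ratio 2 p * boost 2 g p).
  move=> c0 c1 c2 h0 h2 h1.
  by apply: norm_le3; [exact: h0|rewrite normrN; exact: h1|rewrite normrN; exact: h2].
have K1 : K * (s / p.1) <= K by exact: ler_piMr.
have da a : val a != 0%N -> `|s * pd a g p| <= A + B + 11 * K.
  move=> a0.
  have -> : s * pd a g p = s / p.1 * boost a g p + - (ratio a p * (s * pd 0 g p)).
    rewrite boostE /ratio (negbTE a0).
    generalize (pd 0 g p), (pd a g p) => g0 ga'.
    by field.
  apply: (le_trans (ler_normD _ _)); rewrite normrN.
  have -> : A + B + 11 * K = K + (A + B + 10 * K) by ring.
  apply: lerD; last exact: norm_ratio_mul.
  apply: norm_ratio_mul; first by rewrite ger0_norm.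
  by apply: le_trans K1; exact: b1.
have [j0|j0] := eqVneq (val j) 0%N; last exact: da.
have -> : j = 0 by exact: val_inj.
have le : A + B + 10 * K <= A + B + 11 * K by rewrite lerD2l ler_wpM2r// ler_nat.
exact: (le_trans d0 le).
Qed.

End RayEstimate.

(** * Derivative bounds for a family of solutions *)

Section Assembly.
Context (R : realType).
Notation pt := (R * (R * R))%type.
Implicit Types (p : pt).

Lemma fin_uniform (F : finType) (P : F -> R -> Prop) :
  (forall x M M', M <= M' -> P x M -> P x M') -> (forall x, exists M, P x M) ->
  exists2 M, 0 <= M & forall x, P x M.
Proof.
move=> Pmono /choice[m Pm]; exists (\sum_x `|m x|); first exact: sumr_ge0.
move=> x; apply: Pmono (Pm x); apply: (le_trans (ler_norm _)).
by rewrite (bigD1 x)//= lerDl sumr_ge0.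
Qed.

Variables (s0 : R) (s01 : 1 < s0) (T : Type) (s1 : T -> R) (U : T -> set pt).
Hypotheses (oU : forall i, open (U i)) (Ufcone : forall i, U i `<=` @fcone R).
Arguments oU : clear implicits.
Hypotheses (s1_ge : forall i, s0 <= s1 i) (slabU : forall i, slab s0 (s1 i) `<=` U i).
Variables (N : nat) (A : R) (A0 : 0 <= A) (f phi : T -> pt -> R) (u0 u1 : R * R -> R).
Hypothesis cphi : forall i, class_C N.+4 (U i) (phi i).
Hypothesis phif : forall i p, U i p -> negbox (phi i) p = f i p.
Hypotheses (cu0 : forall n, class_C n setT u0) (cu1 : forall n, class_C n setT u1).
Hypothesis phi_data : forall i x, phi i (on_hyp s0 x) = u0 x.
Hypothesis dphi_data : forall i x, pd 0 (phi i) (on_hyp s0 x) = u1 x.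
Hypothesis phi_cone : forall i p, U i p -> ~ cone p -> phi i p = 0.
Hypothesis phi_bd : forall i, vanishes_near_bd_cone (U i) (phi i).
Hypothesis f_bound : forall i a b c d e, (a + b + c + d + e <= N)%N ->
  forall p, cone_slab s0 (s1 i) p -> `|Zn a b c d e (f i) p| <= A * p.1 ^- 2.

Let s00 : 0 < s0. Proof. exact: lt_trans ltr01 s01. Qed.

Let time_neq0 i p : U i p -> p.1 != 0.
Proof. by move=> /Ufcone[t0 _]; rewrite gt_eqF. Qed.

Let zboost n h (a : 'I_3) : val a != 0%N -> zspan U phi n h -> (n < N.+4)%N ->
  zspan U phi n.+1 (fun i => boost a (h i)).
Proof.
move=> a0 zh nk; have aE : a = 1 \/ a = 2.
  by case: a a0 => [[|[|[|//]]] i] // _; [left|right]; exact: val_inj.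
by case: aE => ->; [exact: (zspan_boost1 oU time_neq0 cphi zh nk)
  |exact: (zspan_boost2 oU time_neq0 cphi zh nk)].
Qed.

Let zbound n h : zspan U phi n h -> (n <= N)%N -> exists M, forall i p,
  slab s0 (s1 i) p -> `|h i p| <= M * (Num.sqrt (hyp_sq p) / p.1).
Proof.
exact: (zspan_slab_bound s01 oU Ufcone s1_ge slabU A0 cphi phif cu0 cu1 phi_data
  dphi_data phi_cone phi_bd f_bound).
Qed.

Let w_ge0 i p : slab s0 (s1 i) p -> 0 <= Num.sqrt (hyp_sq p) / p.1.
Proof. by move=> [p0 _]; rewrite divr_ge0 ?sqrtr_ge0// ltW. Qed.

(** Inside the cone, t and the |x_a| are at most s0^2 on H_{s0}. This bounds S by three terms s0^2 M
    and also turns a constant into a multiple of 1/t. Outside the cone all derivatives vanish. *)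
Lemma scaling_initial_bound a b c d e : (a + b + c + d + e <= N)%N ->
  exists2 M, 0 <= M & forall i p, 0 < p.1 -> hyp_sq p = s0 ^+ 2 ->
    `|scaling (Zn a b c d e (phi i)) p| <= M / p.1.
Proof.
move=> le; have [M M0 bM] := cut_Zn_bound s01 oU Ufcone s1_ge slabU A0 cphi phif
  cu0 cu1 phi_data dphi_data f_bound le.
pose B := s0 ^+ 2 * M + s0 ^+ 2 * M + s0 ^+ 2 * M.
have sM : 0 <= s0 ^+ 2 * M by rewrite mulr_ge0// sqr_ge0.
have B0 : 0 <= B by rewrite !addr_ge0.
exists (B * s0 ^+ 2); first by rewrite mulr_ge0// sqr_ge0.
move=> i p p0 Hp; have [cp|np] := pselect (cone p); last first.
  have Up := slabU (cut_slab s01 s1_ge i p0 Hp).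
  have [_ [z _]] := Zn_vanish oU phi_cone phi_bd a b c d e Up np.
  rewrite /scaling (z 0) (z 1) (z 2) !mulr0 !addr0 normr0.
  by rewrite divr_ge0 ?mulr_ge0 ?sqr_ge0// ltW.
have Cp : cut s0 p by [].
have [_ t2] := andP (cut_time Cp).
have [_ bp] := bM i p Cp.
have b3 j : `|Defs.coord j p * pd j (Zn a b c d e (phi i)) p| <= s0 ^+ 2 * M.
  by rewrite normrM; apply: ler_pM => //; exact: cut_coord.
have bB : `|scaling (Zn a b c d e (phi i)) p| <= B.
  exact: (norm_le3 (b3 0) (b3 1) (b3 2)).
apply: (le_trans bB); rewrite -mulrA; apply: ler_peMr => //.
by rewrite ler_pdivlMr// mul1r ltW.
Qed.

Lemma derivative_bound a b c d e : (a + b + c + d + e + 2 <= N)%N ->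
  exists M, forall i p, slab s0 (s1 i) p ->
    forall j, `|Num.sqrt (hyp_sq p) * pd j (Zn a b c d e (phi i)) p| <= M.
Proof.
move=> le; have le0 : (a + b + c + d + e <= N)%N by lia.
set n := (a + b + c + d + e)%N.
pose psi i := Zn a b c d e (phi i).
have zpsi : zspan U phi n psi by exact: zspan_Z.
have [B B0 bB] := scaling_initial_bound le0.
(* The restriction to spatial indices is placed inside the predicate, so that [fin_uniform] can
   range over all of ['I_3]. *)
pose P1 (j : 'I_3) M := val j != 0%N -> forall i p, slab s0 (s1 i) p ->
  `|boost j (psi i) p| <= M * (Num.sqrt (hyp_sq p) / p.1).
have m1 j M M' : M <= M' -> P1 j M -> P1 j M'.
  move=> MM' bM j0 i p Sp; apply: le_trans (bM j0 i p Sp) _.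
  by apply: ler_wpM2r => //; exact: w_ge0 Sp.
have e1 j : exists M, P1 j M.
  have [j0|j0] := boolP (val j != 0%N); last by exists 0 => j1; rewrite j1 in j0.
  have nk : (n < N.+4)%N by lia.
  have nN : (n.+1 <= N)%N by lia.
  have [M bM] := zbound (zboost j0 zpsi nk) nN.
  by exists M => _; exact: bM.
have [K1 K10 bK1] := fin_uniform m1 e1.
pose P2 (j : 'I_3 * 'I_3) M := val j.1 != 0%N -> val j.2 != 0%N ->
  forall i p, slab s0 (s1 i) p ->
  `|boost j.1 (boost j.2 (psi i)) p| <= M * (Num.sqrt (hyp_sq p) / p.1).
have m2 j M M' : M <= M' -> P2 j M -> P2 j M'.
  move=> MM' bM j0 j0' i p Sp; apply: le_trans (bM j0 j0' i p Sp) _.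
  by apply: ler_wpM2r => //; exact: w_ge0 Sp.
have e2 j : exists M, P2 j M.
  case: j => u v; rewrite /P2 /=.
  have [u0'|u0'] := boolP (val u != 0%N); last by exists 0 => j1; case/negP: u0'.
  have [v0|v0] := boolP (val v != 0%N); last by exists 0 => _ j1; case/negP: v0.
  have nk : (n < N.+4)%N by lia.
  have nk' : (n.+1 < N.+4)%N by lia.
  have nN : (n.+2 <= N)%N by lia.
  have [M bM] := zbound (zboost u0' (zboost v0 zpsi nk) nk') nN.
  by exists M => _ _; exact: bM.
have [K2 K20 bK2] := fin_uniform m2 e2.
exists (A + B + 11 * (K1 + K2)) => i p Sp j.
have cpsi : class_C 2 (U i) (psi i).
  by apply: class_C_Zn => //; apply: class_C_leq (cphi i); lia.
apply: (ray_estimate (oU i) s01 A0 B0 (addr_ge0 K10 K20) (@slabU i) cpsi _ _ _ _ j Sp).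
- move=> q Sq; exact: (negbox_Zn_bound s01 oU slabU A0 cphi phif phi_cone phi_bd f_bound le0 Sq).
- by move=> q q0 Hq; exact: bB.
- move=> q u Sq u0'; apply: le_trans (bK1 u u0' i q Sq) _.
  by apply: ler_wpM2r; [exact: w_ge0 Sq|rewrite lerDl].
- move=> q u v Sq u0' v0; apply: le_trans (bK2 (u, v) u0' v0 i q Sq) _.
  by apply: ler_wpM2r; [exact: w_ge0 Sq|rewrite lerDr].
Qed.

End Assembly.

(** * Conclusion *)

Section Uniformity.
Context (R : realType).
Notation pt := (R * (R * R))%type.
Implicit Types (p : pt).

(** The family bounds are instantiated with [T] the type of all admissible quadruples (s1, U, f,
    phi), so the constant they produce is chosen before the solution. *)
Lemma uniform_derivative_bound (N : nat) (s0 A : R) (phi0 phi1 : R * R -> R) :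
  1 < s0 -> 0 < A -> cauchy_datum s0 phi0 -> cauchy_datum s0 phi1 ->
  exists M, forall s1 (U : set pt) (f phi : pt -> R), s0 <= s1 ->
    cauchy_solution N.+4 s0 s1 U f phi phi0 phi1 ->
    (forall I, (mlen I <= N)%N ->
      forall p, cone_slab s0 s1 p -> `|Z I f p| <= A * p.1 ^- 2) ->
    forall I, (mlen I + 2 <= N)%N -> forall p, slab s0 s1 p ->
    forall j, `|Num.sqrt (hyp_sq p) * pd j (Z I phi) p| <= M.
Proof.
move=> s01 A0 [c0 _ _] [c1 _ _]; have s00 : 0 < s0 by lra.
pose admissible (d : R * set pt * (pt -> R) * (pt -> R)) :=
  let: (s1, U, f, phi) := d in
  [/\ s0 <= s1, cauchy_solution N.+4 s0 s1 U f phi phi0 phi1 &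
    forall I, (mlen I <= N)%N ->
      forall p, cone_slab s0 s1 p -> `|Z I f p| <= A * p.1 ^- 2].
pose T := {d | admissible d}.
pose s1_ (i : T) := (sval i).1.1.1.
(* The intersection with the open future cone keeps the slab and makes t nonzero and t^2 - r^2
   positive, so that the coefficients 1/t and 1/(t^2 - r^2) are smooth. *)
pose U_ (i : T) := (sval i).1.1.2 `&` @fcone R.
pose f_ (i : T) := (sval i).1.2.
pose phi_ (i : T) := (sval i).2.
have ad (i : T) : [/\ s0 <= s1_ i,
    cauchy_solution N.+4 s0 (s1_ i) (sval i).1.1.2 (f_ i) (phi_ i) phi0 phi1 &
    forall I, (mlen I <= N)%N -> forall p, cone_slab s0 (s1_ i) p ->
      `|Z I (f_ i) p| <= A * p.1 ^- 2].
  by rewrite /s1_ /f_ /phi_; case: i => [[[[? ?] ?] ?]].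
have oU i : open (U_ i).
  by have [_ [[oU _] _ _ _ _] _] := ad i; apply: openI => //; exact: open_fcone.
have Ufcone i : U_ i `<=` @fcone R by move=> p [].
have s1_ge i : s0 <= s1_ i by have [] := ad i.
have slabU i : slab s0 (s1_ i) `<=` U_ i.
  have [_ [[_ SU] _ _ _ _] _] := ad i; move=> p Sp; split; first exact: SU.
  exact: slab_fcone Sp.
have cphi i : class_C N.+4 (U_ i) (phi_ i).
  by have [_ [_ cU _ _ _] _] := ad i; apply: class_C_sub cU => p [].
have phif i p : U_ i p -> negbox (phi_ i) p = f_ i p.
  by have [_ [_ _ _ E _] _] := ad i; move=> [Up _]; exact: E.
have d0 i x : phi_ i (on_hyp s0 x) = phi0 x.
  by have [_ [_ _ _ _ D] _] := ad i; have [] := D x.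
have d1 i x : pd 0 (phi_ i) (on_hyp s0 x) = phi1 x.
  by have [_ [_ _ _ _ D] _] := ad i; have [] := D x.
have pc i p : U_ i p -> ~ cone p -> phi_ i p = 0.
  by have [_ [_ _ [V _] _ _] _] := ad i; move=> [Up _]; exact: V.
have pb i : vanishes_near_bd_cone (U_ i) (phi_ i).
  have [_ [_ _ [_ V] _ _] _] := ad i; move=> p bp.
  by apply: filterS (V p bp) => q qV [Uq _]; exact: qV.
have fb i a b c d e : (a + b + c + d + e <= N)%N -> forall p,
    cone_slab s0 (s1_ i) p -> `|Zn a b c d e (f_ i) p| <= A * p.1 ^- 2.
  move=> le; have [_ _ F] := ad i.
  apply: (F (fun j => nth 0%N [:: a; b; c; d; e] j)).
  by rewrite mlenE.
have DB := derivative_bound s01 oU Ufcone s1_ge slabU (ltW A0) cphi phif c0 c1 d0 d1 pc pb fb.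
(* A multi-index of length at most N has entries at most N, so it is a function between finite types
   and one constant serves all of them; [inord] below makes this conversion. *)
pose P (I : {ffun 'I_5 -> 'I_N.+1}) M := (mlen (fun j => I j) + 2 <= N)%N ->
  forall i p, slab s0 (s1_ i) p ->
  forall j, `|Num.sqrt (hyp_sq p) * pd j (Z (fun j => I j) (phi_ i)) p| <= M.
have Pmono I M M' : M <= M' -> P I M -> P I M'.
  by move=> MM' bM le i p Sp j; apply: le_trans MM'; exact: bM.
have Pex I : exists M, P I M.
  have [le|le] := boolP (mlen (fun j => I j) + 2 <= N)%N; last first.
    by exists 0 => le'; case/negP: le.
  have [M bM] : exists M, forall i p, slab s0 (s1_ i) p ->
      forall j, `|Num.sqrt (hyp_sq p) * pd j (Z (fun j => I j) (phi_ i)) p| <= M.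
    by apply: DB; move: le; rewrite mlenE.
  by exists M => _; exact: bM.
have [M _ bM] := fin_uniform Pmono Pex.
exists M => s1 U f phi s1g sol fA I le p Sp j.
have [i [s1E phiE]] : exists i : T, s1_ i = s1 /\ phi_ i = phi.
  have adm : admissible (s1, U, f, phi) by split.
  by exists (exist _ _ adm).
have IN k : (I k <= N)%N.
  apply: leq_trans (leq_trans (leq_addr 2 _) le).
  by rewrite /mlen (bigD1 k)//= leq_addr.
have IE : I = (fun j => [ffun j => inord (I j) : 'I_N.+1] j : nat).
  by apply/funext => k; rewrite ffunE inordK ?ltnS.
rewrite IE -phiE; apply: bM; last by rewrite s1E.
by rewrite -IE.
Qed.

End Uniformity.

Theorem proposition3p9 (R : realType) (N0 : nat) (hN0 : (2 <= N0)%N)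
    (s0 : R) (hs0 : 1 < s0) :
  exists (k : nat) (C : R)
         (D : R -> R -> (R * R -> R) -> (R * R -> R) -> R),
    0 < C /\
    forall (s1 : R) (A B : R) (phi0 phi1 : R * R -> R)
           (U : set (R * (R * R))) (f phi : R * (R * R) -> R),
      s0 <= s1 -> 0 < A -> 0 < B ->
      cauchy_datum s0 phi0 -> cauchy_datum s0 phi1 ->
      cauchy_solution k s0 s1 U f phi phi0 phi1 ->
      vanishes_near_bd_cone U f ->
      (forall I : 'I_5 -> nat, (mlen I <= N0)%N ->
         (forall p, cone_slab s0 s1 p -> `|Z I f p| <= A * p.1 ^- 2) /\
         (forall tau, s0 <= tau <= s1 ->
            (Lpf 2 tau (Z I f) <= (B * tau^-1)%:E)%E)) ->
      forall I : 'I_5 -> nat, (mlen I <= N0 - 2)%N ->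
        forall p, cone_slab s0 s1 p ->
          let t := p.1 in
          let r := eucl_len p.2 in
          let s := Num.sqrt (t ^+ 2 - r ^+ 2) in
          \sum_(a < 3) `|s * pd a (Z I phi) p|
            + \sum_(a < 3) `|(t - r) * (t / s) * pd a (Z I phi) p|
          <= C * D A B phi0 phi1.
Proof.
(* The solution, its domain and s1 are quantified inside [bounds], so a constant selected from it
   depends only on the arguments of [bounds], with N0 and s0 fixed. *)
pose bounds A (B : R) phi0 phi1 (M : R) := forall s1 U f phi, s0 <= s1 ->
  cauchy_solution N0.+4 s0 s1 U f phi phi0 phi1 ->
  (forall I, (mlen I <= N0)%N ->
    forall p, cone_slab s0 s1 p -> `|Z I f p| <= A * p.1 ^- 2) ->
  forall I, (mlen I + 2 <= N0)%N -> forall p, slab s0 s1 p ->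
  forall j, `|Num.sqrt (hyp_sq p) * pd j (Z I phi) p| <= M.
(* [get] picks an admissible bound when there is one. *)
exists N0.+4, 6, (fun A B phi0 phi1 => get [set M | bounds A B phi0 phi1 M]).
split=> // s1 A B phi0 phi1 U f phi s01 A0 B0 d0 d1 sol _ fAB I le p [cp Hp] /=.
set t := p.1; set r := eucl_len p.2; set s := Num.sqrt _.
have : exists M, bounds A B phi0 phi1 M.
  by have [M bM] := uniform_derivative_bound N0 hs0 A0 d0 d1; exists M.
move=> /(getPex (P := [set M | bounds A B phi0 phi1 M])); move: (get _) => M /= bM.
have s0gt0 : 0 < s0 by lra.
have r0 : 0 <= r := eucl_len_ge0 p.2.
have rt : r < t - 1 := cp.
have Sp : slab s0 s1 p by split=> //; rewrite -/t; lra.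
have bj j : `|s * pd j (Z I phi) p| <= M.
  apply: (bM s1 U f phi s01 sol _ I _ p Sp j); last by lia.
  by move=> J JN; have [+ _] := fAB J JN.
have ss : s ^+ 2 = (t - r) * (t + r).
  rewrite sqr_sqrtr; first by ring.
  by case/andP: Hp => + _; apply: le_trans; exact: sqr_ge0.
have sgt0 : 0 < s.
  rewrite sqrtr_gt0; case/andP: Hp => + _; apply: lt_le_trans.
  by rewrite exprn_gt0.
(* The second weight is dominated by the first: (t - r) t <= (t - r) (t + r) = s^2, that is, (t - r)
   (t/s) <= s. *)
have cj j : `|(t - r) * (t / s) * pd j (Z I phi) p| <= M.
  apply: le_trans (bj j); rewrite !normrM; apply: ler_wpM2r => //.
  rewrite -!normrM ger0_norm; last by rewrite mulr_ge0 ?divr_ge0//; lra.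
  rewrite ger0_norm ?(ltW sgt0)// mulrA ler_pdivrMr// -expr2 ss.
  by apply: ler_wpM2l; lra.
have sum3 (F : 'I_3 -> R) : (forall j, F j <= M) -> \sum_(j < 3) F j <= 3 * M.
  move=> FM; apply: (le_trans (ler_sum _ (fun j _ => FM j))).
  by rewrite sumr_const card_ord mulr_natl.
have -> : 6 * M = 3 * M + 3 * M by ring.
by apply: lerD; exact: sum3.
Qed.
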